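(* Let $H>\frac12$ and let $Y$ be the positive process defined by $$dY_t=\left(\frac{\kappa}{Y_t^{\frac{\alpha}{1-\alpha}}}-\frac{\alpha\nu_1^2}{2(1-\alpha)Y_t}-\theta Y_t\right)dt+\nu_1\,dB_t+\nu_2\,dB^H_t,\qquad t\in[0,T].$$ Then the process $X_t:=Y_t^{\frac1{1-\alpha}}$, $t\in[0,T]$, a.s. satisfies the SDE of the form $$dX_t=\left(\frac{\kappa}{1-\alpha}-\frac{\theta}{1-\alpha}X_t\right)dt+\frac{\nu_1}{1-\alpha}X_t^\alpha\,dB_t+\frac{\nu_2}{1-\alpha}X_t^\alpha\,dB^H_t,$$ where the integral with respect to $B$ is the regular Itô integral (w.r.t. the filtration generated jointly by $(B,B^H)$) and the integral with respect to $B^H$ is understood as the $L^2$-limit of Riemann–Stieltjes integral sums.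
   Context: $T>0$ is fixed; $\kappa,\theta,\nu_1,\nu_2$ are positive constants; $B=\{B_t,\ t\in[0,T]\}$ is a standard Wiener process; $B^H=\{B^H_t,\ t\in[0,T]\}$ is a fractional Brownian motion with Hurst index $H\in(0,1)$, independent of $B$; $\alpha\in\left(\frac12,1\right)$ is such that $\left(H\wedge\frac12\right)+\alpha>1$. The initial value $Y_0>0$ is a deterministic constant. The SDE for $Y$ is understood pathwise as $Y_t=Y_0+\int_0^t b(Y_s)\,ds+Z_t$ with $Z=\nu_1B+\nu_2B^H$ and $b(y)=\kappa y^{-\frac{\alpha}{1-\alpha}}-\frac{\alpha\nu_1^2}{2(1-\alpha)y}-\theta y$; it has a unique solution on $[0,T]$, which is positive and has moments of all real orders. The Riemann–Stieltjes integral sums for $\int_0^tX_s^\alpha\,dB^H_s$ are $\sum_{k=0}^{n-1}X^\alpha_{t_k}(B^H_{t_{k+1}}-B^H_{t_k})$ over partitions $0=t_0<\dots<t_n=t$, with the limit taken as $\max_k(t_{k+1}-t_k)\to0$. *)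

(* Defs.v *)
From HB Require Import structures.
From mathcomp Require Import all_boot all_order all_algebra.
From mathcomp Require Import all_classical all_reals all_analysis.

Set Implicit Arguments.
Unset Strict Implicit.
Unset Printing Implicit Defensive.
Import Order.TTheory GRing.Theory Num.Theory.
Import numFieldNormedType.Exports.

Local Open Scope classical_set_scope.
Local Open Scope ring_scope.

(* A process is a family R -> {RV P >-> R}; its values outside of the time
   interval [0, T] are irrelevant and never constrained. *)

Section processes.
Context d (Om : measurableType d) (R : realType) (P : probability Om R).
Local Notation mu := (@lebesgue_measure R).

(* The law N(0, v).  The case v = 0 is separate because the library's
   [normal_prob 0 0] is the uniform law on [0, 1], not a Dirac mass. *)
Definition centered_normal (v : R) (E : set R) : \bar R :=
  if v == 0 then \d_(0 : R) E else normal_prob 0 (Num.sqrt v) E.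

Definition has_law_N0 (f : Om -> R) (v : R) :=
  forall E : set R, measurable E -> P (f @^-1` E) = centered_normal v E.

Definition continuous_paths (T : R) (X : R -> Om -> R) :=
  {ae P, forall w, {within `[0, T], continuous (X ^~ w)}}.

Definition wiener_process (T : R) (B : R -> {RV P >-> R}) :=
  [/\ {ae P, forall w, B 0 w = 0},
      (forall s t, 0 <= s -> s <= t -> t <= T ->
         has_law_N0 (fun w => B t w - B s w) (t - s)),
      (forall (n : nat) (t : nat -> R) (E : nat -> set R),
         0 <= t 0%N -> t n <= T ->
         (forall k, (k < n)%N -> t k <= t k.+1) ->
         (forall k, (k < n)%N -> measurable (E k)) ->
         P [set w | forall k, (k < n)%N -> E k (B (t k.+1) w - B (t k) w)] =
         (\prod_(k < n) P [set w | E k (B (t k.+1) w - B (t k) w)%R])%E) &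
      continuous_paths T B].

Definition centered_gaussian_process (T : R) (G : R -> {RV P >-> R}) :=
  forall (n : nat) (a t : 'I_n -> R), (forall i, 0 <= t i <= T) ->
    exists2 v, 0 <= v & has_law_N0 (fun w => \sum_(i < n) a i * G (t i) w) v.

Definition fractional_brownian_motion (T H : R) (G : R -> {RV P >-> R}) :=
  [/\ centered_gaussian_process T G,
      (forall s t, 0 <= s <= T -> 0 <= t <= T ->
         covariance P (G s) (G t) =
         ((t `^ (2 * H) + s `^ (2 * H) - `|t - s| `^ (2 * H)) / 2)%:E) &
      continuous_paths T G].

Definition history (X : R -> Om -> R) (t : R) : set (set Om) :=
  \bigcup_(s in `[0, t]) preimage_set_system setT (X s) measurable.

Definition joint_filtration (X Y : R -> Om -> R) (t : R) : set (set Om) :=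
  <<s history X t `|` history Y t >>.

Definition independent_processes (T : R) (X Y : R -> Om -> R) :=
  forall A C, <<s history X T >> A -> <<s history Y T >> C ->
    P (A `&` C) = (P A * P C)%E.

Definition sq_dist (f g : Om -> R) : \bar R :=
  'E_P[fun w => (f w - g w) ^+ 2].

(* [grid] lists the partition points except the first one; the intervals of
   the partition are ]left_node a grid k, right_node a grid k]. *)
Definition left_node (a : R) (grid : seq R) (k : nat) : R :=
  nth a (a :: grid) k.
Definition right_node (a : R) (grid : seq R) (k : nat) : R := nth a grid k.

Record simple_process (F : R -> set (set Om)) (T : R) := SimpleProcess {
  sp_grid : seq R;
  sp_coef : nat -> Om -> R;
  sp_gridP : itv_partition 0 T sp_grid;
  sp_adapted : forall k, (k < size sp_grid)%N ->
    forall E : set R, measurable E ->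
      F (left_node 0 sp_grid k) (sp_coef k @^-1` E);
  sp_bounded : exists M : R, forall k w, (k < size sp_grid)%N ->
    `|sp_coef k w| <= M }.

Definition sp_val F T (V : simple_process F T) (s : R) (w : Om) : R :=
  \sum_(k < size (sp_grid V)) sp_coef V k w *
    \1_(`]left_node 0 (sp_grid V) k, right_node 0 (sp_grid V) k]%classic) s.

Definition sp_integral F T (V : simple_process F T) (B : R -> Om -> R)
    (t : R) (w : Om) : R :=
  \sum_(k < size (sp_grid V)) sp_coef V k w *
    (B (Num.min (right_node 0 (sp_grid V) k) t) w
     - B (Num.min (left_node 0 (sp_grid V) k) t) w).

(* [I] is the Ito integral process t |-> \int_0^t phi dB, 0 <= t <= T, with
   respect to the filtration F, in its continuous version: phi is the limit in
   L^2(dt x dP) of bounded simple F-adapted processes whose elementary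
   integrals converge to I_t in L^2(P).  The expectation is taken before the
   time integral, so that only each phi s, and not the pair (s, w), has to be
   measurable on the nose; for a.s. continuous phi both orders agree. *)
Definition is_ito_integral (F : R -> set (set Om)) (T : R)
    (B phi : R -> Om -> R) (I : R -> {RV P >-> R}) :=
  (exists V : nat -> simple_process F T,
     (\int[mu]_(s in `[0%R, T]) sq_dist (phi s) (sp_val (V n) s))%E
       @[n --> \oo] --> 0%E /\
     forall t, 0 <= t <= T ->
       sq_dist (I t) (sp_integral (V n) B t) @[n --> \oo] --> 0%E) /\
  continuous_paths T I.

Definition riemann_stieltjes_sum (phi G : R -> Om -> R) (grid : seq R)
    (w : Om) : R :=
  \sum_(k < size grid) phi (left_node 0 grid k) w *
    (G (right_node 0 grid k) w - G (left_node 0 grid k) w).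

Definition is_L2_riemann_stieltjes_integral (phi G : R -> Om -> R) (t : R)
    (J : {RV P >-> R}) :=
  (J : Om -> R) \in Lfun P 2%:E /\
  forall eps : R, 0 < eps -> exists2 delta : R, 0 < delta &
    forall grid : seq R, itv_partition 0 t grid ->
      (forall k, (k < size grid)%N ->
         right_node 0 grid k - left_node 0 grid k < delta) ->
      (sq_dist (riemann_stieltjes_sum phi G grid) J < eps%:E)%E.

End processes.

Section equations.
Context {R : realType}.

Definition drift (kappa theta nu1 alpha y : R) : R :=
  kappa / y `^ (alpha / (1 - alpha))
  - alpha * nu1 ^+ 2 / (2 * (1 - alpha) * y) - theta * y.

(* Pathwise solution, a.s. positive.  Integrability of the drift along the
   path is part of the equation (the real-valued integral is a junk value
   otherwise). *)
Definition positive_solution d (Om : measurableType d) (P : probability Om R)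
    (T kappa theta nu1 nu2 alpha Y0 : R) (B BH Y : R -> {RV P >-> R}) :=
  {ae P, forall w,
    (@lebesgue_measure R).-integrable `[0, T]
       (fun s => (drift kappa theta nu1 alpha (Y s w))%:E) /\
    forall t, 0 <= t <= T ->
      0 < Y t w /\
      Y t w = Y0
        + \int[lebesgue_measure]_(s in `[0, t])
            drift kappa theta nu1 alpha (Y s w)
        + (nu1 * B t w + nu2 * BH t w)}.

End equations.

(* Main.v *)
Require Import Defs.
From HB Require Import structures.
From mathcomp Require Import all_boot all_order all_algebra.
From mathcomp Require Import all_classical all_reals all_analysis.
From mathcomp Require Import measurable_realfun ring lra zify.

Set Implicit Arguments.
Unset Strict Implicit.
Unset Printing Implicit Defensive.
Import Order.TTheory GRing.Theory Num.Theory.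
Import numFieldNormedType.Exports.

Local Open Scope classical_set_scope.
Local Open Scope ring_scope.


(** Put p = 1 / (1 - alpha), so that X = Y^p and X^alpha = Y^(p-1), with p > 2.
    The theorem is Itô's formula for Y^p.  The proof is pathwise: the two
    integrals are constructed as limits of left sums along almost every path,
    and moment bounds turn these limits into limits in L^2.

    Fix exponents a < 1/2 < b < H with a + b > 1.  Almost every path of B is
    a-Hölder and almost every path of B^H is b-Hölder, with constants that have
    moments of high order (kolmogorov_holder).  Along such paths Y and the total
    variation of its drift are at most a multiple of these constants (sol_ub,
    sol_var_le); all of them are collected into one random bound G
    (tame_path_ae).  Hence Y^(p-1) is a-Hölder up to a part controlled by a
    monotone function, and its left sums against B^H converge by Young's sewing
    estimate (young_block), at a rate which is a power of the mesh times a power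
    of G (tame_riemann_dist).  Since G has moments, this is the required
    convergence in L^2, and the limit is J.

    The squared increments of Y over dyadic intervals converge to nu1^2 dt: this
    is so for nu1 B (qv_ae_cvg), and the other part of Y has zero quadratic
    variation because b > 1/2.  Summing the second-order Taylor formula for Y^p
    over the dyadic intervals therefore identifies the limit I of the left sums
    against B (foellmer_ito).  In this limit the second-order term cancels the
    term in 1 / Y of the drift, and the equation for X holds by the very
    definition of I.

    It remains to see that I is the Itô integral.  The left sums against B are,
    after truncation, elementary integrals of simple processes.  The Taylor
    formula again bounds them by a power of G and the quadratic variation of B
    along the grid (tame_left_sum_le), so that their fourth moments are bounded
    and their almost sure convergence to I is a convergence in L^2
    (L2_cvg0_of_moments).  The simple processes have to be adapted to the joint
    history of B and B^H, which is not completed by null sets: an Euler scheme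
    provides a version of Y_t that is measurable with respect to the history up
    to time t (adapted_version). *)

(** * Left sums and the sewing estimate *)

Section young.
Context {R : realType}.
Implicit Types (phi G A : R -> R) (s t x y : R) (l : seq R).

Fixpoint left_sum phi G s l : R :=
  if l is x :: l' then phi s * (G x - G s) + left_sum phi G x l' else 0.

Lemma left_sum_cat phi G s l1 l2 :
  left_sum phi G s (l1 ++ l2) =
  left_sum phi G s l1 + left_sum phi G (last s l1) l2.
Proof. by elim: l1 s => [|x l1 IH] s /=; rewrite ?add0r// IH addrA. Qed.

Lemma left_sum_sumE phi G s l :
  left_sum phi G s l = \sum_(k < size l)
    phi (nth s (s :: l) k) * (G (nth s l k) - G (nth s (s :: l) k)).
Proof.
elim: l s => [|x l IH] s /=; first by rewrite big_ord0.
rewrite big_ord_recl /= IH; congr (_ + _); apply: eq_bigr => i _ /=.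
have h1 : nth s (x :: l) i = nth x (x :: l) i.
  by apply: set_nth_default => /=; rewrite ltnS ltnW.
have h2 : nth s l i = nth x l i by apply: set_nth_default.
by rewrite /bump/= /= h1 h2.
Qed.

Lemma path_le_last s l : path <=%R s l -> s <= last s l.
Proof.
by elim: l s => //= x l IH s /andP[sx /IH]; apply: le_trans.
Qed.

Lemma path_le_all s l x : path <=%R s l -> x \in l -> s <= x <= last s l.
Proof.
elim: l s => //= y l IH s /andP[sy pl]; rewrite inE => /orP[/eqP ->|xl].
  by rewrite sy path_le_last.
by have /andP[yx ->] := IH _ pl xl; rewrite (le_trans sy yx).
Qed.

Lemma left_sum_const phi G s l : path <=%R s l -> last s l = s ->
  left_sum phi G s l = 0.
Proof.
elim: l s => //= x l IH s /andP[sx pl] ls.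
have xs : x = s by apply/eqP; rewrite eq_le sx andbT -ls path_le_last.
by rewrite xs in pl ls *; rewrite IH// subrr mulr0 addr0.
Qed.

(** The bound of the sewing lemma for a step [s, t] : dA (dt)^b + (dt)^(a+b). *)
Definition young_gap A (a b s t : R) :=
  (A t - A s) * (t - s) `^ b + (t - s) `^ (a + b).

Section block.
Variables (T a b M g C : R) (phi G A : R -> R).
Hypotheses (a0 : 0 < a) (b0 : 0 < b) (ab1 : 1 < a + b) (M0 : 0 <= M) (g0 : 0 <= g).
Hypothesis Amono : forall s t, 0 <= s -> s <= t -> t <= T -> A s <= A t.
Hypothesis phireg : forall s t, 0 <= s -> s <= t -> t <= T ->
  `|phi t - phi s| <= M * (A t - A s + (t - s) `^ a).
Hypothesis Greg : forall s t, 0 <= s -> s <= t -> t <= T ->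
  `|G t - G s| <= g * (t - s) `^ b.
Hypotheses (C0 : 0 <= C) (Cb : 2 <= C * (1 - 2^-1 `^ b))
  (Cab : 2 <= C * (1 - 2 * 2^-1 `^ (a + b))).

Lemma young_cross s y x e : 0 <= s -> s <= y -> y <= x -> x <= e -> e <= T ->
  `|(phi y - phi s) * (G e - G x)| <= M * g * young_gap A a b s e.
Proof.
move=> s0 sy yx xe eT.
have ye : y <= e by exact: le_trans xe.
have se : s <= e by exact: le_trans ye.
have x0 : 0 <= x by rewrite (le_trans s0)// (le_trans sy).
rewrite normrM (_ : M * g * _ =
  (M * (A e - A s + (e - s) `^ a)) * (g * (e - s) `^ b)); last first.
  rewrite /young_gap powRD; last by rewrite gt_eqF ?addr_gt0.
  by ring.
apply: ler_pM => //.
- apply: le_trans (phireg s0 sy (le_trans ye eT)) _.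
  rewrite ler_wpM2l// lerD//.
    by rewrite lerB// Amono// (le_trans s0).
  by rewrite ge0_ler_powR// ?nnegrE ?subr_ge0// ?lerB// ltW.
- apply: le_trans (Greg x0 xe eT) _; rewrite ler_wpM2l//.
  by rewrite ge0_ler_powR// ?nnegrE ?subr_ge0// ?lerB// ?(le_trans sy)// ltW.
Qed.

(** Young's estimate, by induction on the number of points.  The partition is
    cut at the step that contains the midpoint, so that both parts have at most
    half of the length: since b > 0 and a + b > 1, their bounds add up to a
    fixed proportion of the bound for the whole, and the conditions on C leave
    room for the two cross terms. *)
Lemma young_block s l : 0 <= s -> path <=%R s l -> last s l <= T ->
  `|left_sum phi G s l - phi s * (G (last s l) - G s)|
    <= C * (M * g) * young_gap A a b s (last s l).
Proof.
have [n] := ubnP (size l); elim: n l s => // n IH l s ln s0 pl eT.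
have se := path_le_last pl.
have [e eE] : exists e, last s l = e by eexists.
rewrite eE in eT se *.
have [es|es] := eqVneq e s.
  by rewrite left_sum_const ?eE// es subrr mulr0 subrr normr0 /young_gap !subrr
    !powR0 ?gt_eqF ?addr_gt0// mulr0 addr0 mulr0.
have lt_se : s < e by rewrite lt_neqAle eq_sym es.
pose d := e - s.
have d0 : 0 < d by rewrite subr_gt0.
(* The cut: x is the first point beyond the midpoint and y the one before it. *)
have [] := boolP (has (fun x => s + d / 2 < x) l); last first.
  move=> /hasPn lall.
  have el : e \in l.
    by move: es; rewrite -eE; case: (l) => [|x l']/=; rewrite ?eqxx// mem_last.
  by have := lall _ el; rewrite -leNgt /d => ?; exfalso; lra.
move=> hl; move: hl pl ln eE.
case/split_find => x l1 l2; rewrite /d => hxe hl1.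
rewrite -cats1 -catA /= cat_path => /andP[pl1 /= /andP[yx pl2]].
rewrite last_cat left_sum_cat /= size_cat /= => ln eE.
set y := last s l1 in yx *.
have sy : s <= y by exact: path_le_last.
have xe : x <= e by rewrite -eE path_le_last.
have yle : y <= s + (e - s) / 2.
  rewrite /y; case/lastP: (l1) hl1 => [_|l' z]; first by rewrite /= ; lra.
  by rewrite has_rcons last_rcons negb_or -leNgt => /andP[].
have I1 : `|left_sum phi G s l1 - phi s * (G y - G s)| <=
    C * (M * g) * young_gap A a b s y.
  apply: IH => //; last by rewrite (le_trans yx)// (le_trans xe).
  by move: ln; clear; lia.
have I2 : `|left_sum phi G x l2 - phi x * (G e - G x)| <=
    C * (M * g) * young_gap A a b x e.
  rewrite -eE; apply: IH => //.
  - by move: ln; clear; lia.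
  - by rewrite (le_trans s0)// (le_trans sy).
  - by rewrite eE.
have y0 : 0 <= y by exact: le_trans sy.
have ye : y <= e by exact: le_trans xe.
have ye0 : 0 <= e - y by rewrite subr_ge0.
have se0 : 0 <= e - s by rewrite subr_ge0.
have yes : e - y <= e - s by rewrite lerB.
have K1 : `|(phi y - phi s) * (G e - G y)| <= M * g * young_gap A a b s e.
  by apply: young_cross => //; apply: le_trans xe.
have K2 : `|(phi x - phi y) * (G e - G x)| <= M * g * young_gap A a b s e.
  apply: le_trans (young_cross (s := y) _ yx (lexx _) xe eT) _.
    exact: le_trans sy.
  rewrite ler_wpM2l// ?mulr_ge0// /young_gap lerD//.
    apply: ler_pM; rewrite ?powR_ge0 ?subr_ge0 ?lerB ?Amono//.
    - exact: le_trans ye.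
    - exact: le_trans eT.
    - by rewrite ge0_ler_powR// ?nnegrE// ltW.
  by rewrite ge0_ler_powR// ?nnegrE// ltW// addr_gt0.
pose w := e - s; have w0 : 0 <= w by rewrite subr_ge0.
have E1 : young_gap A a b s y + young_gap A a b x e <=
    (A e - A s) * (2^-1 `^ b * w `^ b) + 2 * (2^-1 `^ (a + b) * w `^ (a + b)).
  rewrite -!powRM// ?invr_ge0// /young_gap.
  have p1 c : 0 < c -> (y - s) `^ c <= (2^-1 * w) `^ c.
    move=> c0; rewrite ge0_ler_powR ?nnegrE ?subr_ge0// ?(ltW c0)//.
      by rewrite mulr_ge0.
    by rewrite /w; lra.
  have p2 c : 0 < c -> (e - x) `^ c <= (2^-1 * w) `^ c.
    move=> c0; rewrite ge0_ler_powR ?nnegrE ?subr_ge0// ?(ltW c0)//.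
      by rewrite mulr_ge0.
    by rewrite /w; lra.
  have := p1 _ b0; have := p2 _ b0.
  have := p1 _ (addr_gt0 a0 b0); have := p2 _ (addr_gt0 a0 b0).
  have yT := le_trans ye eT; have xT := le_trans xe eT.
  have x0 := le_trans y0 yx.
  have Asy : A s <= A y by apply: Amono.
  have Ayx : A y <= A x by apply: Amono.
  have Axe : A x <= A e by apply: Amono.
  move: ((2^-1 * w) `^ b) ((2^-1 * w) `^ (a + b)) (powR_ge0 (2^-1 * w) b) => P Q P0.
  move: ((y - s) `^ b) ((e - x) `^ b) ((y - s) `^ (a + b)) ((e - x) `^ (a + b)).
  move=> u1 u2 u3 u4 h1 h2 h3 h4; nra.
rewrite (_ : _ - _ = (left_sum phi G s l1 - phi s * (G y - G s))
   + (left_sum phi G x l2 - phi x * (G e - G x))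
   + ((phi y - phi s) * (G e - G y) + (phi x - phi y) * (G e - G x))); last by ring.
apply: le_trans (ler_normD _ _) _.
apply: le_trans (lerD (ler_normD _ _) (ler_normD _ _)) _.
apply: le_trans (lerD (lerD I1 I2) (lerD K1 K2)) _.
rewrite -mulrDr.
have MG : 0 <= M * g by rewrite mulr_ge0.
have : C * (M * g) * (young_gap A a b s y + young_gap A a b x e) <=
  C * (M * g) * ((A e - A s) * (2^-1 `^ b * w `^ b) +
     2 * (2^-1 `^ (a + b) * w `^ (a + b))).
  by rewrite ler_wpM2l// mulr_ge0.
move=> /le_trans h; apply: (@le_trans _ _ (C * (M * g) * ((A e - A s) * (2^-1 `^ b * w `^ b) +
     2 * (2^-1 `^ (a + b) * w `^ (a + b))) + 2 * (M * g * young_gap A a b s e))).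
  rewrite (mulr_natl (M * g * _)) mulr2n; apply: lerD; last by [].
  exact: (h _ (lexx _)).
have Ase : 0 <= A e - A s by rewrite subr_ge0 Amono.
rewrite /young_gap -/w.
move: (powR_ge0 w b) (powR_ge0 w (a + b)) Cb Cab Ase MG; clear.
move: (w `^ b) (w `^ (a + b)) (2^-1 `^ b) (2^-1 `^ (a + b)) (A e - A s) (M * g).
move=> u v h k D m u0 v0 hC kC D0 m0.
rewrite -subr_ge0 (_ : _ - _ = m * (D * u * (C * (1 - h) - 2) + v * (C * (1 - 2 * k) - 2))).
  by rewrite mulr_ge0// addr_ge0// mulr_ge0 ?mulr_ge0// subr_ge0.
by ring.
Qed.

Lemma subseq_consP x l (l' : seq R) : subseq (x :: l) l' ->
  exists l1 l2, l' = l1 ++ x :: l2 /\ subseq l l2.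
Proof.
elim: l' => //= y l' IH; case: eqP => [->|_] h; first by exists [::], l'.
by have [l1 [l2 [-> h2]]] := IH h; exists (y :: l1), l2.
Qed.

Definition mesh_le D s l := path (fun x y => y - x <= D) s l.

Definition young_err s t D :=
  C * (M * g) * ((A t - A s) * D `^ b + (t - s) * D `^ (a + b - 1)).

(** Each step of the coarse grid is a block of the fine one, of length at most D. *)
Lemma left_sum_refine D s l l' : 0 <= s -> path <=%R s l' -> subseq l l' ->
  last s l = last s l' -> last s l' <= T -> mesh_le D s l ->
  `|left_sum phi G s l' - left_sum phi G s l| <= young_err s (last s l') D.
Proof.
elim: l s l' => [|x l IH] s l' s0 pl' sub.
  move=> /= els eT _; rewrite left_sum_const// subrr normr0 /young_err -els.
  by rewrite !subrr !mul0r addr0 mulr0.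
have [l1 [l2 [l'E sub2]]] := subseq_consP sub.
move: pl'; rewrite l'E last_cat cat_path /= => /andP[pl1 /andP[yx pl2]] els eT.
move=> /andP[xD ml]; rewrite -cat_rcons left_sum_cat last_rcons.
have xe : x <= last x l2 by exact: path_le_last.
have sx : s <= x by apply: le_trans yx; exact: path_le_last.
have pr : path <=%R s (rcons l1 x) by rewrite rcons_path pl1.
have lr : last s (rcons l1 x) = x by rewrite last_rcons.
have B1 := young_block s0 pr; rewrite lr in B1.
have {}B1 := B1 (le_trans xe eT).
have B2 := IH x l2 (le_trans s0 sx) pl2 sub2 els eT ml.
rewrite (_ : _ - _ = (left_sum phi G s (rcons l1 x) - phi s * (G x - G s)) +
  (left_sum phi G x l2 - left_sum phi G x l)); last by ring.
apply: le_trans (ler_normD _ _) _; apply: le_trans (lerD B1 B2) _.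
have D0 : 0 <= D by apply: le_trans xD; rewrite subr_ge0.
have CMg : 0 <= C * (M * g) by rewrite !mulr_ge0.
rewrite /young_err -mulrDr ler_wpM2l// /young_gap.
have h1 : (A x - A s) * (x - s) `^ b <= (A x - A s) * D `^ b.
  rewrite ler_wpM2l// ?subr_ge0 ?Amono//; first by rewrite (le_trans xe).
  by rewrite ge0_ler_powR// ?nnegrE ?subr_ge0// ltW.
have h2 : (x - s) `^ (a + b) <= (x - s) * D `^ (a + b - 1).
  rewrite -mulr_powRB1 ?subr_ge0 ?addr_gt0// ler_wpM2l ?subr_ge0//.
  by rewrite ge0_ler_powR// ?nnegrE ?subr_ge0// ltW// subr_ge0.
move: h1 h2; lra.
Qed.

(** Both grids are compared with their common refinement. *)
Lemma left_sum_compare s l1 l2 D1 D2 : 0 <= s ->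
  path <=%R s l1 -> path <=%R s l2 -> last s l1 = last s l2 ->
  last s l1 <= T -> mesh_le D1 s l1 -> mesh_le D2 s l2 ->
  `|left_sum phi G s l1 - left_sum phi G s l2| <=
    young_err s (last s l1) D1 + young_err s (last s l1) D2.
Proof.
move=> s0 p1 p2 e12 eT m1 m2.
pose l := sort <=%R (l1 ++ l2).
have srt l0 : path <=%R s l0 -> sort <=%R l0 = l0.
  by move=> /path_sorted; apply: sorted_sort; apply: le_trans.
have sub1 : subseq l1 l.
  rewrite -(srt l1 p1); apply: subseq_sort; [exact: le_total|exact: le_trans|].
  exact: prefix_subseq.
have sub2 : subseq l2 l.
  rewrite -(srt l2 p2); apply: subseq_sort; [exact: le_total|exact: le_trans|].
  exact: suffix_subseq.
have ml x : x \in l -> s <= x <= last s l1.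
  rewrite mem_sort mem_cat => /orP[]; first exact: path_le_all.
  by rewrite e12; exact: path_le_all.
have pl : path <=%R s l.
  rewrite path_sortedE; last exact: le_trans.
  apply/andP; split; last by apply: sort_sorted; exact: le_total.
  by apply/allP => x /ml /andP[].
have el : last s l = last s l1.
  apply/eqP; rewrite eq_le; apply/andP; split.
    have := mem_last s l; rewrite inE => /orP[/eqP ->|/ml /andP[]//].
    exact: path_le_last.
  have := mem_last s l1; rewrite inE => /orP[/eqP ->|h].
    exact: path_le_last.
  by have /andP[] := path_le_all pl (mem_subseq sub1 h).
rewrite -(subrKA (left_sum phi G s l)) -el.
apply: le_trans (ler_normD _ _) _; rewrite distrC lerD//.
  by apply: left_sum_refine; rewrite ?el.
by apply: left_sum_refine; rewrite ?el -?e12.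
Qed.

End block.

Lemma powR_seq_cvg0 c (D : nat -> R) : (forall n, 0 <= D n) ->
  D n @[n --> \oo] --> 0 -> 0 < c -> (D n) `^ c @[n --> \oo] --> 0.
Proof.
move=> D0 Dn c0; apply/cvgrPdist_lt => e e0.
move/cvgrPdist_lt : Dn => /(_ (e `^ c^-1)); rewrite powR_gt0// => /(_ isT).
apply: filterS => n; rewrite !sub0r !normrN ger0_norm// ger0_norm ?powR_ge0// => h.
by rewrite -[ltRHS](@powRr1 _ e) ?ltW// -(@mulVf _ c) ?gt_eqF// powRrM gt0_ltr_powR// ?nnegrE ?powR_ge0.
Qed.

Lemma young_err_cvg0 A a b M g C s t (D : nat -> R) : 0 < b -> 1 < a + b ->
  (forall n, 0 <= D n) -> D n @[n --> \oo] --> 0 ->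
  young_err a b M g C A s t (D n) @[n --> \oo] --> 0.
Proof.
move=> b0 ab D0 Dn.
have pw c := @powR_seq_cvg0 c D D0 Dn.
rewrite /young_err -[X in _ --> X](mulr0 (C * (M * g))).
apply: cvgMr; rewrite -[X in _ --> X](addr0 0).
apply: cvgD.
  by rewrite -[X in _ --> X](mulr0 (A t - A s)); apply: cvgMr; apply: pw.
rewrite -[X in _ --> X](mulr0 (t - s)); apply: cvgMr; apply: pw.
by rewrite subr_gt0.
Qed.

Definition dyadic (T : R) n k : R := k%:R * T / 2 ^+ n.

(** Stopping the grid of [0, T] at t keeps the same 2^n indices for all t; the
    repeated final points do not change left sums. *)
Definition dyadic_grid T t n : seq R :=
  [seq Num.min (dyadic T n k.+1) t | k <- iota 0 (2 ^ n)].

Lemma dyadic0 T n : dyadic T n 0 = 0. Proof. by rewrite /dyadic !mul0r. Qed.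

Lemma dyadic_last T n : dyadic T n (2 ^ n) = T.
Proof. by rewrite /dyadic natrX mulrAC divff ?mul1r// expf_neq0. Qed.

Lemma dyadic_leq T n j k : 0 <= T -> (j <= k)%N -> dyadic T n j <= dyadic T n k.
Proof.
by move=> T0 jk; rewrite /dyadic ler_wpM2r ?invr_ge0 ?exprn_ge0// ler_wpM2r// ler_nat.
Qed.

Lemma dyadic_step T n k : dyadic T n k.+1 - dyadic T n k = T / 2 ^+ n.
Proof. by rewrite /dyadic -mulrBl -mulrBl -natr1 addrAC subrr add0r mul1r. Qed.

Lemma path_map_iota (r : rel R) (f : nat -> R) n :
  (forall k, (k < n)%N -> r (f k) (f k.+1)) ->
  path r (f 0) [seq f k.+1 | k <- iota 0 n].
Proof.
move=> h; rewrite -[f 0]/((fun k => f k) 0%N).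
have : forall m, (forall k, (k < m + n)%N -> r (f k) (f k.+1)) ->
    path r (f m) [seq f k.+1 | k <- iota m n].
  elim: n {h} => //= n IH m h; rewrite h/=; last by lia.
  by apply: IH => k km; apply: h; lia.
by apply.
Qed.

Lemma last_map_iota (f : nat -> R) n :
  last (f 0) [seq f k.+1 | k <- iota 0 n] = f n.
Proof.
by case: n => // n; rewrite -[n.+1]addn1 iotaD map_cat last_cat /= add0n addn1.
Qed.

Lemma left_sum_iota phi G (f : nat -> R) n :
  left_sum phi G (f 0) [seq f k.+1 | k <- iota 0 n] =
  \sum_(k < n) phi (f k) * (G (f k.+1) - G (f k)).
Proof.
have : forall m, left_sum phi G (f m) [seq f k.+1 | k <- iota m n] =
  \sum_(k < n) phi (f (m + k)%N) * (G (f (m + k).+1) - G (f (m + k)%N)).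
  elim: n => [|n IH] m /=; first by rewrite big_ord0.
  rewrite big_ord_recl addn0 IH; congr (_ + _).
  by apply: eq_bigr => i _; rewrite /bump /= addnA addn1.
by move=> /(_ 0%N) ->; apply: eq_bigr => i _; rewrite add0n.
Qed.

End young.

(** * Young integrals along dyadic grids *)

Section young_integral.
Context {R : realType}.
Variables (T a b M g C : R) (phi G A : R -> R).
Hypotheses (T0 : 0 < T) (a0 : 0 < a) (b0 : 0 < b) (ab1 : 1 < a + b)
  (M0 : 0 <= M) (g0 : 0 <= g).
Hypothesis Amono : forall s t, 0 <= s -> s <= t -> t <= T -> A s <= A t.
Hypothesis phireg : forall s t, 0 <= s -> s <= t -> t <= T ->
  `|phi t - phi s| <= M * (A t - A s + (t - s) `^ a).
Hypothesis Greg : forall s t, 0 <= s -> s <= t -> t <= T ->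
  `|G t - G s| <= g * (t - s) `^ b.
Hypotheses (C0 : 0 <= C) (Cb : 2 <= C * (1 - 2^-1 `^ b))
  (Cab : 2 <= C * (1 - 2 * 2^-1 `^ (a + b))).

Let mesh n : R := T / 2 ^+ n.

Lemma dyadic_mesh_ge0 n : 0 <= mesh n.
Proof. by rewrite divr_ge0 ?exprn_ge0 // ltW. Qed.

Lemma dyadic_mesh_cvg0 : mesh n @[n --> \oo] --> 0.
Proof.
rewrite -[X in _ --> X](mulr0 T); apply: cvgMr.
have -> : (fun n : nat => (2 ^+ n)^-1 : R) = GRing.exp 2^-1.
  by apply/funext => n; rewrite exprVn.
by apply: cvg_expr; rewrite ger0_norm ?invr_ge0// invf_lt1// ltr1n.
Qed.

Lemma dyadic_grid_spec t n : 0 <= t <= T ->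
  [/\ path <=%R 0 (dyadic_grid T t n), last 0 (dyadic_grid T t n) = t &
      mesh_le (mesh n) 0 (dyadic_grid T t n)].
Proof.
move=> /andP[t0 tT]; pose f k := Num.min (dyadic T n k) t.
have f0 : f 0%N = 0 by rewrite /f dyadic0 min_l.
have ff k : dyadic T n k <= dyadic T n k.+1 by apply: dyadic_leq => //; exact: ltW.
split.
- rewrite -[X in path _ X _]f0; apply: (@path_map_iota _ _ f) => k _.
  by rewrite /f le_min !ge_min ff lexx orbT.
- by rewrite -[X in last X _]f0 (last_map_iota f) /f dyadic_last min_r.
- rewrite /mesh_le -[X in path _ X _]f0; apply: (@path_map_iota _ _ f) => k _.
  rewrite /f /mesh -(dyadic_step T n k); have := ff k.
  move: (dyadic T n k) (dyadic T n k.+1) => x y xy.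
  by case: (lerP x t); case: (lerP y t); lra.
Qed.

Let S t n := left_sum phi G 0 (dyadic_grid T t n).
Let err := young_err a b M g C A.

Lemma dyadic_left_sum_cvg t : 0 <= t <= T -> cvgn (S t).
Proof.
move=> tT; apply: cauchy_cvg; apply: cauchy_exP => e e0.
have E0 : err 0 t (mesh n) @[n --> \oo] --> 0.
  by apply: young_err_cvg0 => //; [exact: dyadic_mesh_ge0|exact: dyadic_mesh_cvg0].
have e2 : 0 < e / 2 by rewrite divr_gt0.
move/cvgrPdist_lt : E0 => /(_ _ e2) [N _ hN].
exists (S t N); exists N => // n /= Nn; rewrite /ball /=.
have [p1 l1 m1] := dyadic_grid_spec N tT.
have [p2 l2 m2] := dyadic_grid_spec n tT.
have [_ tT'] := andP tT.
have := left_sum_compare a0 b0 ab1 M0 g0 Amono phireg Greg C0 Cb Cab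
   (lexx 0) p1 p2 (D1 := mesh N) (D2 := mesh n).
rewrite l1 l2 => /(_ erefl tT' m1 m2) /le_lt_trans; apply.
have := hN _ (leqnn N); have := hN n Nn; rewrite !sub0r !normrN /err => h1 h2.
have := ler_norm (young_err a b M g C A 0 t (mesh N)).
have := ler_norm (young_err a b M g C A 0 t (mesh n)).
move: h1 h2; lra.
Qed.

Definition young_int t := limn (S t).

Lemma young_int_cvg t : 0 <= t <= T -> S t n @[n --> \oo] --> young_int t.
Proof. by move=> tT; exact: dyadic_left_sum_cvg. Qed.

(** The grid is compared with the dyadic ones, whose own errors vanish. *)
Lemma young_int_dist l D t : 0 <= t <= T -> path <=%R 0 l -> last 0 l = t ->
  mesh_le D 0 l -> `|left_sum phi G 0 l - young_int t| <= err 0 t D.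
Proof.
move=> tT pl lt ml.
have E0 : err 0 t (mesh n) @[n --> \oo] --> 0.
  by apply: young_err_cvg0 => //; [exact: dyadic_mesh_ge0|exact: dyadic_mesh_cvg0].
have L : err 0 t D + err 0 t (mesh n) @[n --> \oo] --> err 0 t D.
  by rewrite -[X in _ --> X]addr0; apply: cvgD => //; exact: cvg_cst.
rewrite -[leRHS](cvg_lim _ L)//.
have L1 : `|left_sum phi G 0 l - S t n| @[n --> \oo] --> `|left_sum phi G 0 l - young_int t|.
  by apply: cvg_norm; apply: cvgB; [exact: cvg_cst|exact: young_int_cvg].
rewrite -[leLHS](cvg_lim _ L1)//; apply: ler_lim; [by apply/cvg_ex; eexists; exact: L1|by apply/cvg_ex; eexists; exact: L|].
apply: nearW => n.
have [p2 l2 m2] := dyadic_grid_spec n tT.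
have [_ tT'] := andP tT.
have := left_sum_compare a0 b0 ab1 M0 g0 Amono phireg Greg C0 Cb Cab
   (lexx 0) pl p2 (D1 := D) (D2 := mesh n).
by rewrite lt l2 => /(_ erefl tT' ml m2).
Qed.

(** The dyadic grids, clamped to [s, t], are subdivisions of a single block. *)
Lemma young_int_increment s t : 0 <= s -> s <= t -> t <= T ->
  `|young_int t - young_int s - phi s * (G t - G s)| <=
    C * (M * g) * young_gap A a b s t.
Proof.
move=> s0 st tT.
have t0 : 0 <= t by exact: le_trans st.
have sT : 0 <= s <= T by rewrite s0 (le_trans st).
have tT' : 0 <= t <= T by rewrite t0 tT.
pose r n := [seq Num.max s (Num.min (dyadic T n k.+1) t) | k <- iota 0 (2 ^ n)].
have rE n : [/\ path <=%R s (r n), last s (r n) = t & mesh_le (mesh n) s (r n)].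
  pose f k := Num.max s (Num.min (dyadic T n k) t).
  have f0 : f 0%N = s by rewrite /f dyadic0 min_l// max_l.
  have ff k : dyadic T n k <= dyadic T n k.+1 by apply: dyadic_leq => //; exact: ltW.
  split.
  - rewrite -[X in path _ X _]f0; apply: (@path_map_iota _ _ f) => k _.
    by rewrite /f ge_max !le_max lexx !le_min /= !ge_min ff lexx !orbT.
  - by rewrite -[X in last X _]f0 (last_map_iota f) /f dyadic_last min_r// max_r.
  - rewrite /mesh_le -[X in path _ X _]f0; apply: (@path_map_iota _ _ f) => k _.
    rewrite /f /mesh -(dyadic_step T n k); have := ff k.
    move: (dyadic T n k) (dyadic T n k.+1) => x y xy.
    have : Num.min y t - Num.min x t <= y - x /\ Num.min x t <= Num.min y t.
      by split; case: (lerP x t); case: (lerP y t); lra.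
    move: (Num.min y t) (Num.min x t) => v u [].
    by case: (lerP s u); case: (lerP s v); lra.
pose l n := dyadic_grid T s n ++ r n.
have lE n : left_sum phi G 0 (l n) = S s n + left_sum phi G s (r n).
  by have [_ e _] := dyadic_grid_spec n sT; rewrite left_sum_cat e.
have L : `|young_int t - left_sum phi G 0 (l n)| + `|S s n - young_int s| @[n --> \oo] --> (0:R).
  have E0 : err 0 t (mesh n) @[n --> \oo] --> 0.
    by apply: young_err_cvg0 => //; [exact: dyadic_mesh_ge0|exact: dyadic_mesh_cvg0].
  rewrite -[X in _ --> X](addr0 0); apply: cvgD; last first.
    rewrite -[X in _ --> X](@normr0 _ R) -(subrr (young_int s)); apply: cvg_norm; apply: cvgB; [exact: young_int_cvg|exact: cvg_cst].
  apply: (@squeeze_cvgr _ _ _ _ (cst 0) _ _ _ _ (cvg_cst _) E0); apply: nearW => n /=.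
  rewrite normr_ge0 /= distrC; have [p1 e1 m1] := dyadic_grid_spec n sT.
  have [p2 e2 m2] := rE n.
  apply: young_int_dist => //; rewrite /l.
  - by rewrite cat_path p1 e1.
  - by rewrite last_cat e1.
  - by rewrite /mesh_le cat_path e1; apply/andP.
apply/ler_addgt0Pr => e e0.
move/cvgrPdist_lt : L => /(_ _ e0) [N _ /(_ N (leqnn N))].
rewrite sub0r normrN ger0_norm ?addr_ge0// => h.
have [p2 e2 m2] := rE N.
have := young_block a0 b0 M0 g0 Amono phireg Greg C0 Cb Cab s0 p2.
rewrite e2 => /(_ tT) h2.
rewrite (_ : _ - _ - _ = (young_int t - left_sum phi G 0 (l N)) + (S s N - young_int s) +
   (left_sum phi G s (r N) - phi s * (G t - G s))); last by rewrite lE; ring.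
apply: le_trans (ler_normD _ _) _; rewrite addrC; apply: lerD => //.
by apply: le_trans (ler_normD _ _) _; exact: ltW.
Qed.

End young_integral.

(** * Uniform continuity on an interval *)

Section uniform_continuity.
Context {R : realType}.
Implicit Types (g h : R -> R) (T s t e : R).

(** With explicit quantifiers, since the modulus is what all the estimates use. *)
Definition unif_cont T g := forall e, 0 < e -> exists2 d, 0 < d &
  forall s t, 0 <= s <= T -> 0 <= t <= T -> `|t - s| < d -> `|g t - g s| < e.

Lemma unif_cont_within T g : unif_cont T g -> {within `[0, T], continuous g}.
Proof.
move=> ug; apply/subspace_continuousP => x /= xT; apply/cvgrPdist_lt => e e0.
have [d d0 hd] := ug _ e0.
rewrite near_withinE; near=> y => /= yT.
apply: hd; [by move: yT; rewrite in_itv|by move: xT; rewrite in_itv|].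
by near: y; exact: nbhsx_ballx.
Unshelve. all: by end_near. Qed.

Lemma within_unif_cont T g : {within `[0, T], continuous g} -> unif_cont T g.
Proof.
move=> /subspace_continuousP cg e e0.
have hc : near_covering `[0, T]%classic.
  by apply/compact_near_coveringP; exact: segment_compact.
have hd : \forall d \near (0:R)^'+, `[0, T]%classic `<=` (fun x => 0 <= x <= T ->
    forall y, 0 <= y <= T -> `|y - x| < d -> `|g y - g x| < e).
  apply: hc.
  move=> x xT; have := cg x xT; move=> /cvgrPdist_lt /(_ (e / 2)).
  rewrite divr_gt0// => /(_ isT); rewrite near_withinE.
  move=> /nbhs_ballP [r /= r0 hr].
  exists (ball x (r / 2), [set d | d < r / 2]).
    split; first by apply: nbhsx_ballx; rewrite divr_gt0.
    by apply: nbhs_right_lt; rewrite divr_gt0.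
  move=> [z d] /= [xz dr] zT y yT yz; rewrite /ball /= in xz.
  have hz : `|g x - g z| < e / 2.
    by apply: hr; rewrite ?in_itv//= /ball/=; apply: lt_trans xz _; lra.
  have hy : `|g x - g y| < e / 2.
    apply: hr; rewrite ?in_itv//= /ball/= -(subrKA z).
    by rewrite (le_lt_trans (ler_normD _ _))// [`|z - y|]distrC; lra.
  rewrite -(subrKA (g x)) (le_lt_trans (ler_normD _ _))//.
  by rewrite distrC; lra.
near (0:R)^'+ => r; exists r; first by near: r; exact: nbhs_right_gt.
move=> s t sT tT st.
have hr : `[0, T]%classic `<=` (fun x => 0 <= x <= T -> forall y, 0 <= y <= T ->
   `|y - x| < r -> `|g y - g x| < e).
  by near: r; exact: hd.
have sI : `[0, T]%classic s by rewrite /= in_itv.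
exact: (hr s sI sT t tT st).
Unshelve. all: by end_near. Qed.

End uniform_continuity.

(** * Chaining over dyadic points *)

Section chaining.
Context {R : realType}.
Variables (T : R) (T0 : 0 < T).

Definition dyadic_index n (t : R) : nat := Num.truncn (t / T * 2 ^+ n).
Local Notation idx := dyadic_index.
Local Notation dy := (dyadic T).

Lemma dyadic_index_itv n t : 0 <= t -> dy n (idx n t) <= t < dy n (idx n t).+1.
Proof.
move=> t0; have p2 : (0 : R) < 2 ^+ n by rewrite exprn_gt0.
have x0 : 0 <= t / T * 2 ^+ n by rewrite mulr_ge0 ?exprn_ge0// divr_ge0// ltW.
have := truncn_itv x0; rewrite -/(idx n t) /dyadic => /andP[h1 h2].
have e : t = (t / T * 2 ^+ n) * T / 2 ^+ n by field; rewrite !gt_eqF.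
by rewrite {2 3}e ler_pM2r ?invr_gt0// ltr_pM2r ?invr_gt0// ler_pM2r// ltr_pM2r// h1.
Qed.

Lemma dyadic_double n k : dy n.+1 (2 * k) = dy n k.
Proof. by rewrite /dyadic exprS natrM; field; rewrite expf_neq0. Qed.

Lemma dyadic_lt n j k : (dy n j < dy n k) = (j < k)%N.
Proof. by rewrite /dyadic ltr_pM2r ?invr_gt0 ?exprn_gt0// ltr_pM2r// ltr_nat. Qed.

Lemma dyadic_index_le n t : 0 <= t <= T -> (idx n t <= 2 ^ n)%N.
Proof.
move=> /andP[t0 tT]; have /andP[h _] := dyadic_index_itv n t0.
rewrite leqNgt -(dyadic_lt n) -leNgt dyadic_last; exact: le_trans h tT.
Qed.

Lemma dyadic_indexS n t : 0 <= t ->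
  idx n.+1 t = (2 * idx n t)%N \/ idx n.+1 t = (2 * idx n t).+1%N.
Proof.
move=> t0; have /andP[h1 h2] := dyadic_index_itv n t0.
have /andP[h3 h4] := dyadic_index_itv n.+1 t0.
have := le_lt_trans h1 h4; rewrite -(dyadic_double n) dyadic_lt ltnS => a.
have := le_lt_trans h3 h2; rewrite -(dyadic_double n) dyadic_lt => b.
move: a b; clear; move: (idx n.+1 t) (idx n t) => x y a b.
have [->|] := eqVneq x (2 * y)%N; first by left.
by move=> ne; right; lia.
Qed.

Section holder.
Variables (q K : R) (g : R -> R).
Hypotheses (q0 : 0 < q) (q1 : q < 1) (K0 : 0 <= K) (gc : unif_cont T g).
Hypothesis gdy : forall n k, (k < 2 ^ n)%N ->
  `|g (dy n k.+1) - g (dy n k)| <= K * q ^+ n.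

Let ap n t := dy n (idx n t).

Lemma dyadic_chain n i t : 0 <= t <= T ->
  `|g (ap (n + i) t) - g (ap n t)| <= K / (1 - q) * (q ^+ n - q ^+ (n + i)).
Proof.
move=> tT; have t0 : 0 <= t by case/andP : tT.
elim: i => [|i IH]; first by rewrite addn0 !subrr normr0 mulr0.
have step : `|g (ap (n + i.+1) t) - g (ap (n + i) t)| <= K * q ^+ (n + i).+1.
  rewrite addnS /ap; set m := (n + i)%N.
  rewrite -(dyadic_double m).
  have [e|e] := dyadic_indexS m t0; rewrite e.
    by rewrite subrr normr0 mulr_ge0// exprn_ge0// ltW.
  apply: gdy; have := dyadic_index_le m.+1 tT; rewrite e expnS; lia.
rewrite -(subrKA (g (ap (n + i) t))) (le_trans (ler_normD _ _))//.
apply: le_trans (lerD step IH) _.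
rewrite addnS exprS; set Q := q ^+ (n + i); set P := q ^+ n.
have Q0 : 0 <= Q by rewrite exprn_ge0// ltW.
have c0 : 1 - q != 0 by rewrite gt_eqF// subr_gt0.
rewrite -subr_ge0 (_ : _ - _ = K * Q * (1 - q)); last by field.
by rewrite !mulr_ge0// subr_ge0 ltW.
Qed.

Lemma dyadic_approx_cvg t : 0 <= t -> ap n t @[n --> \oo] --> t.
Proof.
move=> t0.
apply: (@squeeze_cvgr _ _ _ _ (fun n => t - T / 2 ^+ n) (cst t)).
- apply: nearW => n; have /andP[h1 h2] := dyadic_index_itv n t0.
  by rewrite h1 andbT lerBlDr -(dyadic_step T n (idx n t)) addrC subrK ltW.
- rewrite -[X in _ --> X]subr0; apply: cvgB; first exact: cvg_cst.
  exact: dyadic_mesh_cvg0.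
- exact: cvg_cst.
Qed.

Lemma dyadic_chain_lim n t : 0 <= t <= T ->
  `|g t - g (ap n t)| <= K / (1 - q) * q ^+ n.
Proof.
move=> tT; have t0 : 0 <= t by case/andP : tT.
have c0 : 0 < 1 - q by rewrite subr_gt0.
apply/ler_addgt0Pr => e e0.
have [d d0 hd] := gc e0.
have /cvgrPdist_lt/(_ _ d0)[N _ /(_ (n + N)%N)] := dyadic_approx_cvg t0.
move=> /(_ (leq_addl _ _)) h.
have apT : 0 <= ap (n + N) t <= T.
  have /andP[h1 _] := dyadic_index_itv (n + N) t0.
  rewrite (le_trans h1) ?andbT; last by case/andP : tT.
  by rewrite /ap -(dyadic0 T (n + N)) dyadic_leq// ltW.
have h1 := hd _ _ apT tT h.
rewrite -(subrKA (g (ap (n + N) t))) (le_trans (ler_normD _ _))// addrC.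
apply: lerD; last exact: ltW.
apply: le_trans (dyadic_chain n N tT) _; rewrite ler_wpM2l ?divr_ge0// ?(ltW c0)//.
by rewrite gerBl exprn_ge0// ltW.
Qed.

Lemma dyadic_holder_scale s t n : 0 <= s -> s <= t -> t <= T ->
  t - s <= T / 2 ^+ n -> `|g t - g s| <= (2 / (1 - q) + 1) * K * q ^+ n.
Proof.
move=> s0 st tT h.
have t0 := le_trans s0 st.
have sT : 0 <= s <= T by rewrite s0 (le_trans st).
have tT' : 0 <= t <= T by rewrite t0.
have A1 := dyadic_chain_lim n tT'; have A2 := dyadic_chain_lim n sT.
have A3 : `|g (ap n t) - g (ap n s)| <= K * q ^+ n.
  have /andP[a1 a2] := dyadic_index_itv n s0.
  have /andP[b1 b2] := dyadic_index_itv n t0.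
  have : (idx n s < (idx n t).+1)%N.
    by rewrite -(dyadic_lt n); exact: le_lt_trans a1 (le_lt_trans st b2).
  have : (idx n t < (idx n s).+2)%N.
    rewrite -(dyadic_lt n); apply: le_lt_trans b1 _.
    rewrite -(subrK (dy n (idx n s).+1) (dy n (idx n s).+2)) dyadic_step.
    by move: h a2; move: (dy n _) => z; lra.
  rewrite /ap => u v.
  have [->|ne] := eqVneq (idx n t) (idx n s).
    by rewrite subrr normr0 mulr_ge0// exprn_ge0// ltW.
  have e : idx n t = (idx n s).+1.
    by move: u v ne; clear; move: (idx n t) (idx n s) => x y; lia.
  by rewrite e; apply: gdy; have := dyadic_index_le n tT'; rewrite e.
rewrite (_ : _ - _ = (g t - g (ap n t)) - (g s - g (ap n s)) +
   (g (ap n t) - g (ap n s))); last by ring.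
rewrite (le_trans (ler_normD _ _))//.
apply: le_trans (lerD (ler_normB _ _) A3) _.
move: A1 A2; rewrite -!mulrA -[X in _ <= X -> _]mulrCA; lra.
Qed.

End holder.

(** Chaining: a point is approached from a dyadic one by steps of decreasing
    dyadic lengths, and the bounds on their increments form a geometric series. *)
Lemma dyadic_holder (de K : R) (g : R -> R) : 0 < de -> 0 <= K -> unif_cont T g ->
  (forall n k, (k < 2 ^ n)%N -> `|g (dy n k.+1) - g (dy n k)| <= K * (2^-1 `^ de) ^+ n) ->
  forall s t, 0 <= s -> s <= t -> t <= T ->
  `|g t - g s| <= (2 / (1 - 2^-1 `^ de) + 1) * (2 / T) `^ de * K * (t - s) `^ de.
Proof.
move=> de0 K0 gc gdy s t s0 st tT.
set q := 2^-1 `^ de.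
have q0 : 0 < q by rewrite powR_gt0.
have q1 : q < 1.
  have := @gt0_ltr_powR R _ de0 2^-1 1; rewrite powR1 !nnegrE => -> //.
  by rewrite invf_lt1// ltr1n.
have [->|ne] := eqVneq t s; first by rewrite !subrr normr0 powR0 ?mulr0// gt_eqF.
have ts : 0 < t - s by rewrite subr_gt0 lt_neqAle eq_sym ne.
have hex : exists n, T / 2 ^+ n.+1 < t - s.
  have /cvgrPdist_lt/(_ _ ts)[N _ /(_ N.+1 (leqnSn _))] := dyadic_mesh_cvg0 T.
  rewrite sub0r normrN ger0_norm ?divr_ge0 ?exprn_ge0 ?(ltW T0)// => h.
  by exists N.
case: (ex_minnP hex) => n hn hmin.
have hle : t - s <= T / 2 ^+ n.
  case: n hn hmin => [|n] hn hmin; first by rewrite expr0 divr1; lra.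
  by rewrite leNgt; apply/negP => /hmin; rewrite ltnn.
apply: le_trans (dyadic_holder_scale q0 q1 K0 gc gdy s0 st tT hle) _.
have c0 : 0 <= 2 / (1 - q) + 1 by rewrite addr_ge0// divr_ge0// subr_ge0 ltW.
have qn : q ^+ n <= (2 / T) `^ de * (t - s) `^ de.
  rewrite -powRM ?divr_ge0 ?(ltW ts) ?(ltW T0)//.
  rewrite /q -powR_mulrn ?powR_ge0// powRAC powR_mulrn ?invr_ge0//.
  rewrite ge0_ler_powR ?nnegrE ?exprn_ge0 ?invr_ge0// ?(ltW de0)//.
    by rewrite mulr_ge0 ?divr_ge0 ?(ltW ts) ?(ltW T0).
  rewrite exprVn mulrAC ler_pdivlMr//.
  move: hn; rewrite exprS invfM => /ltW; lra.
apply: le_trans (ler_wpM2l (mulr_ge0 c0 K0) qn) _.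
by rewrite le_eqVlt; apply/orP; left; apply/eqP; ring.
Qed.

End chaining.

(** * Primitives of integrable functions *)

Section unif_cont_theory.
Context {R : realType}.
Variables (T : R) (T0 : 0 <= T).
Implicit Types f g : R -> R.

Lemma unif_contN f : unif_cont T f -> unif_cont T (fun s => - f s).
Proof.
move=> fc e e0; have [d d0 hd] := fc e e0; exists d => // s t sT tT st.
by rewrite -opprD normrN; exact: hd.
Qed.

Lemma unif_contD f g : unif_cont T f -> unif_cont T g -> unif_cont T (fun s => f s + g s).
Proof.
move=> fc gc e e0; have e2 : 0 < e / 2 by rewrite divr_gt0.
have [d d0 hd] := fc _ e2; have [d' d'0 hd'] := gc _ e2.
exists (Num.min d d'); first by rewrite lt_min d0.
move=> s t sT tT; rewrite lt_min => /andP[h1 h2].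
rewrite opprD addrACA (le_lt_trans (ler_normD _ _))//.
by move: (hd _ _ sT tT h1) (hd' _ _ sT tT h2); lra.
Qed.

Lemma unif_contB f g : unif_cont T f -> unif_cont T g -> unif_cont T (fun s => f s - g s).
Proof. by move=> fc gc; apply: unif_contD => //; exact: unif_contN. Qed.

Lemma unif_cont_bounded f : unif_cont T f -> exists2 M, 0 <= M &
  forall s, 0 <= s <= T -> `|f s| <= M.
Proof.
move=> fc; have nc : unif_cont T (fun s => `|f s|).
  move=> e e0; have [d d0 hd] := fc e e0; exists d => // s t sT tT st.
  by rewrite (le_lt_trans (ler_dist_dist _ _))//; exact: hd.
have [c cT hc] := EVT_max T0 (unif_cont_within nc).
by exists `|f c| => // s sT; apply: hc; rewrite in_itv.
Qed.

Lemma unif_contZ c f : unif_cont T f -> unif_cont T (fun s => c * f s).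
Proof.
move=> fc e e0; have c0 : 0 < `|c| + 1 by rewrite ltr_wpDl.
have [d d0 hd] := fc _ (divr_gt0 e0 c0).
exists d => // s t sT tT /(hd _ _ sT tT) h.
rewrite -mulrBr normrM; move: h; rewrite ltr_pdivlMr// => h.
by apply: le_lt_trans h; rewrite mulrC ler_wpM2l// lerDl.
Qed.

Lemma unif_cont_comp f (F : R -> R) (D : R -> Prop) : unif_cont T f ->
  (forall s, 0 <= s <= T -> D (f s)) ->
  (forall e, 0 < e -> exists2 d, 0 < d &
    forall x y, D x -> D y -> `|y - x| < d -> `|F y - F x| < e) ->
  unif_cont T (F \o f).
Proof.
move=> fc fD Fc e e0; have [d d0 hd] := Fc e e0; have [d' d'0 hd'] := fc d d0.
exists d' => // s t sT tT st; apply: hd; [exact: fD|exact: fD|exact: hd'].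
Qed.

Lemma unif_cont_cst c : unif_cont T (fun=> c).
Proof. by move=> e e0; exists 1 => // s t _ _ _; rewrite subrr normr0. Qed.

End unif_cont_theory.

Section primitive.
Context {R : realType}.
Notation mu := (@lebesgue_measure R).
Variable T : R.
Implicit Types (f g : R -> R) (s t c : R).

Definition prim f t : R := \int[lebesgue_measure]_(s in `[0, t]) f s.

Definition intble f := mu.-integrable `[0, T] (EFin \o f).

Lemma intbleD f g : intble f -> intble g -> intble (fun s => f s + g s).
Proof. by move=> fi gi; apply: (integrableD _ fi gi). Qed.

Lemma intbleB f g : intble f -> intble g -> intble (fun s => f s - g s).
Proof. by move=> fi gi; apply: (integrableB _ fi gi). Qed.

Lemma intbleZ c f : intble f -> intble (fun s => c * f s).
Proof. by move=> fi; apply: (integrableZl _ c fi). Qed.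

Lemma intble_norm f : intble f -> intble (fun s => `|f s|).
Proof. by move=> fi; rewrite /intble; apply: integrable_norm. Qed.

Lemma intble_cont f : unif_cont T f -> intble f.
Proof.
by move=> fc; apply: continuous_compact_integrable; [exact: segment_compact|exact: unif_cont_within].
Qed.

Lemma intble_cst c : intble (fun=> c).
Proof. by apply: intble_cont => e e0; exists 1 => // s t _ _ _; rewrite subrr normr0. Qed.

Lemma intbleS f t : intble f -> t <= T -> mu.-integrable `[0, t] (EFin \o f).
Proof.
move=> fi tT; apply: integrableS fi => //.
by apply: subset_itvl; rewrite bnd_simp.
Qed.

Lemma intbleSoc f s t : intble f -> 0 <= s -> t <= T -> mu.-integrable `]s, t] (EFin \o f).
Proof.
move=> fi s0 tT; apply: integrableS fi => //.
by apply: subset_itv; rewrite bnd_simp.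
Qed.

Lemma prim_incr f s t : intble f -> 0 <= s -> s <= t -> t <= T ->
  prim f t - prim f s = \int[mu]_(u in `]s, t]) f u.
Proof. move=> fi s0 st tT; rewrite /prim.
by rewrite (@Rintegral_itvB _ f (BLeft 0) (BRight t) s) ?bnd_simp//; exact: intbleS. Qed.

Lemma le_prim_incr f g s t : intble f -> intble g -> 0 <= s -> s <= t -> t <= T ->
  (forall u, s < u -> u <= t -> f u <= g u) ->
  prim f t - prim f s <= prim g t - prim g s.
Proof.
move=> fi gi s0 st tT fg; rewrite !prim_incr//; apply: le_Rintegral => //.
- exact: intbleSoc.
- exact: intbleSoc.
- by move=> u /=; rewrite in_itv /= => /andP[su ut]; exact: fg.
Qed.

Lemma norm_prim_incr_le f s t : intble f -> 0 <= s -> s <= t -> t <= T ->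
  `|prim f t - prim f s| <= prim (fun u => `|f u|) t - prim (fun u => `|f u|) s.
Proof.
move=> fi s0 st tT; have nfi := intble_norm fi; rewrite !prim_incr//.
by apply: le_normr_Rintegral => //; exact: intbleSoc.
Qed.

Lemma primD f g t : intble f -> intble g -> t <= T ->
  prim (fun s => f s + g s) t = prim f t + prim g t.
Proof. by move=> fi gi tT; rewrite /prim RintegralD//; exact: intbleS. Qed.

Lemma primB f g t : intble f -> intble g -> t <= T ->
  prim (fun s => f s - g s) t = prim f t - prim g t.
Proof. by move=> fi gi tT; rewrite /prim RintegralB//; exact: intbleS. Qed.

Lemma primZ c f t : intble f -> t <= T ->
  prim (fun s => c * f s) t = c * prim f t.
Proof. by move=> fi tT; rewrite /prim RintegralZl//; exact: intbleS. Qed.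

Lemma prim_cst c t : 0 <= t -> prim (fun=> c) t = c * t.
Proof.
move=> t0; rewrite /prim Rintegral_cst//= lebesgue_measure_itv/= lte_fin.
by move: t0; rewrite le_eqVlt => /predU1P[<-|->]; rewrite ?ltxx// -EFinD subr0.
Qed.

Lemma prim0 f : prim f 0 = 0.
Proof. by rewrite /prim set_itv1 Rintegral_set1. Qed.

Lemma prim_cont f : 0 <= T -> intble f -> unif_cont T (prim f).
Proof.
by move=> T0 fi; apply: within_unif_cont; apply: parameterized_integral_continuous.
Qed.

Lemma prim_mono f s t : intble f -> (forall u, 0 <= u -> u <= T -> 0 <= f u) ->
  0 <= s -> s <= t -> t <= T -> prim f s <= prim f t.
Proof.
move=> fi f0 s0 st tT.
have := le_prim_incr (intble_cst 0) fi s0 st tT.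
rewrite !prim_cst// ?(le_trans s0)// !mul0r subrr subr_ge0; apply => u su ut.
by apply: f0; [exact: le_trans s0 (ltW su)|exact: le_trans tT].
Qed.

Lemma eq_prim f g t : (forall s, 0 <= s -> s <= t -> f s = g s) -> prim f t = prim g t.
Proof.
move=> fg; apply: eq_Rintegral => s; rewrite inE /= in_itv /= => /andP[s0 st].
exact: fg.
Qed.

Lemma eq_intble f g : (forall s, 0 <= s -> s <= T -> f s = g s) -> intble f -> intble g.
Proof.
move=> fg; apply: eq_integrable => // s; rewrite inE /= in_itv /= => /andP[s0 st].
by congr EFin; exact: fg.
Qed.

Lemma intbleM f g : unif_cont T f -> intble g -> 0 <= T -> intble (fun s => f s * g s).
Proof.
move=> fc gi T0.
have fw := unif_cont_within fc.
apply: (integrableMr _ _ _ gi) => //.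
  by apply: measurable_realfun.subspace_continuous_measurable_fun.
have [M M0 hM] := unif_cont_bounded T0 fc.
exists M; split; first exact: num_real.
move=> x Mx s /=; rewrite in_itv /= => sT.
by rewrite (le_trans (hM _ _))// ltW.
Qed.

End primitive.


(** * Taylor estimates for real powers *)

Section taylor_powR.
Context {R : realType}.
Implicit Types (x y r e M m p : R).

Lemma is_derive_powR r (x : R) : 0 < x ->
  is_derive x 1 ((@powR R) ^~ r) (r * x `^ (r - 1)).
Proof.
move=> x0; have xi : x \in `]0, +oo[ by rewrite in_itv /= x0.
apply: DeriveDef; first exact: derivable_powR.
by rewrite -(powR_derive1 r xi) derive1E.
Qed.

Lemma MVT_between (f df : R -> R) x y :
  (forall u : R, Num.min x y <= u -> u <= Num.max x y -> is_derive u 1 f (df u)) ->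
  exists c, [/\ Num.min x y <= c, c <= Num.max x y & f y - f x = df c * (y - x)].
Proof.
have gen (a b : R) : a < b -> (forall u : R, a <= u -> u <= b -> is_derive u 1 f (df u)) ->
    exists c, [/\ a <= c, c <= b & f b - f a = df c * (b - a)].
  move=> ab h; have [] := @MVT R f df a b ab.
  - by move=> u; rewrite in_itv /= => /andP[/ltW au /ltW ub]; exact: h.
  - apply: derivable_within_continuous => u; rewrite in_itv /= => /andP[au ub].
    by have := h u au ub; case.
  - by move=> c; rewrite in_itv /= => /andP[/ltW ac /ltW cb] e; exists c.
have [xy|yx|->] := ltgtP x y => h.
- exact: gen.
- have [c [c1 c2 e]] := gen y x yx h; exists c; split => //.
  by rewrite -opprB e; ring.
- by exists y; split; rewrite ?minxx ?maxxx ?lexx// !subrr mulr0.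
Qed.

Lemma between_dist x y c : Num.min x y <= c -> c <= Num.max x y -> `|c - x| <= `|y - x|.
Proof.
have [xy|/ltW xy] := leP x y.
  move=> h1 h2.
  by rewrite (ger0_norm (_ : 0 <= y - x)) ?subr_ge0// ger0_norm ?subr_ge0// lerB.
move=> h1 h2.
by rewrite (ler0_norm (_ : y - x <= 0)) ?subr_le0// ler0_norm ?subr_le0// lerN2 lerB.
Qed.

Lemma powR_MVT_between r x y : 0 < x -> 0 < y ->
  exists c, [/\ Num.min x y <= c, c <= Num.max x y &
    y `^ r - x `^ r = r * c `^ (r - 1) * (y - x)].
Proof.
move=> x0 y0; have [|c h] := @MVT_between ((@powR R) ^~ r) (fun u => r * u `^ (r - 1)) x y.
  by move=> u xu _; apply: is_derive_powR; apply: lt_le_trans xu; rewrite lt_min x0.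
by exists c.
Qed.

(** Local Lipschitz bound away from 0; the bound covers both signs of r - 1. *)
Lemma powR_lip r m M x y : 0 < m -> m <= x <= M -> m <= y <= M ->
  `|y `^ r - x `^ r| <= `|r| * (m `^ (r - 1) + M `^ (r - 1)) * `|y - x|.
Proof.
move=> m0 /andP[mx xM] /andP[my yM].
have [c [c1 c2 ->]] := powR_MVT_between r (lt_le_trans m0 mx) (lt_le_trans m0 my).
rewrite !normrM ler_wpM2r// ler_wpM2l// ger0_norm ?powR_ge0//.
have mc : m <= c by apply: le_trans c1; rewrite le_min mx.
have cM : c <= M by apply: le_trans c2 _; rewrite ge_max xM.
have c0 := lt_le_trans m0 mc; have M0 := lt_le_trans c0 cM.
have [r1|r1] := leP 0 (r - 1).
  apply: (@le_trans _ _ (M `^ (r - 1))); last by rewrite lerDr powR_ge0.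
  by rewrite ge0_ler_powR// nnegrE ltW.
apply: (@le_trans _ _ (m `^ (r - 1))); last by rewrite lerDl powR_ge0.
rewrite -(opprK (r - 1)) !(powRN _ (- (r - 1))) lef_pV2 ?posrE ?powR_gt0//.
by rewrite ge0_ler_powR// ?nnegrE ?oppr_ge0 ltW.
Qed.

Lemma powR_lip_le r M x y : 1 <= r -> 0 < x -> x <= M -> 0 < y -> y <= M ->
  `|y `^ r - x `^ r| <= r * M `^ (r - 1) * `|y - x|.
Proof.
move=> r1 x0 xM y0 yM; have r0 : 0 <= r by apply: le_trans r1.
have [c [c1 c2 ->]] := powR_MVT_between r x0 y0.
have c0 : 0 <= c by apply: le_trans c1; rewrite le_min !ltW.
have cM : c <= M by apply: le_trans c2 _; rewrite ge_max xM.
rewrite !normrM ler_wpM2r// (ger0_norm r0) ler_wpM2l// ger0_norm ?powR_ge0//.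
by rewrite ge0_ler_powR// ?nnegrE ?subr_ge0//; exact: le_trans cM.
Qed.

Variables (p : R) (p2 : 2 < p).

Lemma powR_taylor1 M x y : 0 < x -> x <= M -> 0 < y -> y <= M ->
  `|y `^ p - x `^ p - p * x `^ (p - 1) * (y - x)| <=
    p * (p - 1) * M `^ (p - 2) * (y - x) ^+ 2.
Proof.
move=> x0 xM y0 yM; have [c [c1 c2 ->]] := powR_MVT_between p x0 y0.
have c0 : 0 < c by apply: lt_le_trans c1; rewrite lt_min x0.
have cM : c <= M by apply: le_trans c2 _; rewrite ge_max xM.
rewrite -mulrBl -mulrBr !normrM -real_normK ?num_real// expr2 mulrA ler_wpM2r//.
have p0 : 0 <= p by apply: le_trans (ltW p2).
rewrite (ger0_norm p0) -!mulrA ler_wpM2l//.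
have p11 : 1 <= p - 1 by move: p2; clear; lra.
apply: le_trans (powR_lip_le p11 x0 xM c0 cM) _.
have -> : p - 1 - 1 = p - 2 by ring.
have p10 : 0 <= p - 1 by apply: le_trans p11.
by rewrite -mulrA ler_wpM2l// ler_wpM2l ?powR_ge0// between_dist.
Qed.

Lemma powR_taylor2 m M : 0 < m -> exists2 K, 0 <= K &
  forall x y, m <= x <= M -> m <= y <= M ->
  `|y `^ p - x `^ p - p * x `^ (p - 1) * (y - x)
     - 2^-1 * (p * (p - 1) * x `^ (p - 2)) * (y - x) ^+ 2| <= K * `|y - x| ^+ 3.
Proof.
move=> m0.
pose L := `|p - 2| * (m `^ (p - 2 - 1) + M `^ (p - 2 - 1)).
have L0 : 0 <= L by rewrite mulr_ge0// addr_ge0 ?powR_ge0.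
have pp : 0 <= p * (p - 1) by move: p2; clear => h; apply: mulr_ge0; lra.
exists (p * (p - 1) * L); first by rewrite mulr_ge0.
move=> x y /andP[mx xM] /andP[my yM].
have x0 := lt_le_trans m0 mx; have y0 := lt_le_trans m0 my.
pose h z := z `^ p - (p * x `^ (p - 1) * (z - x)
     + 2^-1 * (p * (p - 1) * x `^ (p - 2)) * (z - x) ^+ 2).
pose dh z := p * z `^ (p - 1) - (p * x `^ (p - 1) + p * (p - 1) * x `^ (p - 2) * (z - x)).
have hd (u : R) : 0 < u -> is_derive u 1 h (dh u).
  move=> u0; have := is_derive_powR p u0 => hp.
  apply: is_derive_eq.
  by rewrite /dh /GRing.scale /=; field.
have [|c [c1 c2]] := @MVT_between h dh x y.
  by move=> v xv _; apply: hd; apply: lt_le_trans xv; rewrite lt_min x0.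
have -> : h y - h x = y `^ p - x `^ p - p * x `^ (p - 1) * (y - x)
     - 2^-1 * (p * (p - 1) * x `^ (p - 2)) * (y - x) ^+ 2.
  by rewrite /h subrr expr0n mulr0 mulr0; ring.
move=> ->.
have mc : m <= c by apply: le_trans c1; rewrite le_min mx.
have cM : c <= M by apply: le_trans c2 _; rewrite ge_max xM.
have c0 := lt_le_trans m0 mc.
have [d [d1 d2 e]] := powR_MVT_between (p - 1) x0 c0.
have md : m <= d by apply: le_trans d1; rewrite le_min mx.
have dM : d <= M by apply: le_trans d2 _; rewrite ge_max xM.
have cx := between_dist c1 c2; have dx := between_dist d1 d2.
have -> : dh c = p * (p - 1) * (d `^ (p - 2) - x `^ (p - 2)) * (c - x).
  have -> : dh c = p * (c `^ (p - 1) - x `^ (p - 1)) - p * (p - 1) * x `^ (p - 2) * (c - x).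
    by rewrite /dh; ring.
  by rewrite e (_ : p - 1 - 1 = p - 2); ring.
have lip : `|d `^ (p - 2) - x `^ (p - 2)| <= L * `|y - x|.
  have mxM : m <= x <= M by rewrite mx.
  have mdM : m <= d <= M by rewrite md.
  apply: le_trans (powR_lip (p - 2) m0 mxM mdM) _; rewrite -/L.
  by apply: ler_wpM2l => //; exact: le_trans cx.
rewrite normrM [in leLHS]normrM [in leLHS]normrM (ger0_norm pp).
have : `|d `^ (p - 2) - x `^ (p - 2)| * `|c - x| <= L * `|y - x| * `|y - x|.
  by apply: ler_pM.
move=> h1; have v0 := normr_ge0 (y - x).
rewrite -subr_ge0 (_ : _ - _ = p * (p - 1) * `|y - x| *
  (L * `|y - x| * `|y - x| - `|d `^ (p - 2) - x `^ (p - 2)| * `|c - x|)); last by ring.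
by apply: mulr_ge0; [exact: mulr_ge0|rewrite subr_ge0].
Qed.

End taylor_powR.

(** * Bounds on the solutions of the equation *)

Section drift_bounds.
Context {R : realType}.
Implicit Types (x y r e : R).

Lemma powR_lip_ge r e x y : r <= 0 -> 0 < e -> e <= x -> e <= y ->
  `|y `^ r - x `^ r| <= - r * e `^ (r - 1) * `|y - x|.
Proof.
move=> r0 e0 ex ey.
have x0 := lt_le_trans e0 ex; have y0 := lt_le_trans e0 ey.
have [c [xc _ ->]] := powR_MVT_between r x0 y0.
have ec : e <= c by apply: le_trans xc; rewrite le_min ex.
have c0 := lt_le_trans e0 ec.
rewrite !normrM ler0_norm// (ger0_norm (powR_ge0 _ _)).
rewrite -!mulrA ler_wpM2l ?oppr_ge0// ler_wpM2r//.
have -> : r - 1 = - (1 - r) by ring.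
rewrite !powRN lef_pV2 ?posrE ?powR_gt0// ge0_ler_powR ?nnegrE//.
- by rewrite subr_ge0 (le_trans r0).
- exact: ltW.
- exact: ltW.
Qed.

Variables (kappa theta c q : R).
Hypotheses (k0 : 0 < kappa) (th0 : 0 < theta) (c0 : 0 < c) (q1 : 1 < q).

(** The drift in terms of the exponent q = alpha / (1 - alpha) and of the
    coefficient c = alpha nu1^2 / (2 (1 - alpha)) of the Itô correction. *)
Definition rdrift y := kappa / y `^ q - c / y - theta * y.

Let q0 : 0 < q. Proof. exact: lt_trans q1. Qed.

Lemma rdrift_le y : 1 <= y -> rdrift y <= kappa.
Proof.
move=> y1; have y0 : 0 < y by exact: lt_le_trans y1.
have h1 : 1 <= y `^ q.
  by have := ge0_ler_powR (ltW q0) (x := 1) (y := y); rewrite powR1 !nnegrE ler01 (ltW y0) => ->.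
have : kappa / y `^ q <= kappa.
  by rewrite ler_pdivrMr ?powR_gt0// ler_peMr// ltW.
have : 0 < c / y by rewrite divr_gt0.
have : 0 < theta * y by rewrite mulr_gt0.
by rewrite /rdrift; lra.
Qed.

Lemma rdrift_ge : exists2 K, 0 <= K & forall y, 0 < y -> - (K + theta * y) <= rdrift y.
Proof.
have kc : 0 < kappa / c by rewrite divr_gt0.
pose y0 := (kappa / c) `^ (q - 1)^-1.
have y00 : 0 < y0 by rewrite powR_gt0.
have q10 : q - 1 != 0 by rewrite gt_eqF// subr_gt0.
exists (c / y0); first by rewrite divr_ge0// ltW.
move=> y yp; rewrite /rdrift.
have [yy0|yy0] := leP y y0.
  have : y `^ (q - 1) <= kappa / c.
    have := ge0_ler_powR (_ : 0 <= q - 1) (x := y) (y := y0); rewrite !nnegrE.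
    rewrite subr_ge0 (ltW q1) => /(_ isT); rewrite (ltW yp) (ltW y00) => /(_ isT isT yy0).
    by rewrite /y0 -powRrM mulVf// powRr1// ltW.
  rewrite ler_pdivlMr// => h.
  have e : y `^ q = y * y `^ (q - 1) by rewrite mulr_powRB1// ltW.
  have : 0 <= (kappa - y `^ (q - 1) * c) / y `^ q.
    by rewrite divr_ge0 ?powR_ge0// subr_ge0.
  have : 0 < c / y0 by rewrite divr_gt0.
  have -> : (kappa - y `^ (q - 1) * c) / y `^ q = kappa / y `^ q - c / y.
    by rewrite e; field; rewrite !gt_eqF ?powR_gt0.
  by lra.
have : c / y <= c / y0 by rewrite ler_pM2l// lef_pV2 ?posrE// ltW.
have : 0 <= kappa / y `^ q by rewrite divr_ge0 ?powR_ge0// ltW.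
lra.
Qed.

Lemma rdrift_lip e : 0 < e -> exists2 L, 0 <= L & forall x y, e <= x -> e <= y ->
  `|rdrift y - rdrift x| <= L * `|y - x|.
Proof.
move=> e0.
exists (kappa * (q * e `^ (- q - 1)) + c * (1 * e `^ (- 1 - 1)) + theta).
  by rewrite !addr_ge0 ?mulr_ge0 ?powR_ge0 ?ltW.
move=> x y ex ey.
have qn : - q <= 0 by rewrite oppr_le0 ltW.
have n1 : - (1 : R) <= 0 by rewrite oppr_le0.
have h1 := powR_lip_ge qn e0 ex ey; have h2 := powR_lip_ge n1 e0 ex ey.
have x0 := lt_le_trans e0 ex; have y0 := lt_le_trans e0 ey.
rewrite !powRN !powRr1 ?(ltW x0) ?(ltW y0)// !opprK in h1 h2.
rewrite /rdrift (_ : _ - _ = kappa * ((y `^ q)^-1 - (x `^ q)^-1) - c * (y^-1 - x^-1)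
   - theta * (y - x)); last by ring.
apply: le_trans (ler_normB _ _) _; apply: le_trans (lerD (ler_normB _ _) (lexx _)) _.
rewrite !normrM (gtr0_norm k0) (gtr0_norm c0) (gtr0_norm th0).
rewrite !mulrDl -!(mulrA kappa) -!(mulrA c) lerD2r; apply: lerD.
  by rewrite ler_pM2l.
by rewrite ler_pM2l.
Qed.

End drift_bounds.

Section path_bounds.
Context {R : realType}.
Variables (T kappa theta c q : R).
Hypotheses (T0 : 0 < T) (k0 : 0 < kappa) (th0 : 0 < theta) (c0 : 0 < c) (q1 : 1 < q).
Local Notation b := (rdrift kappa theta c q).
Variables (Y0 Z : R) (y z : R -> R).
Hypotheses (Z0 : 0 <= Z) (zc : unif_cont T z) (zb : forall t, 0 <= t <= T -> `|z t| <= Z).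
Hypothesis (bi : intble T (b \o y)).
Hypothesis (ypos : forall t, 0 <= t <= T -> 0 < y t).
Hypothesis (yE : forall t, 0 <= t <= T -> y t = Y0 + prim (b \o y) t + z t).

Lemma sol_cont : unif_cont T y.
Proof.
have h : unif_cont T (fun t => Y0 + prim (b \o y) t + z t).
  apply: unif_contD => //; apply: unif_contD; first exact: unif_cont_cst.
  by apply: prim_cont => //; exact: ltW.
move=> e e0; have [d d0 hd] := h e e0; exists d => // s t sT tT st.
by rewrite !yE//; exact: hd.
Qed.

Lemma sol_incr s t : 0 <= s -> s <= t -> t <= T ->
  y t - y s = prim (b \o y) t - prim (b \o y) s + (z t - z s).
Proof. by move=> s0 st tT; rewrite !yE ?s0 ?tT ?(le_trans s0) ?(le_trans st)//; ring. Qed.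

(** Above level 1 the drift is at most kappa, so that a solution exceeds the
    level at which it last entered ]1, +oo[ by no more than kappa T and the
    oscillation of the noise. *)
Lemma sol_ub t : 0 <= t <= T -> y t <= Num.max 1 Y0 + kappa * T + 2 * Z.
Proof.
move=> tT; have /andP[t0 tT'] := tT.
have above s : 0 <= s -> s <= t -> (forall u, s < u -> u <= t -> 1 < y u) ->
    y t - y s <= kappa * T + 2 * Z.
  move=> s0 st h1; rewrite sol_incr//.
  have sT : 0 <= s <= T by rewrite s0 (le_trans st).
  have : prim (b \o y) t - prim (b \o y) s <= kappa * (t - s).
    rewrite mulrBr -!(prim_cst kappa) ?(le_trans s0)//.
    apply: (le_prim_incr bi (intble_cst _ _)) => // u su ut.
    by apply: rdrift_le => //; apply: ltW; exact: h1.
  have : kappa * (t - s) <= kappa * T by rewrite ler_wpM2l ?(ltW k0)//; lra.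
  have := zb tT; have := zb sT; rewrite !ler_norml => /andP[a1 a2] /andP[a3 a4].
  move: a1 a2 a3 a4; lra.
have [[u0 u0I]|no] := pselect (exists u, 0 <= u <= t /\ y u <= 1); last first.
  have h u : 0 <= u -> u <= t -> 1 < y u.
    by move=> u0 ut; rewrite ltNge; apply/negP => yu; apply: no; exists u; rewrite u0.
  have y0E : y 0 = Y0 + z 0 by rewrite yE ?lexx ?ltW// prim0 addr0.
  have h0 : prim (b \o y) t <= kappa * T.
    have := le_prim_incr bi (intble_cst T kappa) (lexx 0) t0 tT' _.
    rewrite !prim0 !subr0 prim_cst// => h1.
    apply: (@le_trans _ _ (kappa * t)); last by rewrite ler_wpM2l// ltW.
    by apply: h1 => u uu ut; apply: rdrift_le => //; apply/ltW/h => //; exact: ltW.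
  rewrite yE//; have := zb tT; rewrite ler_norml => /andP[_ a].
  have : Y0 <= Num.max 1 Y0 by rewrite le_max lexx orbT.
  by move: h0 a Z0; lra.
(* The supremum of E is the last time in [0, t] at which y is at most 1. *)
pose E := [set u | 0 <= u <= t /\ y u <= 1].
have Esup : has_sup E.
  by split; [exists u0|exists t => u [/andP[]]].
have s0 : 0 <= sup E.
  by have [/andP[h _] _] := u0I; apply: le_trans h (ub_le_sup _ _) => //; case: Esup.
have st : sup E <= t by apply: ge_sup; [exists u0|move=> u [/andP[]]].
have sT : 0 <= sup E <= T by rewrite s0 (le_trans st).
have ys : y (sup E) <= 1.
  apply/ler_addgt0Pr => e e0; have [d d0 hd] := sol_cont e0.
  have [u [/andP[u1 u2] yu] su] := sup_adherent d0 Esup.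
  have uT : 0 <= u <= T by rewrite u1 (le_trans u2).
  have us : u <= sup E by apply: ub_le_sup; [case: Esup|split => //; rewrite u1].
  have := hd u (sup E) uT sT; rewrite ger0_norm ?subr_ge0// => /(_ ltac:(lra)).
  by rewrite ltr_norml => /andP[_]; move: yu; lra.
have := above _ s0 st _.
have hu u : sup E < u -> u <= t -> 1 < y u.
  move=> su ut; rewrite ltNge; apply/negP => yu.
  have : u <= sup E.
    by apply: ub_le_sup; [case: Esup|split => //; rewrite ut andbT (le_trans s0)// ltW].
  by rewrite leNgt su.
move=> /(_ hu).
have : 1 <= Num.max 1 Y0 by rewrite le_max lexx.
by move: ys; lra.
Qed.

Definition sol_var := prim (fun s => `|b (y s)|).

Lemma sol_var_mono s t : 0 <= s -> s <= t -> t <= T -> sol_var s <= sol_var t.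
Proof. by move=> *; apply: (@prim_mono _ T) => //; exact: intble_norm bi. Qed.

Lemma sol_drift_incr s t : 0 <= s -> s <= t -> t <= T ->
  `|y t - y s - (z t - z s)| <= sol_var t - sol_var s.
Proof.
by move=> s0 st tT; rewrite sol_incr// addrK; exact: (norm_prim_incr_le bi).
Qed.

(** The drift is bounded below by - (K + theta y); so the integral of its
    absolute value is controlled by its integral, which the equation expresses
    in terms of y and of the noise. *)
Lemma sol_var_le K M : 0 <= K ->
  (forall x, 0 < x -> - (K + theta * x) <= b x) ->
  (forall t, 0 <= t <= T -> y t <= M) ->
  sol_var T <= M + `|Y0| + Z + 2 * (K + theta * M) * T.
Proof.
move=> K0 bK yM.
have TT : 0 <= T <= T by rewrite lexx ltW.
have M0 : 0 <= M by apply: le_trans (yM _ TT); apply/ltW/ypos.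
have h := @le_prim_incr _ T (fun s => `|b (y s)|) (fun s => b (y s) + 2 * (K + theta * M)) 0 T
   (intble_norm bi) (intbleD bi (intble_cst _ _)) (lexx _) (ltW T0) (lexx _).
have {h} : sol_var T <= prim (fun s => b (y s) + 2 * (K + theta * M)) T.
  move: h; rewrite !prim0 !subr0; apply => u u0 uT.
  have uT' : 0 <= u <= T by rewrite (ltW u0).
  have h1 := bK _ (ypos uT').
  have h2 : theta * y u <= theta * M by rewrite ler_pM2l// yM.
  have h3 : 0 <= theta * M by rewrite mulr_ge0// ltW.
  have h4 : 0 < theta * y u by rewrite mulr_gt0// ypos.
  by rewrite ler_norml; apply/andP; split; move: h1 h2 h3 h4 K0; lra.
rewrite (@primD _ T)//; last exact: intble_cst.
have := yE TT; rewrite -[prim (b \o y) T]/(prim (fun s => b (y s)) T).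
set P := prim (fun s => b (y s)) T.
rewrite prim_cst ?(ltW T0)//.
have := zb TT; have := yM _ TT; rewrite ler_norml => h1 /andP[h2 h3] h4.
have := ler_norm (- Y0); rewrite normrN.
move: h1 h2 h3 h4; lra.
Qed.

End path_bounds.

(** * Stopped dyadic grids and weak convergence of masses *)

Lemma big_nat_blocks (R : nmodType) (F : nat -> R) b J :
  \sum_(0 <= k < J * b) F k = \sum_(0 <= j < J) \sum_(j * b <= k < j.+1 * b) F k.
Proof.
elim: J => [|J IH]; first by rewrite mul0n !big_geq.
by rewrite big_nat_recr//= -IH -big_cat_nat//= leq_mul2r leqnSn orbT.
Qed.

Lemma cvg_sum_nat (R : realType) (F : nat -> nat -> R) (l : nat -> R) N :
  (forall j, (j < N)%N -> F n j @[n --> \oo] --> l j) ->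
  \sum_(0 <= j < N) F n j @[n --> \oo] --> \sum_(0 <= j < N) l j.
Proof.
elim: N => [|N IH] h.
  by rewrite big_geq//; under eq_fun do rewrite big_geq//; exact: cvg_cst.
rewrite big_nat_recr//=; under eq_fun do rewrite big_nat_recr//=.
by apply: cvgD; [apply: IH => j jN; apply: h; exact: ltnW|exact: h].
Qed.

Section stopped_grid.
Context {R : realType}.
Variables (T : R) (T0 : 0 < T).
Implicit Types (t s : R) (n m k j : nat).
Local Notation dy := (dyadic T).

Definition stopped t n k := Num.min (dyadic T n k) t.

Lemma stopped0 t n : 0 <= t -> stopped t n 0 = 0.
Proof. by move=> t0; rewrite /stopped dyadic0 min_l. Qed.

Lemma stopped_last t n : t <= T -> stopped t n (2 ^ n) = t.
Proof. by move=> tT; rewrite /stopped dyadic_last min_r. Qed.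

Lemma stopped_le t n j k : (j <= k)%N -> stopped t n j <= stopped t n k.
Proof.
move=> jk; rewrite /stopped le_min !ge_min lexx orbT andbT.
by rewrite dyadic_leq ?(ltW T0).
Qed.

Lemma stopped_ge0 t n k : 0 <= t -> 0 <= stopped t n k.
Proof. by move=> t0; rewrite -{1}(stopped0 n t0) stopped_le. Qed.

Lemma stopped_leT t n k : t <= T -> stopped t n k <= T.
Proof. by move=> tT; rewrite /stopped ge_min tT orbT. Qed.

Lemma stopped_step t n k : stopped t n k.+1 - stopped t n k <= T / 2 ^+ n.
Proof.
rewrite /stopped -(dyadic_step T n k).
have := dyadic_leq n (ltW T0) (leqnSn k).
move: (dy n k) (dy n k.+1) => x y xy.
by case: (lerP x t); case: (lerP y t); lra.
Qed.

Lemma stoppedP t n k : stopped t n k = dy n k \/ stopped t n k.+1 = stopped t n k.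
Proof.
have := dyadic_leq n (ltW T0) (leqnSn k); rewrite /stopped => h.
have [h1|h1] := leP (dy n k) t; first by left.
by right; rewrite min_r// (le_trans (ltW h1)).
Qed.

Lemma dyadic_refine m n j : dy (m + n) (j * 2 ^ n) = dy m j.
Proof.
rewrite /dyadic natrM natrX exprD; field.
by rewrite !expf_neq0.
Qed.

Lemma dyadic_in_block m n j k : (j * 2 ^ n <= k < j.+1 * 2 ^ n)%N ->
  dy m j <= dy (m + n) k <= dy m j.+1.
Proof.
move=> /andP[h1 h2]; rewrite -(dyadic_refine m n j) -(dyadic_refine m n j.+1).
by rewrite !dyadic_leq ?(ltW T0)// ltnW.
Qed.

Lemma dyadic_itv n k : (k <= 2 ^ n)%N -> 0 <= dy n k <= T.
Proof.
move=> kn; have := dyadic_leq n (ltW T0) kn; rewrite dyadic_last => ->.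
by have := dyadic_leq n (ltW T0) (leq0n k); rewrite dyadic0 => ->.
Qed.

Lemma mesh_lt (e : R) : 0 < e -> exists m, T / 2 ^+ m < e.
Proof.
move=> e0; have /cvgrPdist_lt/(_ _ e0)[N _ /(_ N (leqnn _))] := dyadic_mesh_cvg0 T.
by rewrite sub0r normrN ger0_norm ?divr_ge0 ?exprn_ge0 ?(ltW T0)// => h; exists N.
Qed.

Section weights.
Variables (t : R) (a : nat -> nat -> R) (w : R -> R).
Hypotheses (tT : 0 <= t <= T) (a0 : forall n k, 0 <= a n k) (wc : unif_cont T w).
Hypothesis acvg : forall m j, (j <= 2 ^ m)%N ->
  \sum_(0 <= k < j * 2 ^ n) a (m + n)%N k @[n --> \oo] --> stopped t m j.

Let t0 : 0 <= t. Proof. by case/andP : tT. Qed.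
Let tT' : t <= T. Proof. by case/andP : tT. Qed.

Lemma prim_step_sum (e : R) m : 0 <= e ->
  (forall s s', 0 <= s <= T -> 0 <= s' <= T -> `|s' - s| <= T / 2 ^+ m -> `|w s' - w s| <= e) ->
  `|\sum_(0 <= j < 2 ^ m) w (dy m j) * (stopped t m j.+1 - stopped t m j) - prim w t|
   <= e * t.
Proof.
move=> e0 we.
have wi : intble T w by exact: intble_cont.
have -> : prim w t = \sum_(0 <= j < 2 ^ m) (prim w (stopped t m j.+1) - prim w (stopped t m j)).
  by rewrite telescope_sumr// stopped_last// stopped0// prim0 subr0.
have -> : e * t = \sum_(0 <= j < 2 ^ m) e * (stopped t m j.+1 - stopped t m j).
  by rewrite -mulr_sumr telescope_sumr// stopped_last// stopped0// subr0.
rewrite -sumrB (le_trans (ler_norm_sum _ _ _))//.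
rewrite big_nat [leRHS]big_nat; apply: ler_sum => j /andP[_ jm].
have [->|ne] := eqVneq (stopped t m j.+1) (stopped t m j).
  by rewrite !subrr !mulr0 subrr normr0.
have us : stopped t m j = dy m j.
  by have [//|h] := stoppedP t m j; rewrite h eqxx in ne.
have ul := stopped_le t m (leqnSn j); have u0 := stopped_ge0 m j t0.
have uT := stopped_leT m j.+1 tT'; have ust := stopped_step t m j.
have djT : 0 <= dy m j <= T by rewrite -us u0 (le_trans ul).
have bnd s : stopped t m j < s -> s <= stopped t m j.+1 -> `|w s - w (dy m j)| <= e.
  move=> s1 s2; apply: we => //; first by rewrite (le_trans u0 (ltW s1)) (le_trans s2).
  by rewrite -us ger0_norm ?subr_ge0 ?(ltW s1)//; lra.
have h1 : prim w (stopped t m j.+1) - prim w (stopped t m j) <=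
    (w (dy m j) + e) * (stopped t m j.+1 - stopped t m j).
  rewrite mulrBr -!(prim_cst (w (dy m j) + e)) ?(le_trans u0)//.
  apply: (le_prim_incr wi (intble_cst _ _)) => // s s1 s2.
  by have := bnd s s1 s2; rewrite ler_norml => /andP[_]; lra.
have h2 : (w (dy m j) - e) * (stopped t m j.+1 - stopped t m j) <=
    prim w (stopped t m j.+1) - prim w (stopped t m j).
  rewrite mulrBr -!(prim_cst (w (dy m j) - e)) ?(le_trans u0)//.
  apply: (le_prim_incr (intble_cst _ _) wi) => // s s1 s2.
  by have := bnd s s1 s2; rewrite ler_norml => /andP[h _]; move: h; lra.
by rewrite ler_norml; apply/andP; split; lra.
Qed.

(** The masses a n k converge weakly to Lebesgue measure on [0, t]; as w is
    uniformly continuous, it may be replaced by a step function on a fixed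
    coarser grid, for which the convergence is the hypothesis. *)
Lemma weighted_sum_cvg :
  \sum_(0 <= k < 2 ^ n) w (dy n k) * a n k @[n --> \oo] --> prim w t.
Proof.
apply/cvgrPdist_lt => e e0.
have T3 : 0 < 2 * T + 3 by rewrite addr_gt0// mulr_gt0.
pose e1 := e / (2 * T + 3); have e10 : 0 < e1 by rewrite divr_gt0.
have [d d0 hd] := wc e10.
have [m hm] := mesh_lt d0.
have we s s' : 0 <= s <= T -> 0 <= s' <= T -> `|s' - s| <= T / 2 ^+ m -> `|w s' - w s| <= e1.
  by move=> sT s'T h; apply/ltW/hd => //; exact: le_lt_trans hm.
have P3 := prim_step_sum (ltW e10) we.
pose S n j := \sum_(0 <= k < j * 2 ^ n) a (m + n)%N k.
have L2 : \sum_(0 <= j < 2 ^ m) w (dy m j) * (S n j.+1 - S n j) @[n --> \oo] -->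
   \sum_(0 <= j < 2 ^ m) w (dy m j) * (stopped t m j.+1 - stopped t m j).
  apply: cvg_sum_nat => j jm; apply: cvgMr.
  by apply: cvgB; apply: acvg => //; exact: ltnW.
have L1 := acvg (leqnn (2 ^ m)).
move/cvgrPdist_lt : L2 => /(_ _ e10)[N2 _ h2].
move/cvgrPdist_lt : L1 => /(_ _ ltr01)[N1 _ h1].
exists (m + maxn N1 N2)%N => // n /= mn.
have [n' nE] : exists n', n = (m + n')%N by exists (n - m)%N; lia.
have n1 : (N1 <= n')%N by lia.
have n2 : (N2 <= n')%N by lia.
have {}h1 := h1 n' n1; have {}h2 := h2 n' n2; rewrite /= in h1 h2.
rewrite stopped_last// in h1.
rewrite nE expnD big_nat_blocks.
set X := \sum_(0 <= j < _) _.
set Y := \sum_(0 <= j < _) _ in P3 h2; set W := \sum_(0 <= j < _) _ in h2.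
have h3 : `|X - W| <= e1 * (T + 1).
  have -> : X - W = \sum_(0 <= j < 2 ^ m) \sum_(j * 2 ^ n' <= k < j.+1 * 2 ^ n')
      (w (dy (m + n') k) - w (dy m j)) * a (m + n')%N k.
    rewrite /X /W -sumrB; apply: eq_bigr => j _; rewrite /S.
    rewrite (@big_cat_nat _ _ _ (j * 2 ^ n')%N 0 (j.+1 * 2 ^ n')%N)//=; last first.
      by rewrite leq_mul2r leqnSn orbT.
    rewrite [X in _ * X]addrC addKr mulr_sumr -sumrB.
    by apply: eq_bigr => k _; rewrite mulrBl.
  apply: (@le_trans _ _ (e1 * \sum_(0 <= k < 2 ^ m * 2 ^ n') a (m + n')%N k)); last first.
    rewrite ler_wpM2l// ?(ltW e10)//.
    by have := tT'; move: h1; rewrite ltr_norml => /andP[h _]; lra.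
  rewrite big_nat_blocks mulr_sumr (le_trans (ler_norm_sum _ _ _))//.
  rewrite big_nat [leRHS]big_nat; apply: ler_sum => j /andP[_ jm].
  rewrite mulr_sumr (le_trans (ler_norm_sum _ _ _))//.
  rewrite big_nat [leRHS]big_nat; apply: ler_sum => k kj.
  rewrite normrM (ger0_norm (a0 _ _)) ler_wpM2r//.
  have /andP[d1 d2] := dyadic_in_block m kj.
  have /andP[d3 d4] := dyadic_itv (ltnW jm).
  have /andP[d5 d6] := dyadic_itv jm.
  apply: we; [by rewrite d3|by rewrite (le_trans d3 d1) (le_trans d2)|].
  by rewrite ger0_norm ?subr_ge0// -(dyadic_step T m j) lerB.
rewrite (_ : _ - X = - (Y - prim w t) + (Y - W) - (X - W)); last by ring.
rewrite (le_lt_trans (ler_normB _ _))//.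
apply: le_lt_trans (lerD (ler_normD _ _) (lexx _)) _; rewrite normrN.
have : e = e1 * (2 * T + 3) by rewrite /e1 divfK// gt_eqF.
have : e1 * t <= e1 * T by rewrite ler_pM2l.
by move: P3 h2 h3 e10; lra.
Qed.

End weights.
End stopped_grid.

(** * The pathwise Itô formula for powers *)

Section foellmer.
Context {R : realType}.
Variables (T t p nu1 nu2 m0 M Ga b : R) (y x g be : R -> R).
Hypotheses (T0 : 0 < T) (tT : 0 <= t <= T) (p2 : 2 < p) (nu10 : 0 < nu1).
Hypotheses (m00 : 0 < m0) (ym : forall s, 0 <= s <= T -> m0 <= y s <= M).
Hypotheses (yc : unif_cont T y) (bei : intble T be).
Hypothesis yincr : forall s s', 0 <= s -> s <= s' -> s' <= T ->
  y s' - y s = (prim be s' - prim be s) + nu1 * (x s' - x s) + nu2 * (g s' - g s).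
Hypotheses (Ga0 : 0 <= Ga) (b12 : 1 < 2 * b).
Hypothesis gh : forall s s', 0 <= s -> s <= s' -> s' <= T ->
  `|g s' - g s| <= Ga * (s' - s) `^ b.

Local Notation dy := (dyadic T).
Local Notation u := (stopped T t).
Local Notation V := (prim (fun s => `|be s|)).

Definition grid_incr (F : R -> R) n k : R := F (u n k.+1) - F (u n k).
Local Notation dd := grid_incr.

Let t0 : 0 <= t. Proof. by case/andP : tT. Qed.
Let tT' : t <= T. Proof. by case/andP : tT. Qed.
Let ui n k : [/\ 0 <= u n k, u n k <= u n k.+1 & u n k.+1 <= T].
Proof. by split; [exact: stopped_ge0|exact: stopped_le|exact: stopped_leT]. Qed.

Lemma grid_incr_telescope F n : \sum_(0 <= k < 2 ^ n) dd F n k = F t - F 0.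
Proof. by rewrite telescope_sumr// stopped_last// stopped0. Qed.

(** A step of the stopped grid starts at a dyadic point unless it is empty, so
    that phi may be evaluated at points that do not depend on t. *)
Lemma grid_incr_dyadic (phi F : R -> R) n k :
  phi (dy n k) * dd F n k = phi (u n k) * dd F n k.
Proof. by have [->//|e] := stoppedP T0 t n k; rewrite /dd e subrr !mulr0. Qed.

Let rem n k : R := dd (prim be) n k + nu2 * dd g n k.

Lemma grid_incr_solE n k : dd y n k = nu1 * dd x n k + rem n k.
Proof. by have [h1 h2 h3] := ui n k; rewrite /dd yincr// /rem /dd; ring. Qed.

Let Vi : intble T (fun s => `|be s|). Proof. exact: intble_norm. Qed.

Lemma var_mono s s' : 0 <= s -> s <= s' -> s' <= T -> V s <= V s'.
Proof. by move=> *; apply: (prim_mono Vi). Qed.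

Lemma rem_sqr_le n k : (rem n k) ^+ 2 <=
  2 * dd V n k ^+ 2 + 2 * (nu2 ^+ 2 * (Ga ^+ 2 * ((T / 2 ^+ n) `^ (2 * b - 1) * dd id n k))).
Proof.
have [h1 h2 h3] := ui n k.
have hV : dd (prim be) n k ^+ 2 <= dd V n k ^+ 2.
  have := norm_prim_incr_le bei h1 h2 h3; rewrite -/(dd (prim be) n k) => h.
  by rewrite -[leLHS]real_normK ?num_real// ler_sqr ?nnegrE// (le_trans _ h).
have hg : dd g n k ^+ 2 <= Ga ^+ 2 * ((T / 2 ^+ n) `^ (2 * b - 1) * dd id n k).
  have du0 : 0 <= dd id n k by rewrite /dd subr_ge0.
  have := gh h1 h2 h3; rewrite -/(dd g n k) -[u n k.+1 - u n k]/(dd id n k) => h.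
  rewrite -[leLHS]real_normK ?num_real//.
  apply: (@le_trans _ _ ((Ga * dd id n k `^ b) ^+ 2)).
    by rewrite ler_sqr ?nnegrE// mulr_ge0 ?powR_ge0.
  rewrite exprMn ler_wpM2l ?sqr_ge0// -powR_mulrn ?powR_ge0// -powRrM (mulrC b).
  rewrite -[leLHS]mulr_powRB1 ?(lt_trans ltr01 b12)// [leLHS]mulrC ler_wpM2r//.
  rewrite ge0_ler_powR ?nnegrE ?divr_ge0 ?exprn_ge0 ?(ltW T0)//.
    by rewrite subr_ge0 ltW.
  exact: stopped_step.
have h : (nu2 * dd g n k) ^+ 2 <= nu2 ^+ 2 * (Ga ^+ 2 * ((T / 2 ^+ n) `^ (2 * b - 1) * dd id n k)).
  by rewrite exprMn ler_wpM2l// sqr_ge0.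
rewrite /rem; move: (dd (prim be) n k) (nu2 * dd g n k) h hV => v r h hV.
have h0 := sqr_ge0 (v - r).
have h1' : (v + r) ^+ 2 <= 2 * v ^+ 2 + 2 * r ^+ 2.
  by rewrite -subr_ge0 (_ : _ - _ = (v - r) ^+ 2)//; ring.
by apply: le_trans h1' _; rewrite lerD// ler_pM2l.
Qed.

Lemma sum_rem_sqr_le n e : (forall k, (k < 2 ^ n)%N -> dd V n k <= e) ->
  \sum_(0 <= k < 2 ^ n) rem n k ^+ 2 <=
  2 * (e * V T) + 2 * (nu2 ^+ 2 * (Ga ^+ 2 * ((T / 2 ^+ n) `^ (2 * b - 1) * T))).
Proof.
move=> he.
apply: (@le_trans _ _ (\sum_(0 <= k < 2 ^ n) (2 * (e * dd V n k) +
   2 * (nu2 ^+ 2 * (Ga ^+ 2 * ((T / 2 ^+ n) `^ (2 * b - 1) * dd id n k)))))).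
  rewrite big_nat [leRHS]big_nat; apply: ler_sum => k /andP[_ kn].
  apply: le_trans (rem_sqr_le n k) _; rewrite lerD2r expr2 ler_pM2l// ler_wpM2r ?he//.
  by have [h1 h2 h3] := ui n k; rewrite /dd subr_ge0 var_mono.
rewrite big_split/= -!mulr_sumr !grid_incr_telescope subr0 prim0 subr0.
have e0 : 0 <= e.
  have n2 : (0 < 2 ^ n)%N by rewrite expn_gt0.
  apply: le_trans (he _ n2); have [h1 h2 h3] := ui n 0.
  by rewrite /dd subr_ge0 var_mono.
apply: lerD; rewrite ler_pM2l// ler_wpM2l ?var_mono//.
  by rewrite sqr_ge0.
by rewrite ler_wpM2l ?sqr_ge0// ler_wpM2l ?powR_ge0.
Qed.

Lemma sum_rem_sqr_bound n : \sum_(0 <= k < 2 ^ n) rem n k ^+ 2 <=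
  2 * V T ^+ 2 + 2 * (nu2 ^+ 2 * (Ga ^+ 2 * (T `^ (2 * b - 1) * T))).
Proof.
apply: le_trans (sum_rem_sqr_le (e := V T) _) _.
  move=> k _; have [h1 h2 h3] := ui n k.
  have : V 0 <= V (u n k) by apply: var_mono => //; exact: le_trans h3.
  have : V (u n k.+1) <= V T by apply: var_mono => //; exact: le_trans h2.
  by rewrite prim0 /dd; lra.
rewrite expr2 lerD2l ler_pM2l// ler_wpM2l ?sqr_ge0// ler_wpM2l ?sqr_ge0//.
rewrite ler_wpM2r ?(ltW T0)// ge0_ler_powR ?nnegrE ?divr_ge0 ?exprn_ge0 ?(ltW T0)//.
  by rewrite subr_ge0 ltW.
by rewrite ler_pdivrMr ?exprn_gt0// ler_peMr ?(ltW T0)// exprn_ege1 ?ler1n.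
Qed.

Lemma powR_mesh_cvg0 c : 0 < c -> (T / 2 ^+ n) `^ c @[n --> \oo] --> 0.
Proof.
move=> c0; apply: powR_seq_cvg0 => //; last exact: dyadic_mesh_cvg0.
by move=> n; rewrite divr_ge0 ?exprn_ge0// ltW.
Qed.

Lemma var_mesh e : 0 < e -> \forall n \near \oo, forall k, dd V n k < e.
Proof.
move=> e0; have Vc : unif_cont T V by apply: prim_cont => //; exact: ltW.
have [d d0 hd] := Vc e e0.
have := dyadic_mesh_cvg0 T; move/cvgrPdist_lt => /(_ d d0).
apply: filterS => n; rewrite sub0r normrN ger0_norm ?divr_ge0 ?exprn_ge0 ?(ltW T0)// => h k.
have [h1 h2 h3] := ui n k.
have u1 : 0 <= u n k <= T by rewrite h1 (le_trans h2).
have u2 : 0 <= u n k.+1 <= T by rewrite h3 (le_trans h1).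
have := hd _ _ u1 u2; rewrite ger0_norm ?subr_ge0// => /(_ (le_lt_trans (stopped_step T0 t n k) h)).
by apply: le_lt_trans; exact: ler_norm.
Qed.

(** The part of the solution other than nu1 x has zero quadratic variation: it
    is the sum of a continuous function of finite variation and of a function
    that is Hölder of exponent greater than 1/2. *)
Lemma sum_rem_sqr_cvg0 : \sum_(0 <= k < 2 ^ n) rem n k ^+ 2 @[n --> \oo] --> 0.
Proof.
apply/cvgrPdist_lt => e e0.
have V0 : 0 <= V T by rewrite -(prim0 (fun s => `|be s|)) var_mono// ltW.
pose e1 := e / (4 * (V T + 1)).
have e10 : 0 < e1 by rewrite divr_gt0// mulr_gt0//; lra.
have C1 := powR_mesh_cvg0 (_ : 0 < 2 * b - 1).
have {}C1 := C1 ltac:(by rewrite subr_gt0).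
pose E n := 2 * (nu2 ^+ 2 * (Ga ^+ 2 * ((T / 2 ^+ n) `^ (2 * b - 1) * T))).
have : E n @[n --> \oo] --> 0.
  rewrite /E.
  rewrite -[X in _ --> X](mulr0 2); apply: cvgMr.
  rewrite -[X in _ --> X](mulr0 (nu2 ^+ 2)); apply: cvgMr.
  rewrite -[X in _ --> X](mulr0 (Ga ^+ 2)); apply: cvgMr.
  by rewrite -[X in _ --> X](mul0r T); apply: cvgMl.
move/cvgrPdist_lt => /(_ (e / 2)); rewrite divr_gt0// => /(_ isT) C2.
near=> n.
have h1 : forall k, dd V n k < e1 by near: n; exact: var_mesh.
have : `|0 - E n| < e / 2 by near: n; exact: C2.
rewrite !sub0r !normrN => h2.
rewrite ger0_norm; last by apply: sumr_ge0 => k _; exact: sqr_ge0.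
apply: le_lt_trans (sum_rem_sqr_le (e := e1) _) _ => [k _|]; first exact: ltW.
have h3 := le_lt_trans (ler_norm _) h2.
have : e1 * V T <= e / 4.
  rewrite /e1 invfM mulrA mulrAC ler_pdivrMr; last by lra.
  by rewrite ler_pM2l ?divr_gt0//; lra.
by move: h3; rewrite /E; lra.
Unshelve. all: by end_near. Qed.

(** The first-order Taylor formula bounds the left sums against x by quantities
    that do not depend on the grid, except for the quadratic variation of x and
    the left sum against g. *)
Lemma left_sum_bound n :
  nu1 * p * `|\sum_(0 <= k < 2 ^ n) y (dy n k) `^ (p - 1) * dd x n k| <=
  2 * M `^ p + p * M `^ (p - 1) * V T
  + `|nu2| * p * `|\sum_(0 <= k < 2 ^ n) y (dy n k) `^ (p - 1) * dd g n k|
  + p * (p - 1) * M `^ (p - 2) *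
    (2 * nu1 ^+ 2 * (\sum_(0 <= k < 2 ^ n) dd x n k ^+ 2)
     + 2 * (2 * V T ^+ 2 + 2 * (nu2 ^+ 2 * (Ga ^+ 2 * (T `^ (2 * b - 1) * T))))).
Proof.
have p0 : 0 < p by apply: lt_trans p2.
have p10 : 0 <= p - 1 by rewrite subr_ge0; apply: le_trans (ltW p2); rewrite ler1n.
have ypos s : 0 <= s <= T -> 0 < y s by move=> /ym /andP[h _]; exact: lt_le_trans h.
have yM s : 0 <= s <= T -> y s <= M by move=> /ym /andP[].
have M0 : 0 <= M by rewrite (le_trans _ (yM _ tT))// ltW// ypos.
have uI n' k : 0 <= u n' k <= T.
  by have [k1 k2 k3] := ui n' k; rewrite k1 (le_trans k2).
set Sx := \sum_(0 <= k < 2 ^ n) y _ `^ _ * dd x n k.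
set Sg := \sum_(0 <= k < 2 ^ n) y _ `^ _ * dd g n k.
pose Sb := \sum_(0 <= k < 2 ^ n) y (dy n k) `^ (p - 1) * dd (prim be) n k.
pose Sr := \sum_(0 <= k < 2 ^ n) (dd (fun s => y s `^ p) n k
   - p * y (u n k) `^ (p - 1) * dd y n k).
have E : nu1 * p * Sx = (y t `^ p - y 0 `^ p) - p * Sb - nu2 * p * Sg - Sr.
  have -> : Sr = (y t `^ p - y 0 `^ p) -
      \sum_(0 <= k < 2 ^ n) p * y (u n k) `^ (p - 1) * dd y n k.
    by rewrite -(grid_incr_telescope (fun s => y s `^ p) n) -sumrB.
  have -> : \sum_(0 <= k < 2 ^ n) p * y (u n k) `^ (p - 1) * dd y n k =
     p * Sb + nu1 * p * Sx + nu2 * p * Sg.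
    rewrite /Sb /Sx /Sg !mulr_sumr -!big_split/=; apply: eq_bigr => k _.
    rewrite -[LHS](grid_incr_dyadic (fun s => p * y s `^ (p - 1))).
    by rewrite grid_incr_solE /rem; ring.
  by ring.
have hf : `|y t `^ p - y 0 `^ p| <= 2 * M `^ p.
  have T00 : 0 <= (0:R) <= T by rewrite lexx ltW.
  have pp s : 0 <= s <= T -> 0 <= y s `^ p <= M `^ p.
    move=> sT; rewrite powR_ge0/= ge0_ler_powR ?nnegrE ?yM ?(ltW p0)//.
    by rewrite ltW// ypos.
  have /andP[a1 a2] := pp _ tT; have /andP[a3 a4] := pp _ T00.
  by rewrite ler_norml; apply/andP; split; lra.
have hb : `|Sb| <= M `^ (p - 1) * V T.
  apply: (@le_trans _ _ (\sum_(0 <= k < 2 ^ n) M `^ (p - 1) * dd V n k)).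
    apply: le_trans (ler_norm_sum _ _ _) _; apply: ler_sum => k _.
    rewrite (grid_incr_dyadic (fun s => y s `^ (p - 1))) normrM ger0_norm ?powR_ge0//.
    apply: ler_pM => //; first exact: powR_ge0.
      by rewrite ge0_ler_powR ?nnegrE ?yM// ltW// ypos.
    by have [k1 k2 k3] := ui n k; exact: norm_prim_incr_le bei k1 k2 k3.
  rewrite -mulr_sumr grid_incr_telescope prim0 subr0 ler_wpM2l ?powR_ge0//.
  exact: var_mono.
have hq : \sum_(0 <= k < 2 ^ n) dd y n k ^+ 2 <=
   2 * nu1 ^+ 2 * (\sum_(0 <= k < 2 ^ n) dd x n k ^+ 2) +
   2 * \sum_(0 <= k < 2 ^ n) rem n k ^+ 2.
  rewrite !mulr_sumr -big_split/=; apply: ler_sum => k _.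
  rewrite grid_incr_solE -subr_ge0 (_ : _ - _ = (nu1 * dd x n k - rem n k) ^+ 2).
    exact: sqr_ge0.
  by ring.
have hr : `|Sr| <= p * (p - 1) * M `^ (p - 2) * \sum_(0 <= k < 2 ^ n) dd y n k ^+ 2.
  rewrite mulr_sumr; apply: le_trans (ler_norm_sum _ _ _) _; apply: ler_sum => k _.
  by apply: powR_taylor1; rewrite ?ypos ?yM.
have MM : 0 <= p * (p - 1) * M `^ (p - 2).
  by apply: mulr_ge0; [apply: mulr_ge0 => //; exact: ltW|exact: powR_ge0].
have hrr := sum_rem_sqr_bound n.
have {}hr := le_trans hr (ler_wpM2l MM (le_trans hq
  (lerD (lexx _) (ler_wpM2l (ler0n R 2) hrr)))).
have -> : nu1 * p * `|Sx| = `|nu1 * p * Sx|.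
  by rewrite normrM ger0_norm// mulr_ge0// ltW.
rewrite E; apply: le_trans (ler_normB _ _) _; apply: lerD => //.
apply: le_trans (ler_normB _ _) _; apply: lerD; last first.
  by rewrite !normrM (gtr0_norm p0).
apply: le_trans (ler_normB _ _) _; apply: lerD => //.
by rewrite normrM (gtr0_norm p0) -mulrA ler_pM2l.
Qed.

Hypothesis QV : forall m j, (j <= 2 ^ m)%N ->
  \sum_(0 <= k < j * 2 ^ n) dd x (m + n) k ^+ 2 @[n --> \oo] --> u m j.

(** Only nu1 x contributes, since the other part has zero quadratic variation. *)
Lemma qv_sol m j : (j <= 2 ^ m)%N ->
  \sum_(0 <= k < j * 2 ^ n) dd y (m + n) k ^+ 2 / nu1 ^+ 2 @[n --> \oo] --> u m j.
Proof.
move=> jm.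
pose Sx n := \sum_(0 <= k < j * 2 ^ n) dd x (m + n) k ^+ 2.
pose D n := \sum_(0 <= k < j * 2 ^ n) (dd y (m + n) k ^+ 2 / nu1 ^+ 2 - dd x (m + n) k ^+ 2).
have -> : (fun n => \sum_(0 <= k < j * 2 ^ n) dd y (m + n) k ^+ 2 / nu1 ^+ 2) = (fun n => Sx n + D n).
  by apply/funext => n; rewrite /Sx /D sumrB addrC subrK.
rewrite -[X in _ --> X]addr0; apply: cvgD; first exact: QV.
apply/cvgrPdist_lt => e e0.
have T2 : 0 < 2 * (T + 1) by rewrite mulr_gt0// addr_gt0.
pose h := e / (2 * (T + 1)); have h0 : 0 < h by rewrite divr_gt0.
have c0 : 0 < (1 + h^-1) / nu1 ^+ 2 by rewrite divr_gt0 ?exprn_gt0// addr_gt0// invr_gt0.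
have /cvgrPdist_lt/(_ _ (divr_gt0 (divr_gt0 e0 (ltr0n _ 2)) c0))[N1 _ hN1] := sum_rem_sqr_cvg0.
have /cvgrPdist_lt/(_ _ ltr01)[N2 _ hN2] := QV jm.
exists (maxn N1 N2) => // n /= mn.
have n1 : (N1 <= m + n)%N := leq_trans (leq_trans (leq_maxl _ _) mn) (leq_addl _ _).
have n2 : (N2 <= n)%N := leq_trans (leq_maxr _ _) mn.
have := hN1 _ n1; have := hN2 _ n2 => /=.
rewrite !sub0r !normrN.
set X := \sum_(0 <= k < j * 2 ^ n) _; set Q := \sum_(0 <= k < _) _ => hX hQ.
have Dle : `|D n| <= h * X + (1 + h^-1) / nu1 ^+ 2 * Q.
  apply: (@le_trans _ _ (\sum_(0 <= k < j * 2 ^ n) (h * dd x (m + n) k ^+ 2 +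
     (1 + h^-1) / nu1 ^+ 2 * rem (m + n) k ^+ 2))).
    apply: le_trans (ler_norm_sum _ _ _) _; apply: ler_sum => k _.
    rewrite grid_incr_solE; move: (dd x _ _) (rem _ _) => a r.
    pose z := r / nu1.
    have rE : r = nu1 * z by rewrite /z mulrC divfK// gt_eqF.
    have -> : (nu1 * a + r) ^+ 2 / nu1 ^+ 2 - a ^+ 2 = 2 * a * z + z ^+ 2.
      by rewrite rE; field; rewrite gt_eqF.
    have -> : (1 + h^-1) / nu1 ^+ 2 * r ^+ 2 = (1 + h^-1) * z ^+ 2.
      by rewrite rE; field; rewrite !gt_eqF.
    have k1 : 0 <= h^-1 * (h * a + z) ^+ 2 by rewrite mulr_ge0 ?sqr_ge0// invr_ge0 ltW.
    have k2 : 0 <= h^-1 * (h * a - z) ^+ 2 by rewrite mulr_ge0 ?sqr_ge0// invr_ge0 ltW.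
    have e1 : h^-1 * (h * a + z) ^+ 2 = h * a ^+ 2 + 2 * a * z + h^-1 * z ^+ 2.
      by field; rewrite gt_eqF.
    have e2 : h^-1 * (h * a - z) ^+ 2 = h * a ^+ 2 - 2 * a * z + h^-1 * z ^+ 2.
      by field; rewrite gt_eqF.
    rewrite e1 in k1; rewrite e2 in k2; have := sqr_ge0 z => z2.
    by rewrite ler_norml; apply/andP; split; lra.
  rewrite big_split/= -!mulr_sumr lerD2l ler_pM2l// /Q expnD.
  rewrite [leRHS](@big_cat_nat _ _ _ (j * 2 ^ n)%N)//=; last by rewrite leq_mul2r jm orbT.
  by rewrite lerDl; apply: sumr_ge0 => k _; exact: sqr_ge0.
rewrite (le_lt_trans Dle)//.
have hX1 : X < T + 1.
  have := stopped_leT m j tT'; move: hX; rewrite ltr_norml => /andP[h1 _]; lra.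
have hX2 : h * X < e / 2.
  apply: (@lt_le_trans _ _ (h * (T + 1))); first by rewrite ltr_pM2l.
  by rewrite /h; rewrite le_eqVlt; apply/orP; left; apply/eqP; field; rewrite gt_eqF// addr_gt0.
have : (1 + h^-1) / nu1 ^+ 2 * Q < e / 2.
  by have := le_lt_trans (ler_norm _) hQ; rewrite ltr_pdivlMr// mulrC.
by move: hX2; lra.
Qed.

Let w2 s := 2^-1 * (p * (p - 1) * y s `^ (p - 2)).
Let f1 s := p * y s `^ (p - 1).

Lemma powR_sol_cont r : unif_cont T (fun s => y s `^ r).
Proof.
apply: (unif_cont_comp (F := fun v => v `^ r) (D := fun v => m0 <= v <= M)) => // e e0.
pose L := `|r| * (m0 `^ (r - 1) + M `^ (r - 1)) + 1.
have L0 : 0 < L by rewrite ltr_wpDl// mulr_ge0// addr_ge0 ?powR_ge0.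
exists (e / L); first by rewrite divr_gt0.
move=> v v' vD v'D h; apply: le_lt_trans (powR_lip r m00 vD v'D) _.
rewrite ltr_pdivlMr// mulrC in h; apply: le_lt_trans h.
by rewrite ler_wpM2r// lerDl.
Qed.

Let f1c : unif_cont T f1. Proof. by apply: unif_contZ; exact: powR_sol_cont. Qed.
Let w2c : unif_cont T w2. Proof. by do 2 apply: unif_contZ; exact: powR_sol_cont. Qed.

Lemma qv_term_cvg :
  \sum_(0 <= k < 2 ^ n) w2 (dy n k) * dd y n k ^+ 2 @[n --> \oo] --> nu1 ^+ 2 * prim w2 t.
Proof.
have := weighted_sum_cvg T0 tT (a := fun n k => dd y n k ^+ 2 / nu1 ^+ 2) _ w2c qv_sol.
move=> /(_ _)h; have {}h := h (fun n k => divr_ge0 (sqr_ge0 _) (sqr_ge0 _)).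
have -> : (fun n => \sum_(0 <= k < 2 ^ n) w2 (dy n k) * dd y n k ^+ 2) =
   (fun n => nu1 ^+ 2 * \sum_(0 <= k < 2 ^ n) w2 (dy n k) * (dd y n k ^+ 2 / nu1 ^+ 2)).
  apply/funext => n; rewrite mulr_sumr; apply: eq_bigr => k _.
  by field; rewrite gt_eqF.
exact: cvgMr.
Qed.

Lemma qv_total_cvg : \sum_(0 <= k < 2 ^ n) dd y n k ^+ 2 @[n --> \oo] --> nu1 ^+ 2 * t.
Proof.
have := qv_sol (leqnn (2 ^ 0)%N); rewrite stopped_last// => h.
have -> : (fun n => \sum_(0 <= k < 2 ^ n) dd y n k ^+ 2) =
   (fun n => nu1 ^+ 2 * \sum_(0 <= k < 2 ^ 0 * 2 ^ n) dd y (0 + n) k ^+ 2 / nu1 ^+ 2).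
  apply/funext => n; rewrite mul1n mulr_sumr; apply: eq_bigr => k _.
  by rewrite add0n; field; rewrite gt_eqF.
exact: cvgMr.
Qed.

(** The remainder is cubic in the increments: it is at most the largest of them
    times the quadratic variation. *)
Lemma taylor_rem_cvg0 :
  \sum_(0 <= k < 2 ^ n) (dd (fun s => y s `^ p) n k - f1 (dy n k) * dd y n k
     - w2 (dy n k) * dd y n k ^+ 2) @[n --> \oo] --> 0.
Proof.
have [K K0 hK] := powR_taylor2 p2 M m00.
apply/cvgrPdist_lt => e e0.
pose B := nu1 ^+ 2 * t + 1.
have B0 : 0 < B by rewrite ltr_wpDl// mulr_ge0// sqr_ge0.
have K1 : 0 < K + 1 by rewrite ltr_wpDl.
have [d d0 hd] := yc (divr_gt0 e0 (mulr_gt0 K1 B0)).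
have := dyadic_mesh_cvg0 T; move/cvgrPdist_lt => /(_ d d0) [N1 _ h1].
move/cvgrPdist_lt : qv_total_cvg => /(_ _ ltr01) [N2 _ h2].
exists (maxn N1 N2) => // n /= mn.
have n1 : (N1 <= n)%N := leq_trans (leq_maxl _ _) mn.
have n2 : (N2 <= n)%N := leq_trans (leq_maxr _ _) mn.
have {}h1 := h1 _ n1; have {}h2 := h2 _ n2; rewrite /= in h1 h2.
rewrite sub0r normrN ger0_norm ?divr_ge0 ?exprn_ge0 ?(ltW T0)// in h1.
rewrite sub0r normrN.
pose c := e / ((K + 1) * B); have c0 : 0 < c by rewrite divr_gt0// mulr_gt0.
apply: (@le_lt_trans _ _ (\sum_(0 <= k < 2 ^ n) K * c * dd y n k ^+ 2)).
  apply: le_trans (ler_norm_sum _ _ _) _; apply: ler_sum => k _.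
  rewrite grid_incr_dyadic.
  have -> : w2 (dy n k) * dd y n k ^+ 2 = w2 (u n k) * dd y n k ^+ 2.
    by rewrite expr2 !mulrA grid_incr_dyadic.
  have [k1 k2 k3] := ui n k.
  have u1 : 0 <= u n k <= T by rewrite k1 (le_trans k2).
  have u2 : 0 <= u n k.+1 <= T by rewrite k3 (le_trans k1).
  apply: le_trans (hK _ _ (ym u1) (ym u2)) _.
  have hy : `|dd y n k| <= c.
    apply/ltW/hd => //; rewrite ger0_norm ?subr_ge0//.
    by apply: le_lt_trans h1; exact: stopped_step.
  rewrite -/(dd y n k) exprSr real_normK ?num_real//.
  rewrite -(mulrA K) ler_wpM2l// mulrC ler_wpM2r ?sqr_ge0//.
rewrite -mulr_sumr.
have hS : \sum_(0 <= k < 2 ^ n) dd y n k ^+ 2 < B.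
  by move: h2; rewrite ltr_norml /B => /andP[h _]; lra.
apply: (@le_lt_trans _ _ (K * c * B)).
  by apply: ler_wpM2l; [apply: mulr_ge0 => //; exact: ltW|exact: ltW].
have -> : e = (K + 1) * c * B by rewrite /c; field; rewrite !gt_eqF.
by rewrite ltr_pM2r// ltr_pM2r// ltrDl.
Qed.

Lemma drift_term_cvg :
  \sum_(0 <= k < 2 ^ n) f1 (dy n k) * dd (prim be) n k @[n --> \oo] -->
  prim (fun s => f1 s * be s) t.
Proof.
have T0' := ltW T0.
have fi : intble T (fun s => f1 s * be s) by exact: intbleM.
have V0 : 0 <= V t by rewrite -(prim0 (fun s => `|be s|)) var_mono.
apply/cvgrPdist_lt => e e0.
have V1 : 0 < V t + 1 by rewrite ltr_wpDl.
pose c := e / (V t + 1); have c0 : 0 < c by rewrite divr_gt0.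
have [d d0 hd] := f1c c0.
have := dyadic_mesh_cvg0 T; move/cvgrPdist_lt => /(_ d d0); apply: filterS => n.
rewrite sub0r normrN ger0_norm ?divr_ge0 ?exprn_ge0 ?(ltW T0)// => hm.
have -> : prim (fun s => f1 s * be s) t = \sum_(0 <= k < 2 ^ n) dd (prim (fun s => f1 s * be s)) n k.
  by rewrite grid_incr_telescope prim0 subr0.
rewrite -sumrB; apply: (@le_lt_trans _ _ (\sum_(0 <= k < 2 ^ n) c * dd V n k)); last first.
  rewrite -mulr_sumr grid_incr_telescope prim0 subr0.
  have -> : e = c * (V t + 1) by rewrite /c divfK// gt_eqF.
  by rewrite ltr_pM2l// ltrDl.
apply: le_trans (ler_norm_sum _ _ _) _; apply: ler_sum => k _.
rewrite grid_incr_dyadic.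
have [k1 k2 k3] := ui n k.
have e1 s : s <= T -> prim (fun s => f1 s * be s - f1 (u n k) * be s) s =
     prim (fun s => f1 s * be s) s - f1 (u n k) * prim be s.
  by move=> sT; rewrite (primB fi)// ?(primZ _ bei)//; exact: intbleZ.
have e2 s : s <= T -> prim (fun s => c * `|be s|) s = c * V s.
  by move=> sT; rewrite (primZ _ Vi).
have i1 : intble T (fun s => f1 s * be s - f1 (u n k) * be s).
  by apply: intbleB => //; exact: intbleZ.
have -> : dd (prim (fun s => f1 s * be s)) n k - f1 (u n k) * dd (prim be) n k =
   dd (prim (fun s => f1 s * be s - f1 (u n k) * be s)) n k.
  by rewrite /dd !e1// ?(le_trans k2)//; ring.
apply: le_trans (norm_prim_incr_le i1 k1 k2 k3) _.
have -> : c * dd V n k = dd (prim (fun s => c * `|be s|)) n k.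
  by rewrite /dd !e2// ?(le_trans k2)// mulrBr.
apply: (le_prim_incr (intble_norm i1) (intbleZ c Vi)) => //.
move=> s s1 s2; rewrite -mulrBl normrM ler_wpM2r// ltW//.
have u1 : 0 <= u n k <= T by rewrite k1 (le_trans k2).
apply: hd => //; first by rewrite (le_trans k1 (ltW s1)) (le_trans s2).
rewrite ger0_norm ?subr_ge0 ?(ltW s1)//; apply: le_lt_trans hm.
by apply: le_trans (stopped_step T0 t n k); rewrite lerB.
Qed.

(** Föllmer's pathwise Itô formula.  In the Taylor formula summed over the grid
    every term converges, except possibly the left sums against x, which hence
    converge as well. *)
Lemma foellmer_ito (J : R) :
  \sum_(0 <= k < 2 ^ n) y (dy n k) `^ (p - 1) * dd g n k @[n --> \oo] --> J ->
  \sum_(0 <= k < 2 ^ n) y (dy n k) `^ (p - 1) * dd x n k @[n --> \oo] -->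
  (y t `^ p - y 0 `^ p - prim (fun s => f1 s * be s) t
    - nu1 ^+ 2 * prim w2 t - nu2 * p * J) / (nu1 * p).
Proof.
move=> Jc; have p0 : 0 < p by apply: lt_trans p2.
have -> : (fun n => \sum_(0 <= k < 2 ^ n) y (dy n k) `^ (p - 1) * dd x n k) = (fun n =>
  (y t `^ p - y 0 `^ p
   - \sum_(0 <= k < 2 ^ n) f1 (dy n k) * dd (prim be) n k
   - \sum_(0 <= k < 2 ^ n) w2 (dy n k) * dd y n k ^+ 2
   - nu2 * p * \sum_(0 <= k < 2 ^ n) y (dy n k) `^ (p - 1) * dd g n k
   - \sum_(0 <= k < 2 ^ n) (dd (fun s => y s `^ p) n k - f1 (dy n k) * dd y n k
     - w2 (dy n k) * dd y n k ^+ 2)) / (nu1 * p)).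
  apply/funext => n.
  have -> : \sum_(0 <= k < 2 ^ n) (dd (fun s => y s `^ p) n k - f1 (dy n k) * dd y n k
     - w2 (dy n k) * dd y n k ^+ 2) = (y t `^ p - y 0 `^ p)
     - \sum_(0 <= k < 2 ^ n) f1 (dy n k) * dd y n k
     - \sum_(0 <= k < 2 ^ n) w2 (dy n k) * dd y n k ^+ 2.
    by rewrite -(grid_incr_telescope (fun s => y s `^ p) n) -!sumrB.
  have -> : \sum_(0 <= k < 2 ^ n) f1 (dy n k) * dd y n k =
     \sum_(0 <= k < 2 ^ n) f1 (dy n k) * dd (prim be) n k
     + nu1 * p * (\sum_(0 <= k < 2 ^ n) y (dy n k) `^ (p - 1) * dd x n k)
     + nu2 * p * (\sum_(0 <= k < 2 ^ n) y (dy n k) `^ (p - 1) * dd g n k).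
    rewrite !mulr_sumr -!big_split/=; apply: eq_bigr => k _.
    by rewrite grid_incr_solE /rem /f1; ring.
  by field; rewrite !gt_eqF.
apply: cvgMl; rewrite -[X in _ --> X]subr0; apply: cvgB; last exact: taylor_rem_cvg0.
apply: cvgB; last exact: cvgMr.
apply: cvgB; last exact: qv_term_cvg.
apply: cvgB; last exact: drift_term_cvg.
exact: cvg_cst.
Qed.

End foellmer.

(** * Gaussian moments *)

Section gaussian.
Context {R : realType}.
Notation mu := (@lebesgue_measure R).
Implicit Types (s x v : R) (m : nat).

Lemma ge0_integral_normal_prob s (f : _ -> \bar R) :
  measurable_fun [set: R] f -> (forall x, 0 <= f x)%E ->
  (\int[normal_prob 0 s]_x f x = \int[mu]_x (f x * (normal_pdf 0 s x)%:E))%E.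
Proof.
move=> mf f0; have dom := normal_prob_dominates 0 s.
rewrite -(Radon_Nikodym_SigmaFinite.change_of_variables dom f0 measurableT mf).
apply: ge0_ae_eq_integral => //.
- apply: emeasurable_funM => //; apply: (measurable_int mu).
  exact: Radon_Nikodym_SigmaFinite.f_integrable.
- apply: emeasurable_funM => //; apply/measurable_EFinP; exact: measurable_normal_pdf.
- by move=> x _; rewrite mule_ge0// Radon_Nikodym_SigmaFinite.f_ge0.
- by move=> x _; rewrite mule_ge0// lee_fin normal_pdf_ge0.
- apply: ae_eqe_mul2l; apply: integral_ae_eq => //.
  + exact: Radon_Nikodym_SigmaFinite.f_integrable.
  + by apply/measurable_EFinP; exact: measurable_normal_pdf.
  + by move=> E _ mE; rewrite -(Radon_Nikodym_SigmaFinite.f_integral dom mE).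
Qed.

Lemma exprn_le_fact_expR m (u : R) : 0 <= u -> u ^+ m <= m`!%:R * expR u.
Proof.
move=> u0; case: m => [|m].
  by rewrite expr0 fact0 mul1r -[leLHS]expR0 ler_expR.
have := expR_ge1Dxn m u0; have f0 : (0 : R) < m.+1`!%:R by rewrite ltr0n fact_gt0.
move=> h; have : u ^+ m.+1 / m.+1`!%:R <= expR u by lra.
by rewrite ler_pdivrMr// mulrC.
Qed.

Definition gauss_cst m : R := m`!%:R * 4 ^+ m * Num.sqrt 2.

Lemma gauss_cst_ge0 m : 0 <= gauss_cst m.
Proof. by rewrite /gauss_cst !mulr_ge0 ?exprn_ge0 ?sqrtr_ge0. Qed.

(** Half of the Gaussian exponent absorbs the power of x; the other half leaves
    a Gaussian density of twice the variance. *)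
Lemma normal_pdf_moment_le s m x : 0 < s ->
  x ^+ (2 * m) * normal_pdf 0 s x <=
  gauss_cst m * s ^+ (2 * m) * normal_pdf 0 (Num.sqrt 2 * s) x.
Proof.
move=> s0; have q2 : (0 : R) < Num.sqrt 2 by rewrite sqrtr_gt0.
have s20 : 0 < Num.sqrt 2 * s by rewrite mulr_gt0.
rewrite !normal_pdfE ?gt_eqF//; rewrite /normal_peak /normal_fun.
set u := x ^+ 2 / (4 * s ^+ 2).
have u0 : 0 <= u by rewrite divr_ge0 ?sqr_ge0// mulr_ge0// sqr_ge0.
have -> : (Num.sqrt 2 * s) ^+ 2 = 2 * s ^+ 2 by rewrite exprMn sqr_sqrtr.
have -> : 2 * s ^+ 2 * pi *+ 2 = 2 * (s ^+ 2 * pi *+ 2) by rewrite mulrnAr mulrA.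
rewrite sqrtrM// invfM.
have -> : - (x - 0) ^+ 2 / (s ^+ 2 *+ 2) = - u - u.
  by rewrite subr0 /u -mulr_natl; field; rewrite gt_eqF.
have -> : - (x - 0) ^+ 2 / (2 * s ^+ 2 *+ 2) = - u.
  by rewrite subr0 /u -mulr_natl; field; rewrite gt_eqF.
have xE : x ^+ (2 * m) = 4 ^+ m * s ^+ (2 * m) * u ^+ m.
  rewrite !exprM -!exprMn; congr (_ ^+ _); rewrite /u; field.
  by rewrite gt_eqF.
rewrite xE expRD /gauss_cst.
set K := (Num.sqrt (s ^+ 2 * pi *+ 2))^-1; have K0 : 0 <= K by rewrite invr_ge0 sqrtr_ge0.
have h := exprn_le_fact_expR m u0.
have eu : expR u * expR (- u) = 1 by rewrite -expRD subrr expR0.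
have h' : u ^+ m * expR (- u) <= m`!%:R.
  apply: le_trans (ler_wpM2r (expR_ge0 _) h) _.
  by rewrite -mulrA eu mulr1.
have A0 : 0 <= 4 ^+ m * s ^+ (2 * m) * K * expR (- u).
  by rewrite !mulr_ge0 ?exprn_ge0 ?expR_ge0// ltW.
rewrite -subr_ge0 (_ : _ - _ = 4 ^+ m * s ^+ (2 * m) * K * expR (- u) *
  (m`!%:R - u ^+ m * expR (- u))).
  by rewrite mulr_ge0// subr_ge0.
clear -q2; move: K (expR (- u)) (m`!%:R : R) (u ^+ m) (4 ^+ m : R) (s ^+ (2 * m)) (Num.sqrt 2) q2.
by move=> K' E f um c sm q q0; field; rewrite gt_eqF.
Qed.

Lemma normal_moment_le s m : 0 < s ->
  (\int[normal_prob 0 s]_x (x ^+ (2 * m))%:E <= (gauss_cst m * s ^+ (2 * m))%:E)%E.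
Proof.
move=> s0; rewrite ge0_integral_normal_prob; last 2 first.
- by apply/measurable_EFinP; apply: measurable_funX.
- by move=> x; rewrite lee_fin exprM exprn_ge0// sqr_ge0.
apply: (@le_trans _ _ (\int[mu]_x ((gauss_cst m * s ^+ (2 * m))%:E *
   (normal_pdf 0 (Num.sqrt 2 * s) x)%:E))%E).
  apply: ge0_le_integral => //.
  - by move=> x _; rewrite -EFinM lee_fin mulr_ge0 ?normal_pdf_ge0// exprM exprn_ge0// sqr_ge0.
  - apply/measurable_EFinP/measurable_funM; first exact: measurable_funX.
    exact: measurable_normal_pdf.
  - apply/measurable_EFinP/measurable_funM => //; exact: measurable_normal_pdf.
  - by move=> x _; rewrite -!EFinM lee_fin normal_pdf_moment_le.
rewrite ge0_integralZl//; last 3 first.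
- by apply/measurable_EFinP; exact: measurable_normal_pdf.
- by move=> x _; rewrite lee_fin normal_pdf_ge0.
- by rewrite lee_fin mulr_ge0 ?gauss_cst_ge0// exprn_ge0// ltW.
by rewrite integral_normal_pdf mule1.
Qed.

Section second_moment.
Variables (s : R) (s0 : 0 < s).
Let pdf := @normal_pdf R 0 s.

Let mpdf : measurable_fun setT pdf. Proof. exact: measurable_normal_pdf. Qed.
Let pdf0 x : 0 <= pdf x. Proof. exact: normal_pdf_ge0. Qed.

Let pdfE x : pdf x = normal_peak s * expR (- x ^+ 2 * (s ^+ 2 *+ 2)^-1).
Proof. by rewrite /pdf normal_pdfE ?gt_eqF// /normal_fun subr0. Qed.

(** The derivative of x * pdf x. *)
Let g x := pdf x - x ^+ 2 / s ^+ 2 * pdf x.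

Let is_derive_xpdf (x : R) : is_derive x 1 (fun y : R => y * pdf y) (g x).
Proof.
rewrite (_ : (fun y : R => y * pdf y) =
  (fun y => y * (normal_peak s * expR (- y ^+ 2 * (s ^+ 2 *+ 2)^-1)))); last first.
  by apply/funext => y; rewrite pdfE.
apply: is_derive_eq; rewrite /g pdfE /GRing.scale/=.
by rewrite -mulr_natl; field; rewrite gt_eqF.
Qed.

Let sqr_pdf_le x : x ^+ 2 * pdf x <= gauss_cst 1 * s ^+ 2 * normal_pdf 0 (Num.sqrt 2 * s) x.
Proof. by have := normal_pdf_moment_le 1 x s0; rewrite muln1. Qed.

Let sq2 : Num.sqrt 2 * s != 0 :> R.
Proof. by rewrite mulf_neq0 ?gt_eqF// sqrtr_gt0. Qed.

Let int_sqr_pdf : mu.-integrable setT (fun x => (x ^+ 2 * pdf x)%:E).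
Proof.
apply: (@le_integrable _ _ _ mu setT measurableT _
  (fun x => ((gauss_cst 1 * s ^+ 2)%:E * (normal_pdf 0 (Num.sqrt 2 * s) x)%:E)%E)).
- by apply/measurable_EFinP/measurable_funM => //; exact: measurable_funX.
- move=> x _ /=; rewrite lee_fin ger0_norm; last by rewrite mulr_ge0// sqr_ge0.
  by apply: le_trans (sqr_pdf_le x) _; exact: ler_norm.
- by apply: integrableZl => //; exact: integrable_normal_pdf.
Qed.

Let int_g : mu.-integrable setT (EFin \o g).
Proof.
rewrite (_ : EFin \o g = (fun x => (pdf x)%:E - (s ^- 2)%:E * (x ^+ 2 * pdf x)%:E)%E).
  apply: integrableB => //; first exact: integrable_normal_pdf.
  exact: integrableZl.
by apply/funext => x /=; congr (_%:E); rewrite /g mulrA [s ^- 2 * _]mulrC.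
Qed.

Let xpdf_cvg0 : (n.+1%:R * pdf n.+1%:R) @[n --> \oo] --> (0 : R).
Proof.
pose C := gauss_cst 1 * s ^+ 2 * normal_peak (Num.sqrt 2 * s).
apply: (@squeeze_cvgr _ _ _ _ (fun=> 0) (fun n => C * n.+1%:R^-1)).
- apply: nearW => n; rewrite mulr_ge0//=.
  rewrite ler_pdivlMr// mulrC mulrA -expr2.
  apply: le_trans (sqr_pdf_le _) _; rewrite ler_wpM2l//.
    by rewrite mulr_ge0 ?gauss_cst_ge0 ?sqr_ge0.
  exact: normal_pdf_ub.
- exact: cvg_cst.
- by rewrite -[X in _ --> X](mulr0 C); apply: cvgMr; exact: cvg_harmonic.
Qed.

Let int_g_itv n : (\int[mu]_(x in `[(- n.+1%:R)%R, n.+1%:R%R]) (g x)%:E)%E =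
  (2 * (n.+1%:R * pdf n.+1%:R))%:E.
Proof.
have h (x : R) : derivable (fun y : R => y * pdf y) x 1 by have [] := is_derive_xpdf x.
have cp := @continuous_normal_pdf R 0 s (lt0r_neq0 s0).
rewrite (@continuous_FTC2 _ g (fun y : R => y * pdf y)).
- have -> : pdf (- n.+1%:R) = pdf n.+1%:R by rewrite !pdfE sqrrN.
  by rewrite -EFinB mulNr opprK; congr EFin; ring.
- by rewrite gtrN// ltr0n.
- apply: continuous_subspaceT => x; rewrite /g.
  apply: cvgB; first exact: cp.
  apply: cvgM; last exact: cp.
  by apply: cvgMl; exact: exprn_continuous.
- split; first by move=> x _; exact: h.
    by apply: cvg_at_right_filter; apply: cvgM; [exact: cvg_id|exact: cp].
  by apply: cvg_at_left_filter; apply: cvgM; [exact: cvg_id|exact: cp].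
- by move=> x _; rewrite derive1E; have [_ ->] := is_derive_xpdf x.
Qed.

(** Integration of the derivative of x pdf(x), whose boundary terms vanish. *)
Lemma normal_second_moment :
  (\int[normal_prob 0 s]_x (x ^+ 2)%:E = (s ^+ 2)%:E)%E.
Proof.
have int0 : (\int[mu]_x (g x)%:E = 0)%E.
  pose f_ n := (EFin \o g) \_ `[(- n.+1%:R)%R, n.+1%:R]%classic.
  have mg : measurable_fun setT (EFin \o g) by exact: (measurable_int mu).
  have mf_ n : measurable_fun setT (f_ n).
    by apply/(measurable_restrictT _ _).1 => //; apply: measurable_funTS.
  have fg : {ae mu, forall x, setT x -> f_ ^~ x @ \oo --> (EFin \o g) x}.
    apply/aeW => x _; apply: cvg_near_cst; exists (Num.truncn `|x|) => // n /= xn.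
    rewrite /f_ patchE ifT// inE /= in_itv /= -ler_norml.
    apply: ltW; apply: lt_le_trans (truncnS_gt _) _; by rewrite ler_nat ltnS.
  have ig := integrable_abse int_g.
  have fle : {ae mu, forall x n, setT x -> (`|f_ n x| <= `|(EFin \o g) x|)%E}.
    by apply/aeW => x n _; rewrite /f_ patchE; case: ifPn => // _; rewrite abse0.
  have [_ _ h] := @dominated_convergence _ _ R mu setT measurableT f_ _ _ mf_ mg fg ig fle.
  apply: (cvg_unique _ h) => //=.
  under eq_fun do rewrite -integral_mkcond int_g_itv.
  apply: cvg_EFin; first by apply: nearW.
  by rewrite -[X in _ --> X](mulr0 2); apply: cvgMr.
rewrite ge0_integral_normal_prob; last 2 first.
- by apply/measurable_EFinP; apply: measurable_funX.
- by move=> x; rewrite lee_fin sqr_ge0.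
under eq_integral do rewrite -EFinM.
move: int0; rewrite (_ : (fun x => (g x)%:E) =
   (fun x => (pdf x)%:E - (s ^- 2)%:E * (x ^+ 2 * pdf x)%:E)%E); last first.
  by apply/funext => x /=; congr (_%:E); rewrite /g mulrA [s ^- 2 * _]mulrC.
rewrite integralB//=; last 2 first.
- exact: integrable_normal_pdf.
- exact: integrableZl.
rewrite integral_normal_pdf integralZl//.
have fin := integrable_fin_num measurableT int_sqr_pdf.
rewrite -(fineK fin); set I := fine _.
rewrite -EFinM -EFinB => -[] e; congr EFin.
have : s ^+ 2 * (1 - s ^- 2 * I) = 0 by rewrite e mulr0.
by rewrite mulrBr mulr1 mulrA divff ?mul1r ?expf_neq0 ?gt_eqF// => /eqP; rewrite subr_eq0 => /eqP.
Qed.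

End second_moment.

End gaussian.

Section gaussian_law.
Context {R : realType} d (Om : measurableType d) (P : probability Om R).
Variables (f : Om -> R) (v : R).
Hypotheses (mf : measurable_fun setT f) (v0 : 0 <= v) (fv : has_law_N0 P f v).

Lemma ge0_integral_law (g : R -> \bar R) : measurable_fun [set: R] g ->
  (forall x, 0 <= g x)%E ->
  (\int[P]_w g (f w) = if v == 0%R then g 0%R else \int[normal_prob 0 (Num.sqrt v)]_x g x)%E.
Proof.
move=> mg g0.
pose f' : Om -> measurableTypeR R := f.
have mf' : measurable_fun setT f' by exact: mf.
have := @ge0_integral_pushforward _ _ _ _ _ f' mf' P setT g measurableT mg (fun _ _ => g0 _).
rewrite preimage_setT => /= <-.
have [v00|vn0] := eqVneq v 0.
  rewrite (eq_measure_integral (dirac (0 : measurableTypeR R))); last first.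
    by move=> A mA _; rewrite /= /pushforward fv// /centered_normal v00 eqxx.
  by rewrite integral_dirac// diracT mul1e.
apply: (eq_measure_integral (normal_prob 0 (Num.sqrt v))) => A mA _.
by rewrite /= /pushforward fv// /centered_normal (negbTE vn0).
Qed.

Lemma law_moment_le m :
  (\int[P]_w ((f w) ^+ (2 * m))%:E <= (gauss_cst m * v ^+ m)%:E)%E.
Proof.
rewrite (ge0_integral_law (g := fun x => (x ^+ (2 * m))%:E)); last 2 first.
- by apply/measurable_EFinP; apply: measurable_funX.
- by move=> x; rewrite lee_fin exprM exprn_ge0// sqr_ge0.
have [->|vn0] := eqVneq v 0.
  rewrite lee_fin; case: m => [|m].
    rewrite muln0 !expr0 /gauss_cst fact0 expr0 !mul1r mulr1.
    rewrite -[leLHS]sqrtr1 ler_sqrt ?ler1n//.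
  by rewrite mulnS expr0n /= mulr_ge0 ?gauss_cst_ge0 ?exprn_ge0.
have vp : 0 < v by rewrite lt_neqAle eq_sym vn0.
have sv : 0 < Num.sqrt v by rewrite sqrtr_gt0.
by apply: le_trans (normal_moment_le m sv) _; rewrite exprM sqr_sqrtr.
Qed.

Lemma law_second_moment : (\int[P]_w ((f w) ^+ 2)%:E = v%:E)%E.
Proof.
rewrite (ge0_integral_law (g := fun x => (x ^+ 2)%:E)); last 2 first.
- by apply/measurable_EFinP; apply: measurable_funX.
- by move=> x; rewrite lee_fin sqr_ge0.
have [->|vn0] := eqVneq v 0; first by rewrite expr0n.
have vp : 0 < v by rewrite lt_neqAle eq_sym vn0.
by rewrite normal_second_moment ?sqrtr_gt0// sqr_sqrtr.
Qed.

Lemma law_dirac_ae : v = 0 -> {ae P, forall w, f w = 0}.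
Proof.
move=> v00; exists (f @^-1` (~` [set 0])); split.
- by rewrite -[X in measurable X]setTI; apply: mf => //; apply: measurableC.
- rewrite fv; last by apply: measurableC.
  by rewrite /centered_normal v00 eqxx diracE memNset// => /=; apply.
- by move=> w /= fw0; apply: fw0.
Qed.

End gaussian_law.

(** * Hölder constants with moments *)

Section summable_moments.
Context {R : realType} d (Om : measurableType d) (P : probability Om R).

(** Monotone convergence for the series, whose sum S is a common bound. *)
Lemma geometric_integral_sum (F : nat -> Om -> R) (a r : R) :
  (forall n, measurable_fun setT (F n)) -> (forall n w, 0 <= F n w) ->
  0 <= a -> 0 <= r -> r < 1 ->
  (forall n, \int[P]_w (F n w)%:E <= (a * r ^+ n)%:E)%E ->
  exists S : Om -> R, [/\ measurable_fun setT S, (forall w, 0 <= S w),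
    (\int[P]_w (S w)%:E < +oo)%E,
    {ae P, forall w, forall n, F n w <= S w} &
    {ae P, forall w, F n w @[n --> \oo] --> 0}].
Proof.
move=> mF F0 a0 r0 r1 hF.
pose Q w := (\sum_(0 <= n <oo) (F n w)%:E)%E.
have Q0 w : (0 <= Q w)%E by apply: nneseries_ge0 => n _ _; rewrite lee_fin.
have mQ : measurable_fun setT Q.
  apply: (@ge0_emeasurable_sum _ _ _ _ (fun n w => (F n w)%:E) xpredT).
    by move=> k x _ _; rewrite lee_fin.
  by move=> k _; apply/measurable_EFinP.
have c1 : 0 < 1 - r by rewrite subr_gt0.
have EQ : (\int[P]_w Q w <= (a / (1 - r))%:E)%E.
  rewrite integral_nneseries//; last 2 first.
    by move=> n; apply/measurable_EFinP.
    by move=> n x _; rewrite lee_fin.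
  apply: lime_le.
    by apply: is_cvg_nneseries => n _ _; apply: integral_ge0 => w _; rewrite lee_fin.
  apply: nearW => n.
  apply: (@le_trans _ _ (\sum_(0 <= k < n) (a * r ^+ k)%:E)%E).
    by apply: lee_sum => k _; exact: hF.
  rewrite sumEFin lee_fin -mulr_sumr ler_wpM2l//.
  rewrite -[leRHS]mul1r ler_pdivlMr//.
  have -> : (\sum_(0 <= k < n) r ^+ k) * (1 - r) = 1 - r ^+ n.
    elim: n => [|n IH]; first by rewrite big_geq// mul0r expr0 subrr.
    by rewrite big_nat_recr//= mulrDl IH exprS; ring.
  by rewrite gerBl exprn_ge0.
have EQoo : (\int[P]_w Q w < +oo)%E by apply: le_lt_trans EQ _; rewrite ltry.
have iQ : P.-integrable setT Q.
  apply/integrableP; split => //.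
  by under eq_integral do rewrite gee0_abs//.
have Qfin := integrable_ae measurableT iQ.
exists (fun w => fine (Q w)); split.
- exact: measurableT_comp.
- by move=> w; apply: fine_ge0.
- apply: le_lt_trans EQoo; apply: ge0_le_integral => //.
  + by move=> w _; rewrite lee_fin fine_ge0.
  + by apply/measurable_EFinP; exact: measurableT_comp.
  + by move=> w _; have := Q0 w; case: (Q w) => [x| |]//= _; rewrite leey.
- apply: filterS Qfin => w /(_ I) fw n; rewrite -lee_fin (fineK fw).
  apply: le_trans (nneseries_lim_ge n.+1 _); last by move=> k _; rewrite lee_fin.
  rewrite big_nat_recr//= leeDr// sumEFin lee_fin; apply: sumr_ge0 => k _; exact: F0.
- apply: filterS Qfin => w /(_ I) fw.
  apply: cvg_series_cvg_0; apply: nondecreasing_is_cvgn.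
    by apply/nondecreasing_seqP => n; rewrite /series/= big_nat_recr//= lerDl.
  exists (fine (Q w)) => _ [n _ <-] /=.
  rewrite -lee_fin (fineK fw) -sumEFin.
  by apply: nneseries_lim_ge => k _; rewrite lee_fin.
Qed.

Lemma le_power_mean2 (N : nat) (x : nat -> R) :
  (\sum_(0 <= k < N) x k) ^+ 2 <= N%:R * \sum_(0 <= k < N) x k ^+ 2.
Proof.
elim: N => [|N IH]; first by rewrite !big_geq// expr0n mul0r.
rewrite !big_nat_recr//=; move: IH.
set s := \sum_(0 <= k < N) x k; set q := \sum_(0 <= k < N) x k ^+ 2 => IH.
have hs : 2 * (s * x N) <= q + N%:R * x N ^+ 2.
  have : \sum_(0 <= k < N) (2 * (x k * x N)) <= \sum_(0 <= k < N) (x k ^+ 2 + x N ^+ 2).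
    apply: ler_sum => k _; rewrite -subr_ge0.
    rewrite (_ : _ - _ = (x k - x N) ^+ 2) ?sqr_ge0//; ring.
  rewrite -mulr_sumr -mulr_suml big_split/= sumr_const_nat subn0.
  by rewrite -[x N ^+ 2 *+ N]mulr_natl.
by rewrite -natr1; move: IH hs; lra.
Qed.

End summable_moments.

Section holder_paths.
Context {R : realType} d (Om : measurableType d) (P : probability Om R).
Variables (T : R) (T0 : 0 < T).

(** Kolmogorov's criterion: the moments of the normalized increments at the n-th
    dyadic level decrease geometrically, so that their sum gives a Hölder
    constant at dyadic points, and chaining extends it to all times. *)
Lemma kolmogorov_holder (G : R -> Om -> R) (h de C : R) (m : nat) :
  (forall t, measurable_fun setT (G t)) ->
  {ae P, forall w, unif_cont T (G ^~ w)} ->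
  0 <= C -> 0 < de -> 1 + de * (2 * m)%:R < h * (2 * m)%:R ->
  (forall s t, 0 <= s -> s <= t -> t <= T ->
    (\int[P]_w ((G t w - G s w) ^+ (2 * m))%:E <= (C * (t - s) `^ (h * (2 * m)%:R))%:E)%E) ->
  exists K : Om -> R, [/\ measurable_fun setT K, (forall w, 0 <= K w),
    (\int[P]_w (K w ^+ (2 * m))%:E < +oo)%E &
    {ae P, forall w, forall s t, 0 <= s -> s <= t -> t <= T ->
      `|G t w - G s w| <= K w * (t - s) `^ de}].
Proof.
move=> mG Gc C0 de0 hde GC.
have m0 : (0 < m)%N.
  by case: m hde {GC} => //; rewrite muln0 !mulr0 addr0 ltr10.
have M0 : (0 : R) < (2 * m)%:R by rewrite ltr0n muln_gt0.
pose q : R := 2^-1 `^ de.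
have q0 : 0 < q by rewrite powR_gt0.
pose D n k w := (G (dyadic T n k.+1) w - G (dyadic T n k) w).
pose F n w := \sum_(0 <= k < 2 ^ n) (D n k w / q ^+ n) ^+ (2 * m).
have x2m (x : R) : 0 <= x ^+ (2 * m) by rewrite exprM exprn_ge0// sqr_ge0.
have mD n k : measurable_fun setT (D n k) by exact: measurable_funB.
have mF n : measurable_fun setT (F n).
  apply: measurable_sum => k; apply: measurable_funX.
  by apply: measurable_funM => //; exact: mD.
have F0 n w : 0 <= F n w by apply: sumr_ge0.
pose r : R := 2 * (2^-1 `^ (h * (2 * m)%:R)) / q ^+ (2 * m).
have qM : q ^+ (2 * m) = 2^-1 `^ (de * (2 * m)%:R).
  by rewrite /q -powR_mulrn ?powR_ge0// powRrM.
have r0 : 0 <= r by rewrite divr_ge0 ?exprn_ge0 ?mulr_ge0 ?powR_ge0// ltW.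
have r1 : r < 1.
  rewrite /r qM ltr_pdivrMr ?powR_gt0// mul1r.
  have {1}-> : (2 : R) = (2^-1) `^ (-1) by rewrite powR_inv1 ?invr_ge0// invrK.
  rewrite -powRD; last by rewrite invr_eq0 pnatr_eq0 implybT.
  have h2 : 2^-1 != 0 :> R by rewrite invr_eq0 pnatr_eq0.
  have l2 : ln 2^-1 < 0 :> R by apply: ln_lt0; rewrite invr_gt0 ltr0n invf_lt1// ltr1n.
  by rewrite /powR (negbTE h2) ltr_expR (ltr_nM2r l2); move: hde; lra.
have hF n : (\int[P]_w (F n w)%:E <= ((C * T `^ (h * (2 * m)%:R)) * r ^+ n)%:E)%E.
  pose b := C * (T / 2 ^+ n) `^ (h * (2 * m)%:R) / (q ^+ n) ^+ (2 * m).
  have qn : 0 < q ^+ n by rewrite exprn_gt0.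
  have hk k : (k < 2 ^ n)%N -> (\int[P]_w ((D n k w / q ^+ n) ^+ (2 * m))%:E <= b%:E)%E.
    move=> kn.
    have -> : (fun w => ((D n k w / q ^+ n) ^+ (2 * m))%:E) =
       (fun w => ((q ^+ n) ^- (2 * m))%:E * ((D n k w) ^+ (2 * m))%:E)%E.
      by apply/funext => w; rewrite -EFinM expr_div_n mulrC.
    rewrite ge0_integralZl//; last 3 first.
    - by apply/measurable_EFinP; apply: measurable_funX; exact: mD.
    - by move=> w _; rewrite lee_fin.
    - by rewrite lee_fin invr_ge0 exprn_ge0// ltW.
    have /andP[d1 d2] := dyadic_itv T0 kn.
    have /andP[d3 d4] := dyadic_itv T0 (ltnW kn).
    have d5 := dyadic_leq n (ltW T0) (leqnSn k).
    apply: le_trans (lee_wpmul2l _ (GC _ _ d3 d5 d2)) _.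
      by rewrite lee_fin invr_ge0 exprn_ge0// ltW.
    by rewrite -EFinM lee_fin dyadic_step /b mulrC.
  have -> : C * T `^ (h * (2 * m)%:R) * r ^+ n = \sum_(0 <= k < 2 ^ n) b.
    rewrite sumr_const_nat subn0 -[b *+ _]mulr_natl /b natrX /r expr_div_n exprMn.
    have -> : (T / 2 ^+ n) `^ (h * (2 * m)%:R) = T `^ (h * (2 * m)%:R) * (2^-1 `^ (h * (2 * m)%:R)) ^+ n.
      rewrite -exprVn powRM ?(ltW T0) ?exprn_ge0 ?invr_ge0//; congr (_ * _).
      by rewrite -[2^-1 ^+ n]powR_mulrn ?invr_ge0// -[_ ^+ n]powR_mulrn ?powR_ge0// -!powRrM mulrC.
    by rewrite [in RHS]exprAC; ring.
  rewrite /F; under eq_integral do rewrite -sumEFin.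
  rewrite ge0_integral_sum//; last 2 first.
  - move=> k; apply/measurable_EFinP; apply: measurable_funX.
    by apply: measurable_funM => //; exact: mD.
  - by move=> k w _; rewrite lee_fin.
  rewrite -sumEFin big_nat [leRHS]big_nat; apply: lee_sum => k /andP[_ kn].
  exact: hk.
have [|S [mS S0 iS FS _]] := geometric_integral_sum mF F0 _ r0 r1 hF.
  by rewrite mulr_ge0// powR_ge0.
have q1 : q < 1.
  have := @gt0_ltr_powR R _ de0 2^-1 1; rewrite powR1 !nnegrE => -> //.
  by rewrite invf_lt1// ltr1n.
pose c : R := (2 / (1 - q) + 1) * (2 / T) `^ de.
have c0 : 0 <= c.
  by rewrite mulr_ge0 ?powR_ge0// addr_ge0// divr_ge0// subr_ge0 ltW.
pose K w := (S w) `^ ((2 * m)%:R^-1).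
have K0 w : 0 <= K w by exact: powR_ge0.
have KM w : K w ^+ (2 * m) = S w.
  by rewrite -powR_mulrn// -powRrM mulVf ?gt_eqF// powRr1.
have mK : measurable_fun setT K.
  by apply: (measurableT_comp (measurable_powR _)).
exists (fun w => c * K w); split.
- by apply: measurable_funM.
- by move=> w; rewrite mulr_ge0.
- have -> : (fun w => ((c * K w) ^+ (2 * m))%:E) = (fun w => (c ^+ (2 * m))%:E * (S w)%:E)%E.
    by apply/funext => w; rewrite exprMn KM EFinM.
  rewrite ge0_integralZl//; last 3 first.
  + exact/measurable_EFinP.
  + by move=> w _; rewrite lee_fin.
  + by rewrite lee_fin.
  by rewrite lte_mul_pinfty// ?lee_fin.
- apply: filterS2 Gc FS => w Gc FS.
  apply: (dyadic_holder T0 de0 (K0 w) Gc) => n k kn; rewrite -/q.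
  have qn : 0 < q ^+ n by rewrite exprn_gt0.
  have h1 : (D n k w / q ^+ n) ^+ (2 * m) <= K w ^+ (2 * m).
    rewrite KM; apply: le_trans (FS n).
    rewrite /F (@big_cat_nat _ _ _ k)//=; last exact: ltnW.
    rewrite (@big_ltn _ _ _ k)//= addrCA lerDl addr_ge0//; exact: sumr_ge0.
  have : `|D n k w / q ^+ n| <= K w.
    rewrite -(@ler_pXn2r _ (2 * m)) ?nnegrE ?muln_gt0//.
    by rewrite -normrX ger0_norm.
  by rewrite normrM normfV (gtr0_norm qn) ler_pdivrMr.
Qed.

End holder_paths.

(** * Quadratic variation of the Wiener process *)

Section independent_product.
Context {R : realType} d (Om : measurableType d) (P : probability Om R).

(** The pair (U, V) has a product law, to which Tonelli's theorem applies. *)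
Lemma ge0_integral_indep_mul (U V : {RV P >-> R}) (f g : R -> \bar R) :
  (forall A B : set R, measurable A -> measurable B ->
     P (U @^-1` A `&` V @^-1` B) = (P (U @^-1` A) * P (V @^-1` B))%E) ->
  measurable_fun [set: R] f -> measurable_fun [set: R] g ->
  (forall x, 0 <= f x)%E -> (forall x, 0 <= g x)%E ->
  (\int[P]_w (f (U w) * g (V w)) = (\int[P]_w f (U w)) * (\int[P]_w g (V w)))%E.
Proof.
move=> UV mf mg f0 g0.
have mW : measurable_fun setT (fun w => (U w, V w)) by exact: measurable_fun_pair.
pose W : {RV P >-> (R * R)%type} := mfun_Sub (mem_set mW).
pose h (z : R * R) := (f z.1 * g z.2)%E.
have mh : measurable_fun setT h.
  by apply: emeasurable_funM; [exact: (measurableT_comp mf)|exact: (measurableT_comp mg)].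
have h0 z : (0 <= h z)%E by rewrite mule_ge0.
have -> : (\int[P]_w (f (U w) * g (V w)) = \int[distribution P W]_z h z)%E.
  by rewrite ge0_integral_distribution.
have e := @product_measure_unique _ _ _ _ R (distribution P U) (distribution P V) (distribution P W).
rewrite (eq_measure_integral (distribution P U \x distribution P V)%E); last first.
  by move=> A mA _; apply/esym/e => // A' B' mA' mB'; exact: UV.
rewrite fubini_tonelli1//.
rewrite /fubini_F /h /=.
under eq_integral do rewrite ge0_integralZl//.
rewrite ge0_integralZr//; last exact: integral_ge0.
by rewrite !ge0_integral_distribution.
Qed.

End independent_product.

Section wiener_quadratic_variation.
Context {R : realType} d (Om : measurableType d) (P : probability Om R).
Variables (T t : R) (B : R -> {RV P >-> R}).
Hypotheses (T0 : 0 < T) (tT : 0 <= t <= T) (hB : wiener_process T B).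

Local Notation u := (stopped T t).
Local Notation dB n k := (fun w => B (u n k.+1) w - B (u n k) w).
Local Notation du n k := (u n k.+1 - u n k).

Let t0 : 0 <= t. Proof. by case/andP : tT. Qed.
Let tT' : t <= T. Proof. by case/andP : tT. Qed.
Let ui n k : [/\ 0 <= u n k, u n k <= u n k.+1 & u n k.+1 <= T].
Proof. by split; [exact: stopped_ge0|exact: stopped_le|exact: stopped_leT]. Qed.

Let du0 n k : 0 <= du n k. Proof. by rewrite subr_ge0; have [] := ui n k. Qed.

Let mdB n k : measurable_fun setT (dB n k).
Proof. by apply: measurable_funB. Qed.

Let law n k : has_law_N0 P (dB n k) (du n k).
Proof. by have [_ h _ _] := hB; have [h1 h2 h3] := ui n k; exact: h. Qed.

Let dB2 n k w := (dB n k w) ^+ 2.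
Let dB20 n k w : 0 <= dB2 n k w. Proof. exact: sqr_ge0. Qed.
Let mdB2 n k : measurable_fun setT (dB2 n k).
Proof. by apply: measurable_funX; exact: mdB. Qed.

Lemma wiener_incr_indep n k l (A A' : set R) : (k < 2 ^ n)%N -> (l < 2 ^ n)%N -> k != l ->
  measurable A -> measurable A' ->
  P (dB n k @^-1` A `&` dB n l @^-1` A') = (P (dB n k @^-1` A) * P (dB n l @^-1` A'))%E.
Proof.
move=> kn ln kl mA mA'; have [_ _ h _] := hB.
pose E i := if i == k then A else if i == l then A' else setT.
have mE i : (i < 2 ^ n)%N -> measurable (E i).
  by move=> _; rewrite /E; case: ifP => // _; case: ifP.
have u00 : 0 <= u n 0 by exact: stopped_ge0.
have uT : u n (2 ^ n) <= T by exact: stopped_leT.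
have um i : (i < 2 ^ n)%N -> u n i <= u n i.+1 by move=> _; exact: stopped_le.
have := h (2 ^ n)%N (u n) E u00 uT um mE.
have -> : [set w | forall i, (i < 2 ^ n)%N -> E i (B (u n i.+1) w - B (u n i) w)] =
    dB n k @^-1` A `&` dB n l @^-1` A'.
  apply/seteqP; split=> [w /= hw|w /= [hk hl] i _].
    have := hw k kn; have := hw l ln; rewrite /E eqxx eq_sym (negbTE kl) eqxx => ? ?; by split.
  by rewrite /E; case: eqP => [->//|_]; case: eqP => [->//|].
move=> ->; rewrite (bigD1 (Ordinal kn))//= (bigD1 (Ordinal ln))/=; last first.
  by rewrite -val_eqE/= eq_sym.
rewrite big1 ?mule1.
  by rewrite {1 2}/E eqxx eq_sym (negbTE kl) eqxx.
move=> i /andP[ik il]; rewrite -(@probability_setT _ _ _ P); congr (P _).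
apply/seteqP; split => // w _ /=.
by rewrite /E; move: ik il; rewrite -!val_eqE/= => /negbTE -> /negbTE ->.
Qed.

Lemma integral_dB2 n k : (\int[P]_w (dB2 n k w)%:E = (du n k)%:E)%E.
Proof. exact: law_second_moment (mdB n k) (du0 n k) (law n k). Qed.

Lemma integral_dB2_mul n k l : (k < 2 ^ n)%N -> (l < 2 ^ n)%N ->
  (\int[P]_w (dB2 n k w * dB2 n l w)%:E <=
    (du n k * du n l + (k == l)%:R * (gauss_cst 2 * du n k ^+ 2))%:E)%E.
Proof.
move=> kn ln; have [<-|kl] := eqVneq k l.
  have := law_moment_le (mdB n k) (du0 n k) (law n k) 2.
  under eq_integral do rewrite /= (exprD _ 2 2).
  move=> /le_trans; apply; rewrite lee_fin mul1r lerDr.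
  by rewrite mulr_ge0.
rewrite mul0r addr0 EFinM -!integral_dB2.
under eq_integral do rewrite EFinM.
have := @ge0_integral_indep_mul _ _ _ P (mfun_Sub (mem_set (mdB n k)))
   (mfun_Sub (mem_set (mdB n l))) (fun x => (x ^+ 2)%:E) (fun x => (x ^+ 2)%:E).
move=> /= ->//.
- by move=> A A' mA mA'; exact: wiener_incr_indep.
- by apply/measurable_EFinP; apply: measurable_funX.
- by apply/measurable_EFinP; apply: measurable_funX.
- by move=> x; rewrite lee_fin sqr_ge0.
- by move=> x; rewrite lee_fin sqr_ge0.
Qed.

(** The squared increments are pairwise uncorrelated, so that only the diagonal
    terms contribute to the variance of their sum. *)
Lemma qv_variance n J : (J <= 2 ^ n)%N ->
  (\int[P]_w ((\sum_(0 <= k < J) dB2 n k w - u n J) ^+ 2)%:E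
    <= (gauss_cst 2 * T ^+ 2 * 2^-1 ^+ n)%:E)%E.
Proof.
move=> Jn.
pose S w := \sum_(0 <= k < J) dB2 n k w.
have mS : measurable_fun setT S by apply: measurable_sum => k; exact: mdB2.
have S0 w : 0 <= S w by apply: sumr_ge0.
have uJ : u n J = \sum_(0 <= k < J) du n k.
  by rewrite telescope_sumr// stopped0// subr0.
have ES : (\int[P]_w (S w)%:E = (u n J)%:E)%E.
  under eq_integral do rewrite -sumEFin.
  rewrite ge0_integral_sum//; last first.
    by move=> k w _; rewrite lee_fin.
    by move=> k; apply/measurable_EFinP; exact: mdB2.
  by rewrite uJ -sumEFin; apply: eq_bigr => k _; exact: integral_dB2.
pose c := \sum_(0 <= k < J) gauss_cst 2 * du n k ^+ 2.
have ES2 : (\int[P]_w (S w ^+ 2)%:E <= (u n J ^+ 2 + c)%:E)%E.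
  have -> : (fun w => (S w ^+ 2)%:E) = (fun w => \sum_(0 <= k < J) \sum_(0 <= l < J) (dB2 n k w * dB2 n l w)%:E)%E.
    apply/funext => w; rewrite expr2 /S mulr_suml -sumEFin; apply: eq_bigr => k _.
    by rewrite mulr_sumr -sumEFin.
  rewrite ge0_integral_sum//; last first.
    by move=> k w _; apply: sume_ge0 => l _; rewrite lee_fin mulr_ge0.
    move=> k; apply: emeasurable_sum => l; apply/measurable_EFinP.
    by apply: measurable_funM; exact: mdB2.
  have -> : u n J ^+ 2 + c = \sum_(0 <= k < J) \sum_(0 <= l < J)
      (du n k * du n l + (k == l)%:R * (gauss_cst 2 * du n k ^+ 2)).
    rewrite expr2 uJ mulr_suml /c -big_split/= big_nat [RHS]big_nat.
    apply: eq_bigr => k /andP[_ kJ].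
    rewrite [RHS]big_split/= mulr_sumr; congr (_ + _).
    rewrite (bigD1_seq k)/= ?mem_index_iota ?iota_uniq// eqxx mul1r big1 ?addr0// => l lk.
    by rewrite eq_sym (negbTE lk) mul0r.
  rewrite -sumEFin big_nat [leRHS]big_nat; apply: lee_sum => k /andP[_ kJ].
  rewrite ge0_integral_sum//; last first.
    by move=> l w _; rewrite lee_fin mulr_ge0.
    by move=> l; apply/measurable_EFinP/measurable_funM; exact: mdB2.
  rewrite -sumEFin big_nat [leRHS]big_nat; apply: lee_sum => l /andP[_ lJ].
  by apply: integral_dB2_mul; [exact: leq_trans Jn|exact: leq_trans Jn].
have u0 : 0 <= u n J by exact: stopped_ge0.
have EQ : (\int[P]_w ((S w - u n J) ^+ 2)%:E + (2 * u n J ^+ 2)%:E =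
           \int[P]_w (S w ^+ 2)%:E + (u n J ^+ 2)%:E)%E.
  have k1 : ((2 * u n J ^+ 2)%:E = \int[P]_w (2 * u n J * S w)%:E)%E.
    under eq_integral do rewrite EFinM.
    rewrite ge0_integralZl//; last 3 first.
    + exact/measurable_EFinP.
    + by move=> w _; rewrite lee_fin.
    + by rewrite lee_fin mulr_ge0.
    by rewrite ES -EFinM; congr EFin; ring.
  have k2 : ((u n J ^+ 2)%:E = \int[P]_w (u n J ^+ 2)%:E)%E.
    by rewrite integral_cst//= probability_setT mule1.
  rewrite k1 [in RHS]k2 -!ge0_integralD//; last first.
  - apply/measurable_EFinP; apply: measurable_funM => //.
  - by move=> w _; rewrite lee_fin !mulr_ge0.
  - by apply/measurable_EFinP; apply: measurable_funX; exact: measurable_funB.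
  - by move=> w _; rewrite lee_fin sqr_ge0.
  - by move=> w _; rewrite lee_fin sqr_ge0.
  - by apply/measurable_EFinP; apply: measurable_funX.
  - by move=> w _; rewrite lee_fin sqr_ge0.
  by apply: eq_integral => w _; rewrite -!EFinD; congr EFin; ring.
have cle : c <= gauss_cst 2 * T ^+ 2 * 2^-1 ^+ n.
  rewrite /c; have := @gauss_cst_ge0 R 2; move: (gauss_cst 2) => c2 c20.
  apply: (@le_trans _ _ (\sum_(0 <= k < J) c2 * (T / 2 ^+ n * du n k))).
    apply: ler_sum => k _; rewrite ler_wpM2l// expr2 ler_wpM2r//.
    exact: stopped_step.
  rewrite -!mulr_sumr -uJ -!mulrA ler_wpM2l//.
  rewrite exprVn ler_wpM2l ?(ltW T0)// mulrC.
  by rewrite ler_wpM2r ?invr_ge0 ?exprn_ge0//; exact: stopped_leT.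
have h1 : (\int[P]_w ((S w - u n J) ^+ 2)%:E + (2 * u n J ^+ 2)%:E <=
    (u n J ^+ 2 + c)%:E + (u n J ^+ 2)%:E)%E by rewrite EQ leeD2r.
apply: (@le_trans _ _ c%:E); last by rewrite lee_fin.
move: h1; case: (integral _ _ _) => [x| |] h1.
- by move: h1; rewrite -!EFinD !lee_fin; lra.
- by move: h1; rewrite -EFinD addye.
- exact: leNye.
Qed.

(** The variances decrease geometrically with the level, so that the errors at
    the points of a coarser grid tend to 0 almost surely. *)
Lemma qv_ae_cvg : {ae P, forall w, forall m j, (j <= 2 ^ m)%N ->
  \sum_(0 <= k < j * 2 ^ n) grid_incr T t (B ^~ w) (m + n) k ^+ 2 @[n --> \oo] --> u m j}.
Proof.
have H m j : (j <= 2 ^ m)%N -> {ae P, forall w,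
   \sum_(0 <= k < j * 2 ^ n) dB2 (m + n) k w @[n --> \oo] --> u m j}.
  move=> jm.
  pose F n w := (\sum_(0 <= k < j * 2 ^ n) dB2 (m + n) k w - u m j) ^+ 2.
  have mF n : measurable_fun setT (F n).
    apply: measurable_funX; apply: measurable_funB => //.
    by apply: measurable_sum => k; exact: mdB2.
  have F0 n w : 0 <= F n w by exact: sqr_ge0.
  have hF n : (\int[P]_w (F n w)%:E <= (gauss_cst 2 * T ^+ 2 * 2^-1 ^+ n)%:E)%E.
    have jn : (j * 2 ^ n <= 2 ^ (m + n))%N by rewrite expnD leq_mul2r jm orbT.
    have := qv_variance jn.
    have -> : u (m + n) (j * 2 ^ n) = u m j by rewrite /stopped dyadic_refine.
    move=> /le_trans; apply; rewrite lee_fin ler_wpM2l//.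
      by rewrite mulr_ge0 ?gauss_cst_ge0 ?sqr_ge0.
    by rewrite ler_wiXn2l ?invr_ge0 ?leq_addl// invf_le1// ler1n.
  have a0 : 0 <= gauss_cst 2 * T ^+ 2 :> R by rewrite mulr_ge0 ?gauss_cst_ge0 ?sqr_ge0.
  have i0 : 0 <= 2^-1 :> R by rewrite invr_ge0.
  have i1 : 2^-1 < 1 :> R by rewrite invf_lt1// ltr1n.
  have [S [_ _ _ _ h]] := geometric_integral_sum mF F0 a0 i0 i1 hF.
  apply: filterS h => w h.
  apply/cvgrPdist_lt => e e0; move/cvgrPdist_lt : h => /(_ (e ^+ 2)).
  rewrite exprn_gt0// => /(_ isT); apply: filterS => n.
  rewrite sub0r normrN ger0_norm// /F distrC -real_normK ?num_real// ltr_pXn2r// nnegrE//.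
  exact: ltW.
have H2 m : {ae P, forall w, forall j, (j <= 2 ^ m)%N ->
   \sum_(0 <= k < j * 2 ^ n) dB2 (m + n) k w @[n --> \oo] --> u m j}.
  apply/ae_foralln => j; have [jm|jm] := leqP j (2 ^ m).
    by apply: filterS (H m j jm) => w hw _.
  by apply/aeW.
by apply/ae_foralln => m; exact: H2.
Qed.

(** The bound does not depend on n: by the inequality between power means the
    8th power of the sum costs a factor 2^(7n), and each of the 2^n increments
    has a 16th moment of order 2^(-8n). *)
Lemma qv_moment8 n : (\int[P]_w ((\sum_(0 <= k < 2 ^ n) dB2 n k w) ^+ 8)%:E
    <= (gauss_cst 8 * T ^+ 8)%:E)%E.
Proof.
have pm8 w : (\sum_(0 <= k < 2 ^ n) dB2 n k w) ^+ 8 <=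
    (2 ^ n)%:R ^+ 7 * \sum_(0 <= k < 2 ^ n) dB n k w ^+ (2 * 8).
  set N := (2 ^ n)%N.
  have h1 := le_power_mean2 N (fun k => dB2 n k w).
  have h2 := le_power_mean2 N (fun k => dB2 n k w ^+ 2).
  have h3 := le_power_mean2 N (fun k => (dB2 n k w ^+ 2) ^+ 2).
  have -> : \sum_(0 <= k < N) dB n k w ^+ (2 * 8) =
     \sum_(0 <= k < N) ((dB2 n k w ^+ 2) ^+ 2) ^+ 2.
    by apply: eq_bigr => k _; rewrite /dB2 -!exprM.
  move: h1 h2 h3.
  set a := \sum_(0 <= k < N) _; set b := \sum_(0 <= k < N) _ ^+ 2.
  set c := \sum_(0 <= k < N) _ ^+ 2; set e := \sum_(0 <= k < N) _ ^+ 2 => h1 h2 h3.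
  have N0 : 0 <= N%:R :> R by [].
  have b0 : 0 <= b by apply: sumr_ge0 => k _; exact: sqr_ge0.
  have c0 : 0 <= c by apply: sumr_ge0 => k _; exact: sqr_ge0.
  have k1 : (a ^+ 2) ^+ 2 <= (N%:R * b) ^+ 2 by rewrite ler_sqr ?nnegrE ?sqr_ge0 ?mulr_ge0.
  have k2 : (N%:R * b) ^+ 2 <= N%:R ^+ 2 * (N%:R * c).
    by rewrite exprMn ler_wpM2l// exprn_ge0.
  have k3 : ((a ^+ 2) ^+ 2) ^+ 2 <= (N%:R ^+ 2 * (N%:R * c)) ^+ 2.
    rewrite ler_sqr ?nnegrE ?sqr_ge0//; last by rewrite !mulr_ge0.
    exact: le_trans k2.
  rewrite (_ : a ^+ 8 = ((a ^+ 2) ^+ 2) ^+ 2); last by rewrite -!exprM.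
  apply: le_trans k3 _.
  move: (N%:R : R) N0 h3 => r r0 h3.
  have -> : (r ^+ 2 * (r * c)) ^+ 2 = r ^+ 6 * c ^+ 2 by ring.
  have -> : r ^+ 7 * e = r ^+ 6 * (r * e) by ring.
  by rewrite ler_wpM2l// exprn_ge0.
have m16 k : measurable_fun setT (fun w => dB n k w ^+ (2 * 8)).
  by apply: measurable_funX; exact: mdB.
have p16 (x : R) : 0 <= x ^+ (2 * 8) by rewrite exprM exprn_ge0// sqr_ge0.
apply: (@le_trans _ _ (\int[P]_w ((2 ^ n)%:R ^+ 7 * \sum_(0 <= k < 2 ^ n) dB n k w ^+ (2 * 8))%:E)%E).
  apply: ge0_le_integral => //.
  - by move=> w _; rewrite lee_fin exprn_ge0// sumr_ge0.
  - by apply/measurable_EFinP/measurable_funX/measurable_sum => k; exact: mdB2.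
  - by apply/measurable_EFinP/measurable_funM => //; apply: measurable_sum.
  - by move=> w _; rewrite lee_fin.
under eq_integral do rewrite EFinM.
rewrite ge0_integralZl//; last 2 first.
- by apply/measurable_EFinP; apply: measurable_sum.
- by move=> w _; rewrite lee_fin sumr_ge0.
under eq_integral do rewrite -sumEFin.
rewrite ge0_integral_sum//; last first.
  by move=> k w _; rewrite lee_fin.
  by move=> k; exact/measurable_EFinP.
have hk k : (\int[P]_w (dB n k w ^+ (2 * 8))%:E <= (gauss_cst 8 * (T / 2 ^+ n) ^+ 8)%:E)%E.
  apply: le_trans (law_moment_le (mdB n k) (du0 n k) (law n k) 8) _.
  rewrite lee_fin ler_wpM2l ?gauss_cst_ge0// lerXn2r ?nnegrE ?divr_ge0 ?exprn_ge0 ?(ltW T0)//.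
  exact: stopped_step.
apply: (@le_trans _ _ (((2 ^ n)%:R ^+ 7)%:E * \sum_(0 <= k < 2 ^ n) (gauss_cst 8 * (T / 2 ^+ n) ^+ 8)%:E)%E).
  rewrite lee_wpmul2l ?lee_fin ?exprn_ge0//; apply: lee_sum => k _; exact: hk.
rewrite sumEFin -EFinM lee_fin sumr_const_nat subn0 -[_ * _ *+ _]mulr_natl.
rewrite le_eqVlt; apply/orP; left; apply/eqP; rewrite !natrX.
have : 2 ^+ n != 0 :> R by rewrite expf_neq0.
by move: (2 ^+ n : R) (gauss_cst 8) => q c8 q0; field.
Qed.

End wiener_quadratic_variation.

(** * Adapted versions of the solution *)

Section euler_scheme.
Context {R : realType}.
Variables (T s L : R) (b : R -> R) (Y0 : R) (y z : R -> R).
Hypotheses (sT : 0 <= s <= T) (L0 : 0 <= L).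
Hypothesis bL : forall v v', `|b v' - b v| <= L * `|v' - v|.
Hypotheses (yc : unif_cont T y) (bi : intble T (b \o y)).
Hypothesis yE : forall t, 0 <= t <= T -> y t = Y0 + prim (b \o y) t + z t.

Fixpoint euler (x : R) (n k : nat) : R :=
  if k is k'.+1 then
    euler x n k' + b (euler x n k') * (s / n.+1%:R)
    + (z (k'.+1%:R * s / n.+1%:R) - z (k'%:R * s / n.+1%:R))
  else x.

(** A discrete Gronwall argument: after k steps of length h the error is at most
    the oscillation of y over one step times (1 + L h)^k - 1. *)
Lemma euler_cvg : euler (Y0 + z 0) n n.+1 @[n --> \oo] --> y s.
Proof.
have /andP[s0 sT'] := sT; have T0 : 0 <= T by exact: le_trans sT'.
pose g k n : R := k%:R * s / n.+1%:R.
have gE k n : g k.+1 n = g k n + s / n.+1%:R by rewrite /g -natr1; ring.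
have g0 k n : 0 <= g k n by rewrite /g divr_ge0// mulr_ge0.
have gs k n : (k <= n.+1)%N -> g k n <= s.
  by move=> kn; rewrite /g ler_pdivrMr// mulrC ler_wpM2l// ler_nat.
have key n eta : 0 <= eta -> (forall u u', 0 <= u <= T -> 0 <= u' <= T ->
      `|u' - u| <= s / n.+1%:R -> `|y u' - y u| <= eta) ->
    forall k, (k <= n.+1)%N ->
    `|y (g k n) - euler (Y0 + z 0) n k| <= eta * ((1 + L * (s / n.+1%:R)) ^+ k - 1).
  move=> eta0 osc; set h := s / n.+1%:R; have h0 : 0 <= h by rewrite divr_ge0.
  have q0 : 0 <= 1 + L * h by rewrite addr_ge0// mulr_ge0.
  elim=> [_|k IH kn].
    by rewrite /g mul0r mul0r yE ?lexx// prim0 addr0 /= subrr normr0 expr0 subrr mulr0.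
  have {}IH := IH (ltnW kn).
  have k1 : 0 <= g k n <= T by rewrite g0 (le_trans (gs _ _ (ltnW kn))).
  have k2 : 0 <= g k.+1 n <= T by rewrite g0 (le_trans (gs _ _ kn)).
  have k3 : g k n <= g k.+1 n by rewrite gE lerDl.
  have /andP[_ k2T] := k2.
  set e := euler (Y0 + z 0) n k in IH *.
  have bnd : `|prim (b \o y) (g k.+1 n) - prim (b \o y) (g k n) - b e * h| <=
      L * (eta + `|y (g k n) - e|) * h.
    have i1 : intble T (fun v => b (y v) - b e) by apply: intbleB => //; exact: intble_cst.
    have e1 v : 0 <= v <= T -> prim (fun v => b (y v) - b e) v = prim (b \o y) v - b e * v.
      by move=> /andP[v0 vT]; rewrite (primB bi (intble_cst T (b e)))// prim_cst.
    have -> : prim (b \o y) (g k.+1 n) - prim (b \o y) (g k n) - b e * h =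
       prim (fun v => b (y v) - b e) (g k.+1 n) - prim (fun v => b (y v) - b e) (g k n).
      by rewrite !e1// gE -/h; ring.
    apply: le_trans (norm_prim_incr_le i1 (g0 _ _) k3 k2T) _.
    have -> : L * (eta + `|y (g k n) - e|) * h =
       prim (fun=> L * (eta + `|y (g k n) - e|)) (g k.+1 n) -
       prim (fun=> L * (eta + `|y (g k n) - e|)) (g k n).
      by rewrite !prim_cst// gE -/h; ring.
    apply: (le_prim_incr (intble_norm i1) (intble_cst _ _)) => // v v1 v2.
    apply: le_trans (bL _ _) _; rewrite ler_wpM2l//.
    rewrite -(subrKA (y (g k n))); apply: le_trans (ler_normD _ _) _; rewrite lerD2r.
    apply: osc => //; first by rewrite (le_trans (g0 k n) (ltW v1)) (le_trans v2).
    by rewrite ger0_norm ?subr_ge0 ?(ltW v1)// lerBlDl -gE.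
  have -> : y (g k.+1 n) - euler (Y0 + z 0) n k.+1 = (y (g k n) - e) +
     (prim (b \o y) (g k.+1 n) - prim (b \o y) (g k n) - b e * h).
    by rewrite /= -/e -/h -/(g k.+1 n) -/(g k n) !yE//; ring.
  apply: le_trans (ler_normD _ _) _; apply: le_trans (lerD (lexx _) bnd) _.
  rewrite exprS; move: IH; set Q := (_ ^+ k); set D := `|_| => IH.
  have Lh : 0 <= L * h by rewrite mulr_ge0.
  have h1 := ler_wpM2l Lh IH.
  have -> : eta * ((1 + L * h) * Q - 1) = eta * (Q - 1) + L * h * (eta * (Q - 1)) + L * h * eta.
    by ring.
  have -> : L * (eta + D) * h = L * h * D + L * h * eta by ring.
  by rewrite addrA lerD2r lerD.
apply/cvgrPdist_lt => e e0.
pose E := expR (L * s); have E0 : 0 < E by exact: expR_gt0.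
have [d d0 hd] := yc (divr_gt0 e0 (mulr_gt0 E0 (ltr0n _ 2))).
have c1 : s / n.+1%:R @[n --> \oo] --> (0 : R).
  by rewrite -[X in _ --> X](mulr0 s); apply: cvgMr; exact: cvg_harmonic.
move/cvgrPdist_lt : c1 => /(_ d d0); apply: filterS => n.
rewrite sub0r normrN ger0_norm ?divr_ge0// => hn.
have osc u u' : 0 <= u <= T -> 0 <= u' <= T -> `|u' - u| <= s / n.+1%:R ->
    `|y u' - y u| <= e / (E * 2).
  by move=> uT u'T h; apply/ltW/hd => //; exact: le_lt_trans h hn.
have eta0 : 0 <= e / (E * 2) by rewrite divr_ge0// ltW// mulr_gt0.
have := key n _ eta0 osc n.+1 (leqnn _).
have -> : g n.+1 n = s by rewrite /g mulrAC divff ?mul1r.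
move=> /le_lt_trans; apply.
have hE : (1 + L * (s / n.+1%:R)) ^+ n.+1 <= E.
  apply: (@le_trans _ _ (expR (L * (s / n.+1%:R)) ^+ n.+1)).
    by rewrite lerXn2r ?nnegrE ?expR_ge0 ?expR_ge1Dx// addr_ge0// mulr_ge0// divr_ge0.
  by rewrite -expRM_natr /E mulrA mulfVK.
apply: (@le_lt_trans _ _ (e / (E * 2) * E)).
  by rewrite ler_wpM2l//; apply: le_trans hE; rewrite gerBl.
by rewrite invfM mulrA mulrAC divfK ?gt_eqF// ltr_pdivrMr// ltr_pMr// ltr1n.
Qed.

End euler_scheme.

(** Integrability is part of the notion, since the integral of a function that is
    not integrable has a junk value. *)
Definition sol_path {R : realType} (T : R) (b : R -> R) (Y0 : R) (y z : R -> R) :=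
  [/\ unif_cont T z, intble T (b \o y), (forall t, 0 <= t <= T -> 0 < y t) &
      forall t, 0 <= t <= T -> y t = Y0 + prim (b \o y) t + z t].

Section adapted_version.
Context {R : realType} d (Om : measurableType d) (P : probability Om R).
Variables (T s kappa theta c q Y0 nu1 nu2 : R) (B BH Y : R -> Om -> R).
Hypotheses (T0 : 0 < T) (sT : 0 <= s <= T) (k0 : 0 < kappa) (th0 : 0 < theta)
  (c0 : 0 < c) (q1 : 1 < q).
Local Notation b := (rdrift kappa theta c q).
Local Notation z w := (fun t => nu1 * B t w + nu2 * BH t w).
Hypothesis hY : {ae P, forall w, sol_path T b Y0 (Y ^~ w) (z w)}.

Let bt (N : nat) (v : R) := b (Num.max v N.+1%:R^-1).

Lemma truncated_drift_lip N : exists2 L, 0 <= L &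
  forall v v', `|bt N v' - bt N v| <= L * `|v' - v|.
Proof.
have e0 : (0 : R) < N.+1%:R^-1 by rewrite invr_gt0.
have [L L0 hL] := rdrift_lip k0 th0 c0 q1 e0.
exists L => // v v'; apply: le_trans (hL _ _ _ _) _; rewrite ?le_max ?lexx ?orbT//.
rewrite ler_wpM2l//; move: (N.+1%:R^-1) => e.
wlog h : v v' / v <= v' => [H|].
  have [|/ltW] := leP v v'; first exact: H.
  by move=> /H; rewrite distrC [X in _ <= X]distrC.
rewrite (ger0_norm (_ : 0 <= v' - v)) ?subr_ge0//.
rewrite ger0_norm; last by rewrite subr_ge0 ge_max !le_max h lexx orbT.
by case: (lerP v e); case: (lerP v' e); lra.
Qed.

Local Notation F := (g_sigma_algebraType (history B s `|` history BH s)).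

Let mproc (X : R -> Om -> R) t : (forall A, history X s A ->
   (history B s `|` history BH s) A) -> 0 <= t <= s -> measurable_fun [set: F] (X t : F -> R).
Proof.
move=> sub ts _ E mE; rewrite setTI; apply: sub_sigma_algebra; apply: sub.
exists t; first by rewrite /= in_itv.
by exists E => //; rewrite setTI.
Qed.

Let mz t : 0 <= t <= s -> measurable_fun [set: F] (fun w : F => z w t).
Proof.
move=> ts; apply: measurable_funD; apply: measurable_funM => //.
  by apply: mproc => // A; left.
by apply: mproc => // A; right.
Qed.

Let mbt N : measurable_fun [set: R] (bt N).
Proof.
have [L L0 hL] := truncated_drift_lip N.
apply: continuous_measurable_fun => v; apply/cvgrPdist_lt => e e0.
have L1 : 0 < L + 1 by rewrite ltr_wpDl.
have eL : 0 < e / (L + 1) by rewrite divr_gt0.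
near=> v'; apply: le_lt_trans (hL _ _) _.
apply: (@le_lt_trans _ _ ((L + 1) * `|v - v'|)).
  by rewrite ler_wpM2r// lerDl.
by rewrite mulrC -ltr_pdivlMr.
Unshelve. all: by end_near. Qed.

Let Eul N n k w := euler s (bt N) (z w) (Y0 + z w 0) n k.

Let mEul N n k : (k <= n.+1)%N -> measurable_fun [set: F] (fun w : F => Eul N n k w).
Proof.
have s0 : 0 <= s by case/andP : sT.
have ok j : (j <= n.+1)%N -> 0 <= j%:R * s / n.+1%:R <= s.
  move=> jn; rewrite divr_ge0 ?mulr_ge0//= ler_pdivrMr// mulrC.
  by rewrite ler_wpM2l// ler_nat.
elim: k => [_|k IH kn] /=.
  by apply: measurable_funD => //; apply: mz; rewrite lexx.
apply: measurable_funD; last by apply: measurable_funB; apply: mz; apply: ok => //; exact: ltnW.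
apply: measurable_funD; first exact: IH (ltnW kn).
apply: measurable_funM => //.
by apply: (measurableT_comp (mbt N)); exact: IH (ltnW kn).
Qed.

(** Away from 0 the drift is Lipschitz, and the Euler scheme with a truncated
    drift, which only uses the noise up to time s, converges to the solution as
    soon as the truncation level is below the minimum of the path.  So the
    solution at time s has a version measurable with respect to the history of
    the noise up to time s, without null sets being added to it. *)
Lemma adapted_version : exists Ys : Om -> R,
  (forall E : set R, measurable E -> joint_filtration B BH s (Ys @^-1` E)) /\
  {ae P, forall w, Y s w = Ys w}.
Proof.
pose I N w := fine (limn_esup (fun n => (Eul N n n.+1 w)%:E)).
pose Ys w := fine (limn_esup (fun N => (I N w)%:E)).
exists Ys; split.
  have mI N : measurable_fun [set: F] (I N : F -> R).
    apply: measurableT_comp => //; apply: measurable_fun_limn_esup => n.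
    by apply/measurable_EFinP; exact: mEul.
  have mY : measurable_fun [set: F] (Ys : F -> R).
    apply: measurableT_comp => //; apply: measurable_fun_limn_esup => N.
    by apply/measurable_EFinP; exact: mI.
  by move=> E mE; have := mY measurableT _ mE; rewrite setTI.
apply: filterS hY => w [zc bi ypos yE].
have lime (u : nat -> R) l : u @ \oo --> l -> fine (limn_esup (fun n => (u n)%:E)) = l.
  move=> ul; have /cvg_limn_einf_sup[_ ->//] : (u n)%:E @[n --> \oo] --> l%:E.
  by apply: cvg_EFin => //; apply: nearW.
have yc := sol_cont T0 zc bi yE.
have [x xT hx] := EVT_min (ltW T0) (unif_cont_within yc).
have yx : 0 < Y x w by apply: ypos; move: xT; rewrite in_itv.
apply/esym; apply: (lime (fun N => I N w)); apply: cvg_near_cst.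
(* Beyond this level the truncation does not see the path. *)
exists (Num.truncn (Y x w)^-1) => // N /= hN.
have yN t : 0 <= t <= T -> Num.max (Y t w) N.+1%:R^-1 = Y t w.
  move=> tT; apply/max_idPl; apply: le_trans (hx t _); last by rewrite in_itv.
  rewrite -[leRHS]invrK lef_pV2 ?posrE ?invr_gt0//.
  by apply/ltW/(lt_le_trans (truncnS_gt _)); rewrite ler_nat.
have [L L0 hL] := truncated_drift_lip N.
apply: lime; apply: (@euler_cvg _ T s L (bt N) Y0 (Y ^~ w) (z w)) => //.
- apply: eq_intble bi => t t0 tT; rewrite /= /bt yN//; exact/andP.
- move=> t tT; rewrite yE//; congr (_ + _ + _); apply: eq_prim => v v0 vt.
  by rewrite /= /bt yN// v0 (le_trans vt)//; case/andP : tT.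
Qed.

End adapted_version.

(** * Paths driven by Hölder noise *)

Section path_estimates.
Context {R : realType}.
Variables (T kappa theta c p nu1 nu2 Y0 a b : R).
Hypotheses (T0 : 0 < T) (k0 : 0 < kappa) (th0 : 0 < theta) (c0 : 0 < c) (p2 : 2 < p)
  (nu10 : 0 < nu1) (nu20 : 0 < nu2) (a0 : 0 < a) (ab : a < b) (b1 : b < 1) (ab1 : 1 < a + b)
  (b12 : 1 < 2 * b).
Local Notation q := (p - 1).
Local Notation bd := (rdrift kappa theta c q).

Definition holder_on (ga K : R) (x : R -> R) :=
  forall s t, 0 <= s -> s <= t -> t <= T -> `|x t - x s| <= K * (t - s) `^ ga.

(** A solution driven by x and g, all of whose characteristics that matter for
    the integrals are bounded by the same number X: in this way all moment
    estimates concern the powers of a single random variable. *)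
Record tame_path (X : R) (x g y : R -> R) : Prop := TamePath {
  tame_ge1 : 1 <= X;
  tame_holderx : holder_on a X x;
  tame_holderg : holder_on b X g;
  tame_x : forall t, 0 <= t <= T -> `|x t| <= X;
  tame_sol : sol_path T bd Y0 y (fun t => nu1 * x t + nu2 * g t);
  tame_le : forall t, 0 <= t <= T -> y t <= X;
  tame_var : sol_var kappa theta c q y T <= X }.

Let b0 : 0 < b. Proof. exact: lt_trans ab. Qed.
Let q1 : 1 < q. Proof. by rewrite ltrBrDr (_ : 1 + 1 = 2). Qed.

Lemma holder_unif_cont ga K x : 0 < ga -> 0 <= K -> holder_on ga K x -> unif_cont T x.
Proof.
move=> ga0 K0 hx e e0; have K1 : 0 < K + 1 by rewrite ltr_wpDl.
pose d := (e / (K + 1)) `^ ga^-1.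
have eK : 0 < e / (K + 1) by rewrite divr_gt0.
have d0 : 0 < d by rewrite powR_gt0.
exists d => //.
have key s t : 0 <= s <= T -> 0 <= t <= T -> s <= t -> t - s < d -> `|x t - x s| < e.
  move=> /andP[s0 _] /andP[_ tT] st h; apply: le_lt_trans (hx _ _ s0 st tT) _.
  apply: (@le_lt_trans _ _ ((K + 1) * (t - s) `^ ga)).
    by rewrite ler_wpM2r ?powR_ge0// lerDl.
  rewrite mulrC -ltr_pdivlMr//.
  have <- : d `^ ga = e / (K + 1) by rewrite /d -powRrM mulVf ?gt_eqF// powRr1// ltW.
  by apply: (gt0_ltr_powR ga0) => //; rewrite nnegrE ?subr_ge0// ltW.
move=> s t sT tT; have [st|/ltW ts] := leP s t.
  by rewrite ger0_norm ?subr_ge0//; exact: key.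
by rewrite distrC ger0_norm ?subr_ge0// distrC; exact: key.
Qed.

(** The bounds on solutions are linear in the Hölder constant of the noise. *)
Lemma tame_path_exists : exists2 C, 1 <= C & forall Ga x g y,
  1 <= Ga -> holder_on a Ga x -> holder_on b Ga g -> x 0 = 0 -> g 0 = 0 ->
  sol_path T bd Y0 y (fun t => nu1 * x t + nu2 * g t) -> tame_path (C * Ga) x g y.
Proof.
have [K K0 hK] := rdrift_ge theta k0 c0 q1.
pose Z := nu1 * T `^ a + nu2 * T `^ b.
have Z0 : 0 <= Z by rewrite addr_ge0// mulr_ge0 ?powR_ge0// ltW.
pose Cy := Num.max 1 Y0 + kappa * T + 2 * Z.
have Cy0 : 0 <= Cy.
  rewrite !addr_ge0 ?mulr_ge0 ?(ltW k0) ?(ltW T0)//.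
  by rewrite le_max ler01.
pose Cv := Cy + `|Y0| + Z + 2 * (K + theta * Cy) * T.
have Cv0 : 0 <= Cv.
  have h1 : 0 <= K + theta * Cy by apply: addr_ge0 => //; apply: mulr_ge0 => //; exact: ltW.
  have h2 : 0 <= 2 * (K + theta * Cy) * T.
    by apply: mulr_ge0; [exact: mulr_ge0|exact: ltW].
  by do 3 (apply: addr_ge0 => //).
pose C := 1 + T `^ a + Cy + Cv.
have Ta0 : 0 <= T `^ a by exact: powR_ge0.
exists C => [|Ga x g y Ga1 hx hg x00 g00 sp]; first by rewrite /C; lra.
have Ga0 : 0 <= Ga by apply: le_trans Ga1.
have C1 : 1 <= C by rewrite /C; lra.
have GC : Ga <= C * Ga by rewrite ler_peMl.
have hol0 ga u : 0 < ga -> holder_on ga Ga u -> u 0 = 0 ->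
    forall t, 0 <= t <= T -> `|u t| <= Ga * T `^ ga.
  move=> ga0 hu u0 t /andP[t0 tT]; have := hu _ _ (lexx 0) t0 tT.
  rewrite u0 !subr0 => /le_trans; apply; rewrite ler_wpM2l//.
  by rewrite ge0_ler_powR ?nnegrE ?(ltW ga0) ?(ltW T0).
have [zc bi ypos yE] := sp.
have zb t : 0 <= t <= T -> `|nu1 * x t + nu2 * g t| <= Z * Ga.
  move=> tT; apply: le_trans (ler_normD _ _) _; rewrite !normrM (gtr0_norm nu10) (gtr0_norm nu20).
  have h1 := ler_wpM2l (ltW nu10) (hol0 _ _ a0 hx x00 t tT).
  have h2 := ler_wpM2l (ltW nu20) (hol0 _ _ b0 hg g00 t tT).
  by rewrite /Z mulrDl -!mulrA ![_ `^ _ * Ga]mulrC lerD.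
have ZG : 0 <= Z * Ga by rewrite mulr_ge0.
have m1 : 0 <= Num.max 1 Y0 by rewrite le_max ler01.
have yb t : 0 <= t <= T -> y t <= Cy * Ga.
  move=> tT; apply: le_trans (sol_ub T0 k0 th0 c0 q1 ZG zc zb bi yE tT) _.
  have h1 := ler_wpM2l m1 Ga1.
  have h2 : kappa * T <= kappa * T * Ga by apply: ler_peMr => //; apply: mulr_ge0; exact: ltW.
  by rewrite /Cy; move: h1 h2; rewrite mulr1; lra.
split.
- exact: le_trans GC.
- move=> s t s0 st tT; apply: le_trans (hx s t s0 st tT) _.
  by rewrite ler_wpM2r ?powR_ge0.
- move=> s t s0 st tT; apply: le_trans (hg s t s0 st tT) _.
  by rewrite ler_wpM2r ?powR_ge0.
- move=> t tT; apply: le_trans (hol0 _ _ a0 hx x00 t tT) _.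
  by rewrite mulrC ler_wpM2r// /C; lra.
- exact: sp.
- move=> t tT; apply: le_trans (yb t tT) _; rewrite ler_wpM2r// /C; lra.
- have h := sol_var_le T0 th0 zb bi ypos yE K0 hK yb.
  apply: le_trans h _; apply: (@le_trans _ _ (Cv * Ga)); last first.
    by rewrite ler_wpM2r// /C; lra.
  have h1 : `|Y0| <= `|Y0| * Ga by rewrite ler_peMr.
  have h2 : 2 * (K + theta * (Cy * Ga)) * T <= 2 * (K + theta * Cy) * T * Ga.
    have h0 : 0 <= K * T * (Ga - 1).
      by apply: mulr_ge0; [apply: mulr_ge0 => //; exact: ltW|rewrite subr_ge0].
    by rewrite -subr_ge0 (_ : _ - _ = 2 * (K * T * (Ga - 1))); [rewrite mulr_ge0|ring].
  by rewrite /Cv; move: h1 h2; lra.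
Qed.

(** An integer above p, so that only moments of integer order are needed. *)
Definition tame_deg := (Num.truncn p).+1.
Local Notation N := tame_deg.
Let pN : p <= N%:R. Proof. by apply/ltW/truncnS_gt. Qed.

Lemma powR_le_exprn X r : 1 <= X -> r <= p -> X `^ r <= X ^+ N.
Proof.
move=> X1 rp; rewrite -powR_mulrn; last by apply: le_trans X1.
by apply: ler_powR => //; exact: le_trans rp pN.
Qed.

Section tame.
Variables (X : R) (x g y : R -> R) (tp : tame_path X x g y).
Local Notation phi := (fun s => y s `^ (p - 1)).
Local Notation V := (sol_var kappa theta c q y).

Let X1 : 1 <= X. Proof. by case: tp. Qed.
Let X0 : 0 <= X. Proof. exact: le_trans X1. Qed.
Let ypos t : 0 <= t <= T -> 0 < y t.
Proof. by case: (tame_sol tp) => _ _ h _ tT; exact: h. Qed.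

Lemma tame_phi_le t : 0 <= t <= T -> 0 <= y t `^ (p - 1) <= X ^+ N.
Proof.
move=> tT; rewrite powR_ge0/=; apply: (@le_trans _ _ (X `^ (p - 1))).
  rewrite ge0_ler_powR ?nnegrE//; [by rewrite subr_ge0; have := p2; lra|exact/ltW/ypos|exact: tame_le tp _ tT].
by apply: powR_le_exprn => //; have := p2; lra.
Qed.

Lemma tame_var_mono s t : 0 <= s -> s <= t -> t <= T -> V s <= V t.
Proof. by case: (tame_sol tp) => _ bi _ _ s0 st tT; apply: (sol_var_mono bi). Qed.

Definition phi_cst := (p - 1) * (1 + nu1 + nu2 * T `^ (b - a)).
Local Notation Cphi := phi_cst.
Let Cphi0 : 0 <= Cphi.
Proof.
apply: mulr_ge0; first by rewrite subr_ge0; have := p2; lra.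
by rewrite !addr_ge0 ?mulr_ge0 ?powR_ge0 ?(ltW nu10) ?(ltW nu20).
Qed.

(** The increment of y consists of a drift part, controlled by the monotone
    function V, and of a noise part, which is a-Hölder; the power p - 1 is
    Lipschitz below X. *)
Lemma tame_phi_reg s t : 0 <= s -> s <= t -> t <= T ->
  `|y t `^ (p - 1) - y s `^ (p - 1)| <=
    (Cphi * X ^+ N.+1) * (V t - V s + (t - s) `^ a).
Proof.
move=> s0 st tT; have sT : 0 <= s <= T by rewrite s0 (le_trans st).
have tT' : 0 <= t <= T by rewrite tT (le_trans s0).
have [zc bi _ yE] := tame_sol tp.
have p11 : 1 <= p - 1 by have := p2; lra.
apply: le_trans (powR_lip_le p11 (ypos sT) (tame_le tp sT) (ypos tT') (tame_le tp tT')) _.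
have hX : X `^ (p - 1 - 1) <= X ^+ N by apply: powR_le_exprn => //; have := p2; lra.
have hV := sol_drift_incr bi yE s0 st tT.
have hx := tame_holderx tp s0 st tT; have hg := tame_holderg tp s0 st tT.
have ts0 : 0 <= t - s by rewrite subr_ge0.
have hb : (t - s) `^ b <= T `^ (b - a) * (t - s) `^ a.
  have {1}-> : b = (b - a) + a by ring.
  rewrite powRD; last by rewrite subrK gt_eqF ?b0.
  rewrite ler_wpM2r ?powR_ge0// ge0_ler_powR ?nnegrE ?subr_ge0 ?(ltW ab) ?(ltW T0)//.
  by rewrite lerBlDr (le_trans tT)// lerDl.
set D := (t - s) `^ a in hx hb *; have D0 : 0 <= D by exact: powR_ge0.
have VV : 0 <= V t - V s by rewrite subr_ge0 tame_var_mono.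
have hy : `|y t - y s| <= (1 + nu1 + nu2 * T `^ (b - a)) * X * (V t - V s + D).
  rewrite [in leLHS](_ : y t - y s = (y t - y s - (nu1 * x t + nu2 * g t - (nu1 * x s + nu2 * g s)))
     + (nu1 * (x t - x s) + nu2 * (g t - g s))); last by ring.
  apply: le_trans (ler_normD _ _) _.
  apply: le_trans (lerD hV (ler_normD _ _)) _.
  rewrite !normrM (gtr0_norm nu10) (gtr0_norm nu20).
  have h1 := ler_wpM2l (ltW nu10) hx.
  have h2 := ler_wpM2l (ltW nu20) (le_trans hg (ler_wpM2l X0 hb)).
  apply: le_trans (lerD (lexx _) (lerD h1 h2)) _.
  have XD : V t - V s <= X * (V t - V s) by rewrite ler_peMl.
  have Tb : 0 <= T `^ (b - a) by exact: powR_ge0.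
  have e1 : 0 <= nu1 * X * (V t - V s) by rewrite !mulr_ge0// ltW.
  have e2 : 0 <= nu2 * T `^ (b - a) * X * (V t - V s) by rewrite !mulr_ge0// ltW.
  have e3 : 0 <= X * D by rewrite mulr_ge0.
  have -> : (1 + nu1 + nu2 * T `^ (b - a)) * X * (V t - V s + D) =
    X * (V t - V s) + (nu1 * (X * D) + nu2 * (X * (T `^ (b - a) * D))) +
    (nu1 * X * (V t - V s) + nu2 * T `^ (b - a) * X * (V t - V s) + X * D) by ring.
  by rewrite -[leLHS]addr0 lerD ?lerD2r// !addr_ge0.
have -> : Cphi * X ^+ N.+1 * (V t - V s + D) =
   (p - 1) * X ^+ N * ((1 + nu1 + nu2 * T `^ (b - a)) * X * (V t - V s + D)).
  by rewrite /Cphi exprS; ring.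
have p10 : 0 <= p - 1 by apply: le_trans p11.
by apply: ler_pM => //; [rewrite mulr_ge0 ?powR_ge0|rewrite ler_wpM2l].
Qed.

Let Cphi1 := Cphi * X ^+ N.+1.
Let Cphi10 : 0 <= Cphi1. Proof. by rewrite mulr_ge0 ?exprn_ge0. Qed.

(** Each summand takes care of one of the two conditions of the sewing estimate. *)
Definition sewing_cst := 2 / (1 - 2^-1 `^ b) + 2 / (1 - 2 * 2^-1 `^ (a + b)).
Local Notation Cy := sewing_cst.

Let half_powR_lt1 (r : R) : 0 < r -> (2^-1 : R) `^ r < 1.
Proof.
move=> r0; have e1 : (1 : R) `^ r = 1 by rewrite powR1.
rewrite -[ltRHS]e1; apply: gt0_ltr_powR; rewrite ?nnegrE//.
by rewrite invf_lt1// ltr1n.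
Qed.

Let qb : 0 < 1 - 2^-1 `^ b. Proof. by rewrite subr_gt0 half_powR_lt1. Qed.
Let qab : 0 < 1 - 2 * 2^-1 `^ (a + b).
Proof.
rewrite subr_gt0 (_ : a + b = (a + b - 1) + 1); last by ring.
rewrite powRD ?powRr1//; last by rewrite invr_eq0 pnatr_eq0 implybT.
by rewrite mulrCA mulfV ?mulr1 ?half_powR_lt1 ?subr_gt0// pnatr_eq0.
Qed.
Let Cy0 : 0 <= Cy. Proof. by rewrite /Cy addr_ge0// divr_ge0// ltW. Qed.
Let Cyb : 2 <= Cy * (1 - 2^-1 `^ b).
Proof. by rewrite mulrDl divfK ?gt_eqF// lerDl mulr_ge0 ?divr_ge0 ?(ltW qb) ?(ltW qab). Qed.
Let Cyab : 2 <= Cy * (1 - 2 * 2^-1 `^ (a + b)).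
Proof. by rewrite mulrDl (divfK (lt0r_neq0 qab)) lerDr mulr_ge0 ?divr_ge0 ?(ltW qb) ?(ltW qab). Qed.

Definition young_cst := Cy * Cphi * (T `^ (1 - a) + T).
Local Notation Ky := young_cst.
Let Ky0 : 0 <= Ky.
Proof.
by apply: mulr_ge0; [exact: mulr_ge0|apply: addr_ge0; [exact: powR_ge0|exact: ltW]].
Qed.

Let V0 : V 0 = 0. Proof. exact: prim0. Qed.

Lemma tame_var_le t : 0 <= t <= T -> 0 <= V t <= X.
Proof.
move=> /andP[t0 tT]; rewrite -[X in X <= _ <= _]V0 tame_var_mono//=.
by apply: le_trans (tame_var tp); apply: tame_var_mono.
Qed.

Lemma tame_young_err_le t D : 0 <= t <= T -> 0 <= D <= T ->
  young_err a b Cphi1 X Cy V 0 t D <= Ky * X ^+ N.+3 * D `^ (a + b - 1).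
Proof.
move=> tT /andP[D0 DT]; have /andP[Vt0 VtX] := tame_var_le tT.
rewrite /young_err V0 !subr0.
have bE : D `^ b <= T `^ (1 - a) * D `^ (a + b - 1).
  have {1}-> : b = (1 - a) + (a + b - 1) by ring.
  rewrite (@powRD _ D (1 - a) (a + b - 1)); last by rewrite (_ : 1 - a + (a + b - 1) = b) ?(gt_eqF b0)//; ring.
  rewrite ler_wpM2r ?powR_ge0// ge0_ler_powR ?nnegrE ?(ltW T0)//.
  by rewrite subr_ge0; have := ab; have := b1; lra.
set E := D `^ (a + b - 1) in bE *; have E0 : 0 <= E by exact: powR_ge0.
have -> : Ky * X ^+ N.+3 * E = Cy * (Cphi1 * X) * (X * (T `^ (1 - a) * E) + X * (T * E)).
  by rewrite /Ky /Cphi1 !exprS; ring.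
have /andP[t0 tT'] := tT.
apply: ler_wpM2l; first by apply: mulr_ge0 => //; exact: mulr_ge0.
apply: lerD; first by apply: ler_pM => //; exact: powR_ge0.
apply: (@le_trans _ _ (T * E)); first by rewrite ler_wpM2r.
by rewrite ler_peMl// mulr_ge0// ltW.
Qed.

Local Notation J := (young_int T phi g).

Lemma tame_riemann_dist l D t : 0 <= t <= T -> 0 <= D <= T ->
  path <=%R 0 l -> last 0 l = t -> mesh_le D 0 l ->
  `|left_sum phi g 0 l - J t| <= Ky * X ^+ N.+3 * D `^ (a + b - 1).
Proof.
move=> tT DT pl lt hl; apply: le_trans (tame_young_err_le tT DT).
apply: (young_int_dist T0 a0 b0 ab1 Cphi10 X0 tame_var_mono tame_phi_reg (tame_holderg tp) Cy0 Cyb Cyab) => //.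
Qed.

Lemma dyadic_left_sumE F t n : 0 <= t <= T ->
  \sum_(0 <= k < 2 ^ n) y (dyadic T n k) `^ (p - 1) * grid_incr T t F n k =
  left_sum phi F 0 (dyadic_grid T t n).
Proof.
move=> tT; have t0 : 0 <= t by case/andP : tT.
rewrite -[X in left_sum _ _ X](stopped0 T n t0) left_sum_iota big_mkord.
by apply: eq_bigr => k _; exact: (grid_incr_dyadic t T0 phi).
Qed.

Let Tg := T `^ (a + b - 1).
Let TT : 0 <= T <= T. Proof. by rewrite lexx ltW. Qed.

(** Comparison with the partition of [0, t] into a single step. *)
Lemma tame_young_le t : 0 <= t <= T -> `|J t| <= (Ky * T `^ (a + b - 1) + T `^ b) * X ^+ N.+3.
Proof.
move=> tT; have /andP[t0 tT'] := tT.
have h : `|left_sum phi g 0 [:: t] - J t| <= Ky * X ^+ N.+3 * Tg.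
  by apply: (tame_riemann_dist tT TT); rewrite /mesh_le /= ?andbT// subr0.
have h0 : `|left_sum phi g 0 [:: t]| <= T `^ b * X ^+ N.+3.
  rewrite /= addr0 normrM; have o0 : 0 <= (0:R) <= T by rewrite lexx ltW.
  have /andP[p0 pX] := tame_phi_le o0; rewrite (ger0_norm p0).
  have hg := tame_holderg tp (lexx 0) t0 tT'; rewrite subr0 in hg.
  have hT : t `^ b <= T `^ b by rewrite ge0_ler_powR ?nnegrE ?(ltW b0) ?(ltW T0).
  apply: (@le_trans _ _ (X ^+ N * (X * T `^ b))).
    by apply: ler_pM => //; apply: le_trans hg _; rewrite ler_wpM2l.
  rewrite mulrA -exprSr mulrC ler_wpM2l ?powR_ge0//.
  by apply: ler_weXn2l => //; exact: leq_trans (leqnSn _) (leqnSn _).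
rewrite -(subKr (left_sum phi g 0 [:: t]) (J t)); apply: le_trans (ler_normB _ _) _.
rewrite mulrDl addrC lerD// (le_trans h)// mulrAC//.
Qed.

Let Sg_dist t n : 0 <= t <= T ->
  `|left_sum phi g 0 (dyadic_grid T t n) - J t| <= Ky * X ^+ N.+3 * (T / 2 ^+ n) `^ (a + b - 1).
Proof.
move=> tT; have [h1 h2 h3] := dyadic_grid_spec T0 n tT.
apply: tame_riemann_dist => //; rewrite divr_ge0 ?exprn_ge0 ?(ltW T0)//=.
by rewrite ler_pdivrMr ?exprn_gt0// ler_peMr ?(ltW T0)// exprn_ege1// ler1n.
Qed.

Lemma tame_young_cvg t : 0 <= t <= T ->
  \sum_(0 <= k < 2 ^ n) y (dyadic T n k) `^ (p - 1) * grid_incr T t g n k @[n --> \oo] --> J t.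
Proof.
move=> tT; under eq_fun do rewrite dyadic_left_sumE//.
apply: (young_int_cvg T0 a0 b0 ab1 Cphi10 X0 tame_var_mono tame_phi_reg (tame_holderg tp) Cy0 Cyb Cyab) => //.
Qed.

Lemma tame_young_cont : unif_cont T J.
Proof.
pose K := X ^+ N * X + Cy * (Cphi1 * X) * (X + T `^ a).
have K0 : 0 <= K.
  by apply: addr_ge0; apply: mulr_ge0 => //; [exact: exprn_ge0|apply: mulr_ge0 => //; exact: mulr_ge0|rewrite addr_ge0 ?powR_ge0].
apply: (holder_unif_cont b0 K0) => s t s0 st tT.
have sT : 0 <= s <= T by rewrite s0 (le_trans st).
have tT' : 0 <= t <= T by rewrite tT (le_trans s0).
have h := young_int_increment T0 a0 b0 ab1 Cphi10 X0 tame_var_mono tame_phi_reg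
  (tame_holderg tp) Cy0 Cyb Cyab s0 st tT.
have /andP[p0 pX] := tame_phi_le sT.
have hg := tame_holderg tp s0 st tT.
have /andP[Vs0 _] := tame_var_le sT; have /andP[_ VtX] := tame_var_le tT'.
rewrite (_ : J t - J s = (J t - J s - y s `^ (p - 1) * (g t - g s)) + y s `^ (p - 1) * (g t - g s)); last by rewrite subrK.
apply: le_trans (ler_normD _ _) _; apply: le_trans (lerD h (lexx _)) _.
rewrite normrM (ger0_norm p0) /K [leRHS]mulrDl [leLHS]addrC; apply: lerD.
  by rewrite -mulrA; apply: ler_pM.
rewrite -[leRHS]mulrA; apply: ler_wpM2l; first by apply: mulr_ge0 => //; exact: mulr_ge0.
rewrite /young_gap [leRHS]mulrDl; apply: lerD.
  by rewrite ler_wpM2r ?powR_ge0// lerBlDr (le_trans VtX)// lerDl.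
rewrite powRD; last by rewrite gt_eqF// addr_gt0.
rewrite ler_wpM2r ?powR_ge0// ge0_ler_powR ?nnegrE ?(ltW a0) ?(ltW T0) ?subr_ge0//.
by rewrite lerBlDr (le_trans tT)// lerDl.
Qed.

Let yc : unif_cont T y.
Proof. by have [zc bi _ yE] := tame_sol tp; exact: (sol_cont T0 zc bi yE). Qed.

Let ym : exists2 m0, 0 < m0 & forall s, 0 <= s <= T -> m0 <= y s <= X.
Proof.
have [s sT hs] := EVT_min (ltW T0) (unif_cont_within yc).
exists (y s); first by apply: ypos; move: sT; rewrite in_itv.
by move=> u uT; rewrite (tame_le tp uT) andbT hs// in_itv.
Qed.

Lemma tame_powR_cont r : unif_cont T (fun s => y s `^ r).
Proof. by have [m0 m00 ymm] := ym; exact: (powR_sol_cont m00 ymm yc). Qed.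

Let yincr s s' : 0 <= s -> s <= s' -> s' <= T -> y s' - y s =
  prim (bd \o y) s' - prim (bd \o y) s + nu1 * (x s' - x s) + nu2 * (g s' - g s).
Proof.
move=> s0 ss sT; have [zc bi _ yE] := tame_sol tp.
by rewrite (sol_incr yE s0 ss sT); ring.
Qed.

Let JgC := 2 * (Ky * Tg) + T `^ b.
Let Sg_le t n : 0 <= t <= T ->
  `|left_sum phi g 0 (dyadic_grid T t n)| <= JgC * X ^+ N.+3.
Proof.
move=> tT; have h := Sg_dist n tT.
have hT : (T / 2 ^+ n) `^ (a + b - 1) <= Tg.
  rewrite ge0_ler_powR ?nnegrE ?divr_ge0 ?exprn_ge0 ?subr_ge0 ?(ltW T0) ?(ltW ab1)//.
  by rewrite ler_pdivrMr ?exprn_gt0// ler_peMr ?(ltW T0)// exprn_ege1// ler1n.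
have {}h := le_trans h (ler_wpM2l (mulr_ge0 Ky0 (exprn_ge0 N.+3 X0)) hT).
rewrite -(subrK (J t) (left_sum _ _ _ _)); apply: le_trans (ler_normD _ _) _.
apply: le_trans (lerD h (tame_young_le tT)) _; rewrite /JgC /Tg le_eqVlt; apply/orP; left.
by apply/eqP; ring.
Qed.

Definition ito_cst := (2 + p + nu2 * p * (2 * (Ky * T `^ (a + b - 1)) + T `^ b)
   + p * (p - 1) * (2 * nu1 ^+ 2 + 2 * (2 + 2 * (nu2 ^+ 2 * (T `^ (2 * b - 1) * T))))) / (nu1 * p).

(** This replaces a martingale inequality: the Taylor formula expresses the left
    sums against x through bounded quantities and the quadratic variation. *)
Lemma tame_left_sum_le t n : 0 <= t <= T ->
  `|\sum_(0 <= k < 2 ^ n) y (dyadic T n k) `^ (p - 1) * grid_incr T t x n k| <=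
  ito_cst * X ^+ N.+3 * (1 + \sum_(0 <= k < 2 ^ n) grid_incr T t x n k ^+ 2).
Proof.
move=> tT; have [m0 m00 ymm] := ym; have [_ bi _ _] := tame_sol tp.
have p0 : 0 < p by apply: lt_trans p2.
have h := left_sum_bound T0 tT p2 nu10 m00 ymm bi yincr X0 b12 (tame_holderg tp) n.
rewrite (dyadic_left_sumE g n tT) in h.
set Q := \sum_(0 <= k < 2 ^ n) _ ^+ 2 in h *.
have Q0 : 0 <= Q by apply: sumr_ge0 => k _; exact: sqr_ge0.
set Sx := `|_| in h *.
rewrite -(ler_pM2l (mulr_gt0 nu10 p0)); apply: le_trans h _.
set A := X ^+ N.+3; have A0 : 0 <= A by exact: exprn_ge0.
have XA j : (j <= N.+3)%N -> X ^+ j <= A by move=> jN; rewrite ler_weXn2l.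
have /andP[VT0 VTX] := tame_var_le TT.
have e1 : X `^ p <= A by apply: le_trans (powR_le_exprn X1 (lexx p)) (XA _ _); rewrite -addn3 leq_addr.
have e2 : X `^ (p - 1) * V T <= A.
  apply: (@le_trans _ _ (X ^+ N * X)); last by rewrite -exprSr XA// -addn3 -addn1 leq_add2l.
  by rewrite ler_pM ?powR_ge0// powR_le_exprn//; have := p2; lra.
have hX : X `^ (p - 2) <= X ^+ N by rewrite powR_le_exprn//; have := p2; lra.
have X2 : X ^+ N * X ^+ 2 <= A by rewrite -exprD XA// -addn3 leq_add2l.
have e3 : X `^ (p - 2) * V T ^+ 2 <= A.
  by apply: le_trans X2; rewrite ler_pM ?powR_ge0 ?exprn_ge0// lerXn2r ?nnegrE.
have e4 : X `^ (p - 2) * X ^+ 2 <= A.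
  by apply: le_trans X2; rewrite ler_wpM2r ?exprn_ge0.
have e5 : X `^ (p - 2) <= A by apply: le_trans hX (XA _ _); rewrite -addn3 leq_addr.
have e6 := Sg_le n tT; rewrite -/A in e6.
set SG := `|left_sum _ _ _ _| in e6 *.
have -> : ito_cst = (2 + p + nu2 * p * JgC
   + p * (p - 1) * (2 * nu1 ^+ 2 + 2 * (2 + 2 * (nu2 ^+ 2 * (T `^ (2 * b - 1) * T))))) / (nu1 * p) by [].
set tb := T `^ (2 * b - 1); have tb0 : 0 <= tb by exact: powR_ge0.
set K := (X in X / _); have KE : nu1 * p * (K / (nu1 * p) * A * (1 + Q)) = K * A * (1 + Q).
  by field; rewrite !gt_eqF.
rewrite [leRHS]KE {KE} /K (gtr0_norm nu20).
have pp : 0 <= p * (p - 1) by rewrite mulr_ge0 ?(ltW p0)// subr_ge0; have := p2; lra.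
have JgC0 : 0 <= JgC.
  by apply: addr_ge0; [do 2 apply: mulr_ge0 => //|]; exact: powR_ge0.
have T00 := ltW T0.
have n1 : 0 <= nu1 ^+ 2 by exact: sqr_ge0.
have n2 : 0 <= nu2 ^+ 2 by exact: sqr_ge0.
have AQ : 0 <= A * Q by exact: mulr_ge0.
have f1 : 2 * X `^ p <= 2 * A by rewrite ler_wpM2l.
have f2 : p * X `^ (p - 1) * V T <= p * A by rewrite -mulrA ler_wpM2l// ltW.
have f3 : nu2 * p * SG <= nu2 * p * (JgC * A) by rewrite ler_wpM2l// mulr_ge0// ltW.
have f4 : X `^ (p - 2) * (2 * nu1 ^+ 2 * Q + 2 * (2 * V T ^+ 2 + 2 * (nu2 ^+ 2 * (X ^+ 2 * (tb * T)))))
   <= A * (2 * nu1 ^+ 2 * Q) + 2 * (2 * A + 2 * (nu2 ^+ 2 * (A * (tb * T)))).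
  have -> : X `^ (p - 2) * (2 * nu1 ^+ 2 * Q + 2 * (2 * V T ^+ 2 + 2 * (nu2 ^+ 2 * (X ^+ 2 * (tb * T)))))
    = X `^ (p - 2) * (2 * nu1 ^+ 2 * Q) + 2 * (2 * (X `^ (p - 2) * V T ^+ 2) +
       2 * (nu2 ^+ 2 * ((X `^ (p - 2) * X ^+ 2) * (tb * T)))) by ring.
  apply: lerD; first by apply: ler_wpM2r => //; do 2 apply: mulr_ge0 => //.
  apply: ler_wpM2l => //; apply: lerD; first by apply: ler_wpM2l.
  apply: ler_wpM2l => //; apply: ler_wpM2l => //.
  by apply: ler_wpM2r => //; exact: mulr_ge0.
have {}f4 := ler_wpM2l pp f4.
rewrite -[p * (p - 1) * _ * (_ + _)]mulrA.
apply: le_trans (lerD (lerD (lerD f1 f2) f3) f4) _.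
have g1 : 0 <= 2 * (A * Q) by exact: mulr_ge0.
have g2 : 0 <= p * (A * Q) by rewrite mulr_ge0// ltW.
have g3 : 0 <= nu2 * p * JgC * (A * Q).
  by apply: mulr_ge0 => //; apply: mulr_ge0 => //; apply: mulr_ge0; exact: ltW.
have g4 : 0 <= p * (p - 1) * (2 * nu1 ^+ 2 * A + 4 * (A * Q) + 4 * (nu2 ^+ 2 * (tb * T) * (A * Q))).
  apply: mulr_ge0 => //; apply: addr_ge0; first apply: addr_ge0.
  - by apply: mulr_ge0 => //; exact: mulr_ge0.
  - exact: mulr_ge0.
  - by do 2 apply: mulr_ge0 => //; apply: mulr_ge0 => //; exact: mulr_ge0.
rewrite -subr_ge0 (_ : _ - _ = 2 * (A * Q) + p * (A * Q) + nu2 * p * JgC * (A * Q) +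
  p * (p - 1) * (2 * nu1 ^+ 2 * A + 4 * (A * Q) + 4 * (nu2 ^+ 2 * (tb * T) * (A * Q)))); last by ring.
by rewrite !addr_ge0.
Qed.

(** The Itô correction and the part - c / y of the drift cancel. *)
Lemma tame_foellmer t : c = (p - 1) * nu1 ^+ 2 / 2 -> 0 <= t <= T ->
  (forall m j, (j <= 2 ^ m)%N ->
    \sum_(0 <= k < j * 2 ^ n) grid_incr T t x (m + n) k ^+ 2 @[n --> \oo] --> stopped T t m j) ->
  \sum_(0 <= k < 2 ^ n) y (dyadic T n k) `^ (p - 1) * grid_incr T t x n k @[n --> \oo] -->
  (y t `^ p - y 0 `^ p - prim (fun s => p * kappa - p * theta * y s `^ p) t - nu2 * p * J t)
  / (nu1 * p).
Proof.
move=> cE tT QV; have [m0 m00 ymm] := ym; have [zc bi _ yE] := tame_sol tp.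
have h := foellmer_ito T0 tT p2 nu10 m00 ymm yc bi yincr X0 b12 (tame_holderg tp) QV
  (tame_young_cvg tT).
have /andP[t0 tT'] := tT.
have yr := tame_powR_cont.
have i1 : intble T (fun s => p * y s `^ (p - 1) * bd (y s)).
  by apply: (intbleM (f := fun s => p * y s `^ (p - 1)) (g := bd \o y)) => //; [apply: unif_contZ|exact: ltW].
have i2 : intble T (fun s => 2^-1 * (p * (p - 1) * y s `^ (p - 2))).
  by apply: intble_cont; do 2 apply: unif_contZ.
have E : prim (fun s => p * kappa - p * theta * y s `^ p) t =
   prim (fun s => p * y s `^ (p - 1) * bd (y s)) t +
   nu1 ^+ 2 * prim (fun s => 2^-1 * (p * (p - 1) * y s `^ (p - 2))) t.
  rewrite -(primZ (nu1 ^+ 2) i2 tT') -(primD i1 _ tT'); last exact: intbleZ.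
  apply: eq_prim => s s0 st; have sT : 0 <= s <= T by rewrite s0 (le_trans st).
  have y0 := ypos sT; have yn0 : y s != 0 by rewrite gt_eqF.
  have e1 : y s `^ p = y s `^ (p - 1) * y s.
    by rewrite -[X in _ * X]powRr1 ?(ltW y0)// -powRD ?subrK// yn0 implybT.
  have e2 : y s `^ (p - 1) = y s `^ (p - 2) * y s.
    rewrite -[X in _ * X]powRr1 ?(ltW y0)// -powRD; last by rewrite yn0 implybT.
    by congr (_ `^ _); ring.
  have z0 : y s `^ (p - 1) != 0 by rewrite gt_eqF// powR_gt0.
  rewrite /rdrift e1 cE; move: z0 e2; set z := y s `^ (p - 1); set zz := y s `^ (p - 2) => z0 e2.
  have -> : p * z * (kappa / z - (p - 1) * nu1 ^+ 2 / 2 / y s - theta * y s) =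
    p * kappa - p * (p - 1) * nu1 ^+ 2 / 2 * (z / y s) - p * theta * (z * y s).
    by field; rewrite z0 yn0.
  have -> : z / y s = zz by rewrite e2 mulfK.
  by field.
rewrite E opprD addrA; exact: h.
Qed.

End tame.

End path_estimates.

(** * Convergence in mean square, and increments of fractional Brownian motion *)

Section convergence_tools.
Context {R : realType}.
Local Notation mu := (@lebesgue_measure R).

Lemma ge0_ecvg0 (u : nat -> \bar R) : (forall n, (0 <= u n)%E) ->
  (forall e : R, 0 < e -> \forall n \near \oo, (u n <= e%:E)%E) -> u n @[n --> \oo] --> 0%E.
Proof.
move=> u0 h; apply/(@fine_cvgP _ _ _ _ _ 0); split.
  have := h 1 ltr01; apply: filterS => n un.
  by rewrite ge0_fin_numE//; apply: le_lt_trans un (ltry _).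
apply/cvgrPdist_le => e e0; have := h e e0; apply: filterS => n un /=.
rewrite sub0r normrN ger0_norm ?fine_ge0// -lee_fin fineK// ge0_fin_numE//.
exact: le_lt_trans un (ltry _).
Qed.

Lemma ecvg0_le (u : nat -> \bar R) (e : R) : u n @[n --> \oo] --> 0%E -> 0 < e ->
  \forall n \near \oo, (u n <= e%:E)%E.
Proof.
move=> /(@fine_cvgP _ _ _ _ _ 0)[fin /cvgrPdist_le cv] e0.
have h := cv e e0; move: fin h; apply: filterS2 => n fn /= h.
by rewrite -(fineK fn) lee_fin; move: h; rewrite sub0r normrN; apply: le_trans; exact: ler_norm.
Qed.

(** Valid without measurability: the integral of a nonnegative function is a
    supremum over the simple functions below it. *)
Lemma le_integral_nonneg d (Om : measurableType d) (m : {measure set Om -> \bar R})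
    (D : set Om) (f g : Om -> \bar R) :
  (forall x, D x -> (0 <= f x)%E) -> (forall x, D x -> (f x <= g x)%E) ->
  (\int[m]_(x in D) f x <= \int[m]_(x in D) g x)%E.
Proof.
move=> f0 fg; rewrite !ge0_integralE//; last by move=> x Dx; exact: le_trans (f0 x Dx) (fg x Dx).
apply: le_ereal_sup => _ [h /= hf <-]; exists h => // x; apply: le_trans (hf x) _.
by rewrite /patch; case: ifPn => // /set_mem; exact: fg.
Qed.

(** The time 0 is excepted because no interval of a simple process contains it. *)
Lemma time_integral_le (T c : R) (h : R -> \bar R) : 0 <= T -> 0 <= c ->
  (forall s, 0 <= s <= T -> (0 <= h s)%E) -> (forall s, 0 < s -> s <= T -> (h s <= c%:E)%E) ->
  (\int[mu]_(s in `[0%R, T]) h s <= (c * T)%:E)%E.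
Proof.
move=> T0 c0 h0 hc; pose g (s : R) : \bar R := if s == 0 then +oo%E else c%:E.
have mg : measurable_fun [set: R] g.
  by apply: measurable_fun_ifT => //; apply: measurable_fun_eqr.
have D0 s : `[0, T]%classic s -> 0 <= s <= T by rewrite /= in_itv.
have gc : (\int[mu]_(s in `[0%R, T]) g s = \int[mu]_(s in `[0%R, T]) (cst c%:E) s)%E.
  apply: ge0_ae_eq_integral => //.
  - exact: measurable_funTS.
  - by move=> x _; rewrite /g; case: ifP.
  - exists [set 0]; split; [exact: measurable_set1|exact: lebesgue_measure_set1|].
    move=> s /= hs; apply: contrapT => /eqP s0; apply: hs => _.
    by rewrite /g (negbTE s0).
apply: (@le_trans _ _ (\int[mu]_(s in `[0%R, T]) g s)%E).
  apply: le_integral_nonneg => s /D0 sT; first exact: h0.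
  rewrite /g; case: eqP => [_|/eqP s0]; first by rewrite leey.
  by case/andP: sT => s1 s2; apply: hc => //; rewrite lt_neqAle eq_sym s0.
rewrite gc integral_cst//= lebesgue_measure_itv/= lte_fin.
case: ltP => [_|_]; first by rewrite oppr0 adde0 EFinM.
by rewrite mule0 lee_fin mulr_ge0.
Qed.

End convergence_tools.

Section moments.
Context {R : realType} d (Om : measurableType d) (P : probability Om R).

Lemma square_integrable_Lfun (f : Om -> R) : measurable_fun setT f ->
  (\int[P]_w ((f w) ^+ 2)%:E < +oo)%E -> f \in Lfun P 2%:E.
Proof.
move=> mf fi; rewrite inE; apply/andP; split; rewrite inE//= /finite_norm unlock poweR_lty//.
apply: le_lt_trans fi; rewrite le_eqVlt; apply/orP; left; apply/eqP.
by apply: eq_integral => w _ /=; rewrite powR_mulrn// real_normK// num_real.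
Qed.

(** A form of the Vitali convergence theorem in which the uniform bound on the
    fourth moments comes from a product bound. *)
Lemma L2_cvg0_of_moments (Z Q : nat -> Om -> R) (W : Om -> R) (C : R) :
  (forall n, measurable_fun setT (Z n)) -> (forall n, measurable_fun setT (Q n)) ->
  measurable_fun setT W -> (forall n w, 0 <= Q n w) -> (forall w, 0 <= W w) ->
  (\int[P]_w (W w ^+ 8)%:E < +oo)%E ->
  (forall n, \int[P]_w (Q n w ^+ 8)%:E <= C%:E)%E ->
  (forall n, {ae P, forall w, `|Z n w| <= W w * (1 + Q n w)}) ->
  {ae P, forall w, Z n w @[n --> \oo] --> 0} ->
  (\int[P]_w (Z n w ^+ 2)%:E)%E @[n --> \oo] --> 0%E.
Proof.
move=> mZ mQ mW Q0 W0 W8 Q8 Zb Zc.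
have mX k (f : Om -> R) : measurable_fun setT f -> measurable_fun setT (fun w => (f w ^+ k)%:E).
  by move=> mf; apply/measurable_EFinP; exact: measurable_funX.
pose C' := fine (\int[P]_w (W w ^+ 8)%:E) + 256 * (1 + C).
have W8f : (\int[P]_w (W w ^+ 8)%:E = (fine (\int[P]_w (W w ^+ 8)%:E))%:E)%E.
  by rewrite fineK// ge0_fin_numE//; apply: integral_ge0 => w _; rewrite lee_fin exprn_ge0.
have C0 : 0 <= C.
  by rewrite -lee_fin; apply: le_trans (Q8 0%N); apply: integral_ge0 => w _; rewrite lee_fin exprn_ge0.
have C'0 : 0 <= C'.
  rewrite addr_ge0 ?mulr_ge0 ?addr_ge0// fine_ge0//.
  by apply: integral_ge0 => w _; rewrite lee_fin exprn_ge0.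
have Z4 n : (\int[P]_w (Z n w ^+ 4)%:E <= C'%:E)%E.
  apply: (@le_trans _ _ (\int[P]_w ((W w ^+ 8)%:E + 256%:E * (1 + (Q n w ^+ 8)%:E)))%E).
    apply: ae_ge0_le_integral => //.
    - by move=> w _; rewrite lee_fin exprn_even_ge0.
    - exact: mX.
    - move=> w _; change (0 <= (W w ^+ 8 + 256 * (1 + Q n w ^+ 8))%:E)%E.
      by rewrite lee_fin addr_ge0 ?mulr_ge0 ?addr_ge0 ?exprn_ge0.
    - apply: emeasurable_funD; first exact: mX.
      by apply: measurable_funeM; apply: emeasurable_funD => //; exact: mX.
    have := Zb n; apply: filterS => w Zw _.
    change ((Z n w ^+ 4)%:E <= (W w ^+ 8 + 256 * (1 + Q n w ^+ 8))%:E)%E; rewrite lee_fin.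
    have q0 := Q0 n w; have w0 := W0 w; set q := Q n w in q0 Zw *; set v := W w in w0 Zw *.
    have -> : Z n w ^+ 4 = `|Z n w| ^+ 4 by rewrite -normrX ger0_norm// exprn_even_ge0.
    apply: (@le_trans _ _ ((v * (1 + q)) ^+ 4)).
      by apply: lerXn2r => //; rewrite nnegrE ?mulr_ge0 ?addr_ge0.
    apply: (@le_trans _ _ (v ^+ 8 + (1 + q) ^+ 8)).
      rewrite exprMn -[8%N]/(4 * 2)%N !exprM; set x := v ^+ 4; set y := (1 + q) ^+ 4.
      rewrite -subr_ge0 (_ : _ - _ = 2^-1 * (x ^+ 2 + y ^+ 2 + (x - y) ^+ 2)); last by field.
      by rewrite mulr_ge0 ?addr_ge0 ?sqr_ge0// invr_ge0.
    rewrite lerD2l; have -> : 256 = 2 ^+ 8 :> R by rewrite -natrX.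
    have [q1|/ltW q1] := leP q 1.
      apply: (@le_trans _ _ (2 ^+ 8)); last by rewrite ler_peMr ?exprn_ge0// lerDl exprn_ge0.
      by apply: lerXn2r; rewrite ?nnegrE ?addr_ge0//; lra.
    apply: (@le_trans _ _ ((2 * q) ^+ 8)); last first.
      by rewrite exprMn ler_wpM2l ?exprn_ge0// lerDr.
    by apply: lerXn2r; rewrite ?nnegrE ?addr_ge0 ?mulr_ge0//; lra.
  rewrite ge0_integralD//; first last.
  - by apply: measurable_funeM; apply: emeasurable_funD => //; exact: mX.
  - move=> w _; change (0 <= (256 * (1 + Q n w ^+ 8))%:E)%E.
    by rewrite lee_fin mulr_ge0// addr_ge0// exprn_ge0.
  - exact: mX.
  - by move=> w _; rewrite lee_fin exprn_ge0.
  rewrite ge0_integralZl//; first last.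
  - move=> w _; change (0 <= (1 + Q n w ^+ 8)%:E)%E.
    by rewrite lee_fin addr_ge0// exprn_ge0.
  - by apply: emeasurable_funD => //; exact: mX.
  rewrite ge0_integralD//; first last.
  - exact: mX.
  - by move=> w _; rewrite lee_fin exprn_ge0.
  have P1 : (\int[P]_w (1 : \bar R) = 1)%E by rewrite integral_cst//= probability_setT mule1.
  have -> : C'%:E = (\int[P]_w (W w ^+ 8)%:E + 256%:E * (1 + C%:E))%E by rewrite W8f.
  rewrite P1 leeD2l//.
  by rewrite lee_wpmul2l// leeD2l.
apply: ge0_ecvg0 => [n|e e0].
  by apply: integral_ge0 => w _; rewrite lee_fin sqr_ge0.
(* Z^2 <= min(Z^2, A) + Z^4 / A: the last term has a small integral if A is
   large, and dominated convergence applies to the other one. *)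
pose A := 2 * C' / e + 1.
have A0 : 0 < A by rewrite ltr_wpDl// divr_ge0 ?mulr_ge0// ltW.
have CA : C' / A <= e / 2.
  rewrite ler_pdivrMr// /A mulrDr mulr1.
  have -> : e / 2 * (2 * C' / e) = C' by field; rewrite gt_eqF.
  by rewrite lerDl divr_ge0// ltW.
pose f n w := (Num.min (Z n w ^+ 2) A)%:E.
have mf n : measurable_fun setT (f n).
  apply/measurable_EFinP; apply: measurable_minr => //; exact: measurable_funX.
have c1 : {ae P, forall w, [set: Om] w -> f n w @[n --> \oo] --> 0%E}.
  apply: filterS Zc => w cw _; apply/cvg_EFin; first exact: nearW.
  have c2 : Z n w ^+ 2 @[n --> \oo] --> 0.
    by rewrite -[X in _ --> X](mulr0 (0 : R)); exact: (cvgM cw cw).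
  move/cvgrPdist_le : c2 => c2; apply/cvgrPdist_le => r r0.
  move: (c2 r r0); apply: filterS => n /=; rewrite !sub0r !normrN ger0_norm ?sqr_ge0// => h.
  by rewrite ger0_norm ?le_min ?sqr_ge0 ?(ltW A0)// ge_min h.
have c2 : {ae P, forall w, forall n, [set: Om] w -> (`|f n w| <= (cst A%:E) w)%E}.
  apply: aeW => w n _; rewrite gee0_abs; first by rewrite lee_fin ge_min lexx orbT.
  by rewrite lee_fin le_min sqr_ge0 ltW.
have [_ _] := dominated_convergence measurableT mf (measurable_cst 0%E) c1
  (finite_measure_integrable_cst P A measurableT) c2.
rewrite integral0 => fc.
have := ecvg0_le fc (divr_gt0 e0 (ltr0n R 2)); apply: filterS => n fn.
apply: (@le_trans _ _ (\int[P]_w (f n w + A^-1%:E * (Z n w ^+ 4)%:E))%E).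
  apply: ge0_le_integral => //.
  - by move=> w _; rewrite lee_fin sqr_ge0.
  - exact: mX.
  - by apply: emeasurable_funD => //; apply: measurable_funeM; exact: mX.
  move=> w _; change ((Z n w ^+ 2)%:E <= (Num.min (Z n w ^+ 2) A + A^-1 * Z n w ^+ 4)%:E)%E.
  rewrite lee_fin.
  have z0 := sqr_ge0 (Z n w); rewrite (exprM _ 2 2).
  set z := Z n w ^+ 2 in z0 *; have [zA|/ltW Az] := leP z A.
    by rewrite lerDl; apply: mulr_ge0; [rewrite invr_ge0 ltW|exact: sqr_ge0].
  apply: (@le_trans _ _ (A^-1 * z ^+ 2)); last by rewrite lerDr ltW.
  by rewrite mulrC ler_pdivlMr// expr2 ler_wpM2l.
rewrite ge0_integralD//; first last.
- by apply: measurable_funeM; exact: mX.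
- move=> w _; change (0 <= (A^-1 * Z n w ^+ 4)%:E)%E.
  by rewrite lee_fin mulr_ge0 ?exprn_even_ge0// invr_ge0 ltW.
- by move=> w _; rewrite lee_fin le_min sqr_ge0 ltW.
rewrite ge0_integralZl//; first last.
- by rewrite lee_fin invr_ge0 ltW.
- by move=> w _; rewrite lee_fin exprn_even_ge0.
- exact: mX.
rewrite (splitr e) EFinD leeD//.
apply: (@le_trans _ _ (A^-1%:E * C'%:E)%E); first by rewrite lee_wpmul2l// lee_fin invr_ge0 ltW.
by rewrite -EFinM lee_fin mulrC.
Qed.

(** Otherwise there is a sequence of pairs of times that approach each other
    without the distance tending to 0, against dominated convergence. *)
Lemma L2_modulus (T : R) (phi : R -> Om -> R) (G : Om -> R) :
  (forall t, 0 <= t <= T -> measurable_fun setT (phi t)) -> measurable_fun setT G ->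
  (\int[P]_w (G w ^+ 2)%:E < +oo)%E ->
  {ae P, forall w, unif_cont T (phi ^~ w) /\ forall t, 0 <= t <= T -> `|phi t w| <= G w} ->
  forall e, 0 < e -> exists2 de, 0 < de & forall s t, 0 <= s <= T -> 0 <= t <= T ->
    `|t - s| < de -> (\int[P]_w ((phi t w - phi s w) ^+ 2)%:E <= e%:E)%E.
Proof.
move=> mphi mG G2 hphi e e0; apply: contrapT => no.
have /choice[st hst] : forall n : nat, exists p : R * R, [/\ 0 <= p.1 <= T, 0 <= p.2 <= T,
    `|p.2 - p.1| < n.+1%:R^-1 &
    (e%:E <= \int[P]_w ((phi p.2 w - phi p.1 w) ^+ 2)%:E)%E].
  move=> n; apply: contrapT => hn; apply: no; exists n.+1%:R^-1; first by rewrite invr_gt0.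
  move=> s t sT tT st; rewrite leNgt; apply/negP => /ltW lt; apply: hn.
  by exists (s, t).
pose f n w := ((phi (st n).2 w - phi (st n).1 w) ^+ 2)%:E.
have mf n : measurable_fun setT (f n).
  apply/measurable_EFinP; apply: measurable_funX; have [h1 h2 _ _] := hst n.
  by apply: measurable_funB; exact: mphi.
have ig : P.-integrable setT (fun w => 4%:E * (G w ^+ 2)%:E)%E.
  apply: integrableZl => //; apply/integrableP; split.
    by apply/measurable_EFinP; exact: measurable_funX.
  by under eq_integral do rewrite gee0_abs ?lee_fin ?sqr_ge0//.
have c1 : {ae P, forall w, [set: Om] w -> f n w @[n --> \oo] --> 0%E}.
  apply: filterS hphi => w [uc _] _.
  apply/cvg_EFin; first exact: nearW.
  apply/cvgrPdist_lt => r r0.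
  have r1 : 0 < Num.min r 1 by rewrite lt_min r0 ltr01.
  have [de de0 hd] := uc _ r1.
  have /cvgrPdist_lt/(_ _ de0) := @cvg_harmonic R; apply: filterS => n /=.
  rewrite sub0r normrN ger0_norm ?invr_ge0// => hn; have [h1 h2 h3 _] := hst n.
  have := hd _ _ h1 h2 (lt_trans h3 hn); rewrite lt_min => /andP[x1 x2].
  rewrite sub0r normrN normrX; apply: le_lt_trans x1.
  by rewrite expr2 ler_piMl// ltW.
have c2 : {ae P, forall w, forall n, [set: Om] w -> (`|f n w| <= 4%:E * (G w ^+ 2)%:E)%E}.
  apply: filterS hphi => w [_ gb] n _; have [h1 h2 _ _] := hst n.
  rewrite gee0_abs; last by rewrite lee_fin sqr_ge0.
  change (((phi (st n).2 w - phi (st n).1 w) ^+ 2)%:E <= (4 * G w ^+ 2)%:E)%E.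
  rewrite lee_fin -[leLHS]real_normK ?num_real//.
  have -> : 4 * G w ^+ 2 = (G w + G w) ^+ 2 by ring.
  have gw : 0 <= G w by apply: le_trans (gb _ h1).
  rewrite lerXn2r ?nnegrE ?addr_ge0//; apply: le_trans (ler_normB _ _) _.
  by rewrite lerD// gb.
have [_ _] := dominated_convergence measurableT mf (measurable_cst 0%E) c1 ig c2.
rewrite integral0 => fc.
have : (e%:E <= limn (fun n => \int[P]_w f n w))%E.
  apply: lime_ge; first by apply/cvg_ex; exists 0%E.
  by apply: nearW => n; have [] := hst n.
by rewrite (cvg_lim _ fc)// lee_fin leNgt e0.
Qed.

(** A centered normal law is determined by its second moment, so that f and - f
    have the same law. *)
Lemma symmetric_law_mean0 (f : Om -> R) (v v' : R) : measurable_fun setT f ->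
  0 <= v -> 0 <= v' -> has_law_N0 P f v -> has_law_N0 P (fun w => - f w) v' ->
  ('E_P[f] = 0)%E.
Proof.
move=> mf v0 v0' fv fv'.
have mN : measurable_fun setT (fun w => - f w) by exact: measurableT_comp.
have vv : v' = v.
  apply: EFin_inj; rewrite -(law_second_moment mf v0 fv) -(law_second_moment mN v0' fv').
  by apply: eq_integral => w _; rewrite sqrrN.
have fL : f \in Lfun P 2%:E.
  by apply: square_integrable_Lfun => //; rewrite (law_second_moment mf v0 fv) ltry.
have fi : P.-integrable setT (EFin \o f).
  by apply/Lfun1_integrable; exact: (Lfun_subset12 (fin_num_measure P _ measurableT) fL).
pose g (x : R) : \bar R := (Num.max x 0)%:E.
have mg : measurable_fun [set: R] g.
  by apply/measurable_EFinP; apply: measurable_maxr.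
have g0 x : (0 <= g x)%E by rewrite lee_fin le_max lexx orbT.
have pE : (\int[P]_w ((EFin \o f) ^\+ w) = \int[P]_w g (f w))%E.
  by apply: eq_integral => w _; rewrite funeposE /g EFin_max.
have nE : (\int[P]_w ((EFin \o f) ^\- w) = \int[P]_w g (- f w)%R)%E.
  by apply: eq_integral => w _; rewrite funenegE /g EFin_max.
rewrite unlock integralE nE pE (ge0_integral_law mN fv' mg g0) vv.
rewrite -(ge0_integral_law mf fv mg g0) -pE subee//.
exact: integrable_pos_fin_num.
Qed.

Section fractional.
Variables (T H : R) (G : R -> {RV P >-> R}).
Hypotheses (T0 : 0 <= T) (H0 : 0 < H) (hG : fractional_brownian_motion T H G).

Let mG t : measurable_fun setT (G t). Proof. exact: measurable_funPT. Qed.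

Let lin2 x y s t : 0 <= s <= T -> 0 <= t <= T ->
  exists2 v, 0 <= v & has_law_N0 P (fun w => x * G s w + y * G t w) v.
Proof.
move=> sT tT; have [cg _ _] := hG.
have [i|v v0 hv] := cg 2%N (fun i => if i == ord0 then x else y) (fun i => if i == ord0 then s else t).
  by case: ifP.
exists v => //; move: hv; congr (has_law_N0 P _ v).
by apply/funext => w; rewrite !big_ord_recl big_ord0 /= addr0.
Qed.

Let mean0 x y s t : 0 <= s <= T -> 0 <= t <= T ->
  ('E_P[fun w => (x * G s w + y * G t w)%R] = 0)%E.
Proof.
move=> sT tT; have [v v0 hv] := lin2 x y sT tT; have [v' v0' hv'] := lin2 (- x) (- y) sT tT.
have m : measurable_fun setT (fun w => x * G s w + y * G t w).
  by apply: measurable_funD; exact: measurable_funM.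
apply: (symmetric_law_mean0 m v0 v0' hv).
move: hv'; congr (has_law_N0 P _ v'); apply/funext => w; ring.
Qed.

Let G_L2 t : 0 <= t <= T -> (G t : Om -> R) \in Lfun P 2%:E.
Proof.
move=> tT; have [v v0 hv] := lin2 1 0 tT tT; apply: square_integrable_Lfun => //.
have m : measurable_fun setT (fun w => 1 * G t w + 0 * G t w).
  by apply: measurable_funD; exact: measurable_funM.
have := law_second_moment m v0 hv; under eq_integral do rewrite mul1r mul0r addr0.
by move=> ->; rewrite ltry.
Qed.

(** As increments have mean 0, their variance can be read off the covariance. *)
Lemma fbm_incr_law s t : 0 <= s <= T -> 0 <= t <= T ->
  has_law_N0 P (fun w => G t w - G s w) (`|t - s| `^ (2 * H)).
Proof.
move=> sT tT; have [v v0 hv] := lin2 (-1) 1 sT tT.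
have fE : (fun w => -1 * G s w + 1 * G t w) = (G t : Om -> R) \- G s.
  by apply/funext => w /=; ring.
have m0 := mean0 (-1) 1 sT tT; rewrite fE in hv m0.
have mD : measurable_fun setT ((G t : Om -> R) \- G s) by exact: measurable_funB.
have v2 := law_second_moment mD v0 hv.
have DL : (G t : Om -> R) \- G s \in Lfun P 2%:E.
  by apply: square_integrable_Lfun => //; rewrite v2 ltry.
suff -> : `|t - s| `^ (2 * H) = v by [].
have [_ hc _] := hG.
have H2 : 2 * H != 0 by rewrite gt_eqF// mulr_gt0.
have VE : 'V_P[(G t : Om -> R) \- G s] = v%:E.
  by rewrite varianceE// m0 -v2 expe2 mule0 sube0 unlock.
have := varianceB (G_L2 tT) (G_L2 sT).
have vt : 'V_P[G t] = _ := hc t t tT tT; have vs : 'V_P[G s] = _ := hc s s sT sT.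
rewrite VE vt vs hc// !subrr normr0 powR0// => h.
change (v%:E = ((t `^ (2 * H) + t `^ (2 * H) - 0) / 2 + (s `^ (2 * H) + s `^ (2 * H) - 0) / 2
  - 2 * ((s `^ (2 * H) + t `^ (2 * H) - `|s - t| `^ (2 * H)) / 2))%:E) in h.
case: h => ->; rewrite distrC.
by field.
Qed.

Lemma fbm0_ae : {ae P, forall w, G 0 w = 0}.
Proof.
have z : 0 <= (0 : R) <= T by rewrite lexx.
have [v v0 hv] := lin2 1 0 z z.
have fE : (fun w => 1 * G 0 w + 0 * G 0 w) = G 0 by apply/funext => w; ring.
have m0 := mean0 1 0 z z; rewrite fE in hv m0.
apply: (law_dirac_ae (mG 0) hv); apply: EFin_inj.
rewrite -(law_second_moment (mG 0) v0 hv); have [_ hc _] := hG.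
have H2 : 2 * H != 0 by rewrite gt_eqF// mulr_gt0.
have := varianceE (G_L2 z); have vz : 'V_P[G 0] = _ := hc 0 0 z z; rewrite m0 expe2 mule0 sube0 vz.
rewrite subrr normr0 powR0// !addr0 subr0 mul0r => ->.
by rewrite unlock.
Qed.

End fractional.
End moments.

(** * Random bounds on the paths *)

Section random_bounds.
Context {R : realType} d (Om : measurableType d) (P : probability Om R).

Lemma integral_exprn_lty (G : Om -> R) j k : measurable_fun setT G -> (forall w, 1 <= G w) ->
  (j <= k)%N -> (\int[P]_w (G w ^+ k)%:E < +oo)%E -> (\int[P]_w (G w ^+ j)%:E < +oo)%E.
Proof.
move=> mG G1 jk; apply: le_lt_trans; apply: ge0_le_integral => //.
- by move=> w _; rewrite lee_fin exprn_ge0// (le_trans ler01).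
- by apply/measurable_EFinP; exact: measurable_funX.
- by apply/measurable_EFinP; exact: measurable_funX.
- by move=> w _; rewrite lee_fin ler_weXn2l.
Qed.

Lemma exprn_add3_le (x y : R) k : 0 <= x -> 0 <= y ->
  (1 + x + y) ^+ k <= 3 ^+ k * (1 + x ^+ k + y ^+ k).
Proof.
move=> x0 y0; pose M := Num.max 1 (Num.max x y).
have M0 : 0 <= M by rewrite le_max ler01.
have h1 : 1 <= M by rewrite le_max lexx.
have h2 : x <= M by rewrite !le_max lexx orbT.
have h3 : y <= M by rewrite !le_max lexx !orbT.
have xk : 0 <= x ^+ k by exact: exprn_ge0.
have yk : 0 <= y ^+ k by exact: exprn_ge0.
apply: (@le_trans _ _ ((3 * M) ^+ k)).
  by apply: lerXn2r; rewrite ?nnegrE ?addr_ge0 ?mulr_ge0//; lra.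
rewrite exprMn ler_wpM2l ?exprn_ge0//.
have [->|[->|->]] : M = 1 \/ M = x \/ M = y.
- by rewrite /M; case: (leP x y) => _; [case: (leP 1 y)|case: (leP 1 x)] => _; auto.
- by rewrite expr1n; lra.
- lra.
- lra.
Qed.

End random_bounds.

Section random_paths.
Context {R : realType} d (Om : measurableType d) (P : probability Om R).
Variables (T kappa theta nu1 nu2 H c p Y0 : R) (B BH Y : R -> {RV P >-> R}).
Hypotheses (T0 : 0 < T) (k0 : 0 < kappa) (th0 : 0 < theta) (c0 : 0 < c) (p2 : 2 < p)
  (nu10 : 0 < nu1) (nu20 : 0 < nu2) (H1 : H < 1) (H2 : 1 / 2 < H)
  (hB : wiener_process T B) (hBH : fractional_brownian_motion T H BH).
Local Notation bd := (rdrift kappa theta c (p - 1)).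
Hypothesis hY : {ae P, forall w, intble T (bd \o (Y ^~ w)) /\ forall t, 0 <= t <= T ->
  0 < Y t w /\ Y t w = Y0 + prim (bd \o (Y ^~ w)) t + (nu1 * B t w + nu2 * BH t w)}.

(** The exponents a = 1/2 - ep and b = 1/2 + 2 ep = H - ep are below the critical
    exponents 1/2 and H of the two processes, and a + b = 1 + ep. *)
Let ep := (H - 1 / 2) / 3.
Let ep0 : 0 < ep. Proof. by rewrite divr_gt0// subr_gt0. Qed.
Let a := 1 / 2 - ep.
Let b := 1 / 2 + 2 * ep.
Let a0 : 0 < a. Proof. by rewrite /a /ep; have := H1; lra. Qed.
Let b0 : 0 < b. Proof. by rewrite /b addr_gt0// mulr_gt0. Qed.

Lemma wiener_holder m : 1 < (2 * m)%:R * ep -> exists K : Om -> R,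
  [/\ measurable_fun setT K, (forall w, 0 <= K w), (\int[P]_w (K w ^+ (2 * m))%:E < +oo)%E &
    {ae P, forall w, holder_on T a (K w) (B ^~ w)}].
Proof.
move=> hm; have [_ hl _ hc] := hB.
apply: (@kolmogorov_holder _ _ _ P T T0 (fun t => B t) (1 / 2) a (gauss_cst m) m) => //.
- by apply: filterS hc => w; exact: within_unif_cont.
- exact: gauss_cst_ge0.
- by rewrite /a; move: hm; lra.
- move=> s t s0 st tT; have mD : measurable_fun setT (fun w => B t w - B s w) by exact: measurable_funB.
  have ts : 0 <= t - s by rewrite subr_ge0.
  apply: le_trans (law_moment_le mD ts (hl s t s0 st tT) m) _.
  rewrite (_ : 1 / 2 * (2 * m)%:R = m%:R); last by rewrite natrM; field.
  by rewrite powR_mulrn.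
Qed.

Lemma fbm_holder m : 1 < (2 * m)%:R * ep -> exists K : Om -> R,
  [/\ measurable_fun setT K, (forall w, 0 <= K w), (\int[P]_w (K w ^+ (2 * m))%:E < +oo)%E &
    {ae P, forall w, holder_on T b (K w) (BH ^~ w)}].
Proof.
move=> hm; have [_ _ hc] := hBH.
apply: (@kolmogorov_holder _ _ _ P T T0 (fun t => BH t) H b (gauss_cst m) m) => //.
- by apply: filterS hc => w; exact: within_unif_cont.
- exact: gauss_cst_ge0.
- have bH : b = H - ep by rewrite /b /ep; field.
  by rewrite bH; move: hm; lra.
- move=> s t s0 st tT; have mD : measurable_fun setT (fun w => BH t w - BH s w) by exact: measurable_funB.
  have H0 : 0 < H by apply: lt_trans H2; rewrite divr_gt0.
  have sT : 0 <= s <= T by rewrite s0 (le_trans st).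
  have tT' : 0 <= t <= T by rewrite tT (le_trans s0).
  have hl := fbm_incr_law H0 hBH sT tT'.
  apply: le_trans (law_moment_le mD (powR_ge0 _ _) hl m) _.
  rewrite ger0_norm ?subr_ge0// -powR_mulrn ?powR_ge0// -powRrM lee_fin.
  by rewrite (_ : 2 * H * m%:R = H * (2 * m)%:R)// natrM; ring.
Qed.

(** The bound is linear in the Hölder constants of the two processes, and these
    have moments of arbitrary order. *)
Lemma tame_path_ae k : exists G : Om -> R, exists A : set Om,
  [/\ measurable_fun setT G, (forall w, 1 <= G w), (\int[P]_w (G w ^+ k)%:E < +oo)%E,
      measurable A /\ P (~` A) = 0%E &
      forall w, A w -> tame_path T kappa theta c p nu1 nu2 Y0 a b (G w) (B ^~ w) (BH ^~ w) (Y ^~ w)].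
Proof.
pose m := (k + (Num.truncn ep^-1).+1)%N.
have hm : 1 < (2 * m)%:R * ep.
  rewrite -ltr_pdivrMr// div1r; apply: lt_le_trans (truncnS_gt _) _.
  by rewrite ler_nat mul2n -addnn /m; apply: leq_trans (leq_addr _ _); rewrite leq_addl.
have [KB [mKB KB0 iKB hKB]] := wiener_holder hm.
have [KH [mKH KH0 iKH hKH]] := fbm_holder hm.
have ab : a < b by rewrite /a /b; have := ep0; lra.
have b1 : b < 1 by rewrite /b /ep; have := H1; lra.
have ab1 : 1 < a + b by rewrite /a /b; have := ep0; lra.
have [C C1 hC] := tame_path_exists Y0 T0 k0 th0 c0 p2 nu10 nu20 a0 ab.
pose Ga w := 1 + KB w + KH w.
have Ga1 w : 1 <= Ga w by rewrite /Ga -addrA lerDl addr_ge0.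
have mGa : measurable_fun setT Ga.
  by apply: measurable_funD => //; apply: measurable_funD.
have C0 : 0 <= C by apply: le_trans C1.
have iGa : (\int[P]_w (Ga w ^+ (2 * m))%:E < +oo)%E.
  apply: (@le_lt_trans _ _ (\int[P]_w ((3 ^+ (2 * m))%:E *
     ((1 + (KB w ^+ (2 * m))%:E) + (KH w ^+ (2 * m))%:E)))%E).
    apply: le_integral_nonneg => w _; first by rewrite lee_fin exprn_ge0// (le_trans ler01).
    change ((Ga w ^+ (2 * m))%:E <= (3 ^+ (2 * m) * (1 + KB w ^+ (2 * m) + KH w ^+ (2 * m)))%:E)%E.
    by rewrite lee_fin exprn_add3_le.
  have mX (f : Om -> R) : measurable_fun setT f -> measurable_fun setT (fun w => (f w ^+ (2 * m))%:E).
    by move=> mf; apply/measurable_EFinP; exact: measurable_funX.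
  have n1 w : (0 <= 1 + (KB w ^+ (2 * m))%:E)%E.
    by change (0 <= (1 + KB w ^+ (2 * m))%:E)%E; rewrite lee_fin addr_ge0 ?exprn_ge0.
  have n2 w : (0 <= (KH w ^+ (2 * m))%:E)%E by rewrite lee_fin exprn_ge0.
  have m1 : measurable_fun setT (fun w => 1 + (KB w ^+ (2 * m))%:E)%E.
    by apply: emeasurable_funD => //; exact: mX.
  rewrite ge0_integralZl//; first last.
  - by move=> w _; rewrite adde_ge0.
  - by apply: emeasurable_funD => //; exact: mX.
  rewrite lte_mul_pinfty//.
  rewrite ge0_integralD//; last exact: mX.
  rewrite ge0_integralD//; [|by move=> w _; rewrite lee_fin exprn_ge0|exact: mX].
  have P1 : (\int[P]_w (1 : \bar R) = 1)%E by rewrite integral_cst//= probability_setT mule1.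
  rewrite P1; apply: lte_add_pinfty => //; apply: lte_add_pinfty => //; exact: (ltry 1).
have ae_tame : {ae P, forall w, tame_path T kappa theta c p nu1 nu2 Y0 a b (C * Ga w)
    (B ^~ w) (BH ^~ w) (Y ^~ w)}.
  have [B00 _ _ _] := hB.
  have H0 : 0 < H by apply: lt_trans H2; rewrite divr_gt0.
  have BH00 := fbm0_ae (ltW T0) H0 hBH.
  have h1 : {ae P, forall w, [/\ holder_on T a (KB w) (B ^~ w), holder_on T b (KH w) (BH ^~ w),
     B 0 w = 0 & BH 0 w = 0]}.
    have h2 : {ae P, forall w, B 0 w = 0 /\ BH 0 w = 0} by apply: filterS2 B00 BH00.
    by apply: filterS3 hKB hKH h2 => w u1 u2 [].
  apply: filterS2 h1 hY => w [u1 u2 u3 u4] [bi hy].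
  have v1 : holder_on T a (Ga w) (B ^~ w).
    move=> s t s0 st tT; apply: le_trans (u1 s t s0 st tT) _.
    by rewrite ler_wpM2r ?powR_ge0// /Ga addrAC lerDr addr_ge0.
  have v2 : holder_on T b (Ga w) (BH ^~ w).
    move=> s t s0 st tT; apply: le_trans (u2 s t s0 st tT) _.
    by rewrite ler_wpM2r ?powR_ge0// /Ga lerDr addr_ge0.
  have G0 : 0 <= Ga w by apply: le_trans (Ga1 w).
  apply: hC => //; split => //.
  - apply: unif_contD; apply: unif_contZ; [exact: (holder_unif_cont a0 G0)|exact: (holder_unif_cont b0 G0)].
  - by move=> t tT; have [] := hy t tT.
  - by move=> t tT; have [] := hy t tT.
have [A [mA PA sA]] := ae_tame.
exists (fun w => C * Ga w), (~` A); split.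
- exact: measurable_funM.
- by move=> w; rewrite -[leLHS](mulr1 1); apply: ler_pM.
- apply: (@integral_exprn_lty _ _ _ P _ k (2 * m)%N).
  + exact: measurable_funM.
  + by move=> w; rewrite -[leLHS](mulr1 1); apply: ler_pM.
  + by rewrite mul2n -addnn /m -addnA leq_addr.
  under eq_integral do rewrite exprMn EFinM.
  rewrite ge0_integralZl//.
  + by rewrite lte_mul_pinfty// lee_fin exprn_ge0.
  + by apply/measurable_EFinP; exact: measurable_funX.
  + by move=> w _; rewrite lee_fin exprn_ge0// (le_trans ler01).
  + by rewrite lee_fin exprn_ge0.
- by split; [exact: measurableC|rewrite setCK].
- by move=> w Aw; apply: contrapT => h; apply: Aw; apply: sA.
Qed.

End random_paths.

(** * The integrals as random variables *)

Section assembly.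
Context {R : realType} d (Om : measurableType d) (P : probability Om R).
Variables (T kappa theta nu1 nu2 c p Y0 a b : R) (B BH Y : R -> {RV P >-> R})
  (G : Om -> R) (A : set Om).
Hypotheses (T0 : 0 < T) (k0 : 0 < kappa) (th0 : 0 < theta) (c0 : 0 < c) (p2 : 2 < p)
  (nu10 : 0 < nu1) (nu20 : 0 < nu2) (a0 : 0 < a) (ab : a < b) (b1 : b < 1) (ab1 : 1 < a + b)
  (b12 : 1 < 2 * b) (cE : c = (p - 1) * nu1 ^+ 2 / 2).
Hypothesis hB : wiener_process T B.
Local Notation N := (tame_deg p).
Local Notation bd := (rdrift kappa theta c (p - 1)).
Hypotheses (mG : measurable_fun setT G) (G1 : forall w, 1 <= G w)
  (iG : (\int[P]_w (G w ^+ (8 * (2 * N + 3)))%:E < +oo)%E)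
  (mA : measurable A) (PA : P (~` A) = 0%E).
Hypothesis tame : forall w, A w ->
  tame_path T kappa theta c p nu1 nu2 Y0 a b (G w) (B ^~ w) (BH ^~ w) (Y ^~ w).

Let phi t w := Y t w `^ (p - 1).
Let J0 t w := young_int T (fun s => Y s w `^ (p - 1)) (BH ^~ w) t.
Let pr t w := prim (fun s => p * kappa - p * theta * Y s w `^ p) t.
Let I0 t w := (Y t w `^ p - Y 0 w `^ p - pr t w - nu2 * p * J0 t w) / (nu1 * p).

(** The integrals are defined pathwise on A; the cut-off makes them random
    variables at all times. *)
Definition cut_off (F : R -> Om -> R) t w := if 0 <= t <= T then F t w * \1_A w else 0.
Local Notation J := (cut_off J0).
Local Notation I := (cut_off I0).

Lemma cut_offE F t w : 0 <= t <= T -> A w -> cut_off F t w = F t w.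
Proof. by move=> tT Aw; rewrite /cut_off tT indicE mem_set// mulr1. Qed.

Lemma ae_of_A (Q : Om -> Prop) : (forall w, A w -> Q w) -> {ae P, forall w, Q w}.
Proof.
move=> h; exists (~` A); split => //; first exact: measurableC.
by move=> w /= nQ Aw; apply: nQ; exact: h.
Qed.

Lemma measurable_lim_indic (f : nat -> Om -> R) (g : Om -> R) :
  (forall n, measurable_fun setT (f n)) ->
  (forall w, A w -> f n w @[n --> \oo] --> g w) ->
  measurable_fun setT (fun w => g w * \1_A w).
Proof.
move=> mf fg; apply: (@measurable_fun_cvg _ _ _ _ (fun n w => f n w * \1_A w)).
  by move=> n; apply: measurable_funM => //; exact: measurable_indic.
move=> w _; rewrite indicE; have [Aw|Aw] := boolP (w \in A).
  by rewrite mulr1; under eq_fun do rewrite mulr1; apply: fg; exact: set_mem.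
by rewrite mulr0; under eq_fun do rewrite mulr0; exact: cvg_cst.
Qed.

Let mY t r : measurable_fun setT (fun w => Y t w `^ r).
Proof. exact: (measurableT_comp (measurable_powR r) (measurable_funPT (Y t))). Qed.

Let mincr (F : R -> {RV P >-> R}) t n k : measurable_fun setT (fun w => grid_incr T t (F ^~ w) n k).
Proof. by apply: measurable_funB; exact: measurable_funPT. Qed.

Let mJ t : measurable_fun setT (J t).
Proof.
have [tT|tT] := boolP (0 <= t <= T); last by rewrite /cut_off (negbTE tT); exact: measurable_cst.
rewrite /cut_off tT.
apply: (measurable_lim_indic (f := fun n w => \sum_(0 <= k < 2 ^ n)
  Y (dyadic T n k) w `^ (p - 1) * grid_incr T t (BH ^~ w) n k)).
  by move=> n; apply: measurable_sum => k; apply: measurable_funM.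
by move=> w Aw; exact: (tame_young_cvg T0 p2 nu10 nu20 a0 ab ab1 (tame Aw) tT).
Qed.

Let pr_unif_cont w : A w -> unif_cont T (fun s => p * kappa - p * theta * Y s w `^ p).
Proof.
move=> Aw; apply: unif_contB; first exact: unif_cont_cst.
by apply: unif_contZ; exact: (tame_powR_cont T0 (tame Aw)).
Qed.

Let mpr t : 0 <= t <= T -> measurable_fun setT (fun w => pr t w * \1_A w).
Proof.
move=> tT; apply: (measurable_lim_indic (f := fun n w => \sum_(0 <= k < 2 ^ n)
  (p * kappa - p * theta * Y (dyadic T n k) w `^ p) * (stopped T t n k.+1 - stopped T t n k))).
  move=> n; apply: measurable_sum => k; apply: measurable_funM => //.
  by apply: measurable_funB => //; apply: measurable_funM.
move=> w Aw; apply: (weighted_sum_cvg T0 (a := fun n k => stopped T t n k.+1 - stopped T t n k)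
   (w := fun s => p * kappa - p * theta * Y s w `^ p)) => //.
- by move=> n k; rewrite subr_ge0; exact: stopped_le.
- exact: pr_unif_cont.
move=> m j jm; have t0 : 0 <= t by case/andP : tT.
under eq_fun do rewrite telescope_sumr// stopped0// subr0.
by under eq_fun do rewrite /stopped dyadic_refine; exact: cvg_cst.
Qed.

Let mI t : measurable_fun setT (I t).
Proof.
have [tT|tT] := boolP (0 <= t <= T); last by rewrite /cut_off (negbTE tT); exact: measurable_cst.
have -> : I t = fun w => ((Y t w `^ p - Y 0 w `^ p) * \1_A w - pr t w * \1_A w
    - nu2 * p * J t w) * (nu1 * p)^-1.
  by apply/funext => w; rewrite /cut_off tT /I0; ring.
apply: measurable_funM => //; apply: measurable_funB; last by apply: measurable_funM => //; exact: (mJ t).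
apply: measurable_funB; last exact: mpr.
by apply: measurable_funM; [exact: measurable_funB|exact: measurable_indic].
Qed.

Let JRV t : {RV P >-> R} := mfun_Sub (mem_set (mJ t)).
Let IRV t : {RV P >-> R} := mfun_Sub (mem_set (mI t)).

Let iGk k : (k <= 8 * (2 * N + 3))%N -> (\int[P]_w (G w ^+ k)%:E < +oo)%E.
Proof. by move=> kN; exact: (integral_exprn_lty mG G1 kN iG). Qed.

Let G0 w : 0 <= G w. Proof. exact: le_trans ler01 (G1 w). Qed.

Let mGk k : measurable_fun setT (fun w => (G w ^+ k)%:E).
Proof. by apply/measurable_EFinP; exact: measurable_funX. Qed.

Let L2_le (f : Om -> R) K k : measurable_fun setT f -> (2 * k <= 8 * (2 * N + 3))%N -> 0 <= K ->
  (forall w, A w -> `|f w| <= K * G w ^+ k) ->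
  (\int[P]_w (f w ^+ 2)%:E <= (K ^+ 2)%:E * \int[P]_w (G w ^+ (2 * k))%:E)%E.
Proof.
move=> mf kN K0 h; rewrite -ge0_integralZl//; first last.
- by rewrite lee_fin sqr_ge0.
- by move=> w _; rewrite lee_fin exprn_ge0.
apply: ae_ge0_le_integral => //.
- by move=> w _; rewrite lee_fin sqr_ge0.
- by apply/measurable_EFinP; exact: measurable_funX.
- by move=> w _; rewrite mule_ge0// lee_fin ?sqr_ge0 ?exprn_ge0.
- exact: measurable_funeM.
apply: ae_of_A => w Aw _; rewrite -EFinM lee_fin.
rewrite mulnC exprM -exprMn -(real_normK (num_real (f w))).
by apply: lerXn2r; rewrite ?nnegrE ?mulr_ge0 ?exprn_ge0//; exact: h.
Qed.

Let g0 : 0 < a + b - 1. Proof. by rewrite subr_gt0. Qed.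

(** The pathwise rate of convergence has a random factor with finite moments, so
    that it is a rate in L^2. *)
Lemma J_riemann_stieltjes t : 0 <= t <= T ->
  is_L2_riemann_stieltjes_integral phi BH t (JRV t).
Proof.
move=> tT; have t0 : 0 <= t by case/andP : tT.
have kN : (2 * N.+3 <= 8 * (2 * N + 3))%N by rewrite -addn3; move: (tame_deg p); clear; lia.
pose CJ := Num.max 0 (young_cst T p nu1 nu2 a b * T `^ (a + b - 1) + T `^ b).
pose Ky := Num.max 0 (young_cst T p nu1 nu2 a b).
have MG := iGk kN.
have MG0 : (0 <= \int[P]_w (G w ^+ (2 * N.+3))%:E)%E by apply: integral_ge0 => w _; rewrite lee_fin exprn_ge0.
have MGE : (\int[P]_w (G w ^+ (2 * N.+3))%:E = (fine (\int[P]_w (G w ^+ (2 * N.+3))%:E))%:E)%E.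
  by rewrite fineK// ge0_fin_numE.
set M := fine _ in MGE; have M0 : 0 <= M by exact: fine_ge0.
split.
  apply: square_integrable_Lfun; first exact: mJ.
  apply: (@le_lt_trans _ _ ((CJ ^+ 2)%:E * \int[P]_w (G w ^+ (2 * N.+3))%:E)%E); last first.
    by rewrite MGE -EFinM ltry.
  apply: (L2_le (mJ t) kN); first by rewrite le_max lexx.
  move=> w Aw; rewrite (cut_offE _ tT Aw).
  apply: le_trans (tame_young_le T0 p2 nu10 nu20 a0 ab b1 ab1 (tame Aw) tT) _.
  by rewrite ler_wpM2r ?exprn_ge0// le_max lexx orbT.
move=> eps eps0.
have Ky0 : 0 <= Ky by rewrite le_max lexx.
pose e1 := Num.min 1 (eps / (2 * (Ky ^+ 2 * M + 1))).
have KM : 0 <= Ky ^+ 2 * M by rewrite mulr_ge0 ?sqr_ge0.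
have KM1 : 0 < Ky ^+ 2 * M + 1 by rewrite ltr_wpDl.
have e10 : 0 < e1 by rewrite lt_min ltr01 divr_gt0// mulr_gt0.
pose D := Num.min T (e1 `^ (a + b - 1)^-1).
have D0 : 0 < D by rewrite lt_min T0 powR_gt0.
have De : D `^ (a + b - 1) <= e1.
  have -> : e1 = (e1 `^ (a + b - 1)^-1) `^ (a + b - 1).
    by rewrite -powRrM mulVf ?gt_eqF// powRr1// ltW.
  by rewrite ge0_ler_powR ?nnegrE ?(ltW D0) ?powR_ge0 ?(ltW g0)// ge_min lexx orbT.
exists D => // grid [pg /eqP lg] mesh.
have pl : path <=%R 0 grid by apply: sub_path pg => x y /ltW.
have ml : mesh_le D 0 grid.
  apply/(pathP 0) => i ig; have := mesh i ig.
  by rewrite /right_node /left_node => /ltW.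
have DT : 0 <= D <= T by rewrite (ltW D0) ge_min lexx.
have RSE w : riemann_stieltjes_sum phi BH grid w = left_sum (phi ^~ w) (BH ^~ w) 0 grid.
  by rewrite left_sum_sumE.
have mRS : measurable_fun setT (riemann_stieltjes_sum phi BH grid).
  rewrite /riemann_stieltjes_sum; apply: measurable_sum => k; apply: measurable_funM; first exact: mY.
  by apply: measurable_funB; exact: measurable_funPT.
have h := @L2_le (fun w => riemann_stieltjes_sum phi BH grid w - JRV t w) (Ky * e1) N.+3
  (measurable_funB mRS (mJ t)) kN (mulr_ge0 Ky0 (ltW e10)) _.
rewrite /sq_dist unlock; apply: le_lt_trans (h _) _.
  move=> w Aw; rewrite RSE [JRV t w](cut_offE _ tT Aw).
  apply: le_trans (tame_riemann_dist T0 p2 nu10 nu20 a0 ab b1 ab1 (tame Aw) tT DT pl lg ml) _.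
  rewrite mulrAC; apply: ler_wpM2r; first exact: exprn_ge0.
  apply: (@le_trans _ _ (Ky * D `^ (a + b - 1))); last by rewrite ler_wpM2l.
  by rewrite ler_wpM2r ?powR_ge0// le_max lexx orbT.
rewrite MGE -EFinM lte_fin.
have e11 : e1 <= 1 by rewrite ge_min lexx.
apply: (@le_lt_trans _ _ (Ky ^+ 2 * M * e1)).
  rewrite exprMn mulrAC; apply: ler_wpM2l => //.
  by rewrite expr2 ler_piMl// ltW.
apply: (@le_lt_trans _ _ ((Ky ^+ 2 * M + 1) * (eps / (2 * (Ky ^+ 2 * M + 1))))).
  by apply: ler_pM => //; [exact: ltW|rewrite lerDl|rewrite ge_min lexx orbT].
have -> : (Ky ^+ 2 * M + 1) * (eps / (2 * (Ky ^+ 2 * M + 1))) = eps / 2.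
  by field; rewrite gt_eqF.
by rewrite ltr_pdivrMr// ltr_pMr// ltr1n.
Qed.

Lemma I_continuous : continuous_paths P T (fun t => IRV t).
Proof.
apply: ae_of_A => w Aw; apply: unif_cont_within.
have h : unif_cont T (fun t => I0 t w).
  have -> : (fun t => I0 t w) = fun t => (nu1 * p)^-1 *
      (Y t w `^ p - Y 0 w `^ p - pr t w - nu2 * p * J0 t w).
    by apply/funext => t; rewrite mulrC.
  apply: unif_contZ; apply: unif_contB; last first.
    by apply: unif_contZ; exact: (tame_young_cont T0 p2 nu10 nu20 a0 ab ab1 (tame Aw)).
  apply: unif_contB; last by apply: prim_cont; [exact: ltW|apply: intble_cont; exact: pr_unif_cont].
  apply: unif_contB; [exact: (tame_powR_cont T0 (tame Aw))|exact: unif_cont_cst].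
move=> e /h[de de0 hd]; exists de => // s t sT tT st.
by rewrite [IRV t w](cut_offE _ tT Aw) [IRV s w](cut_offE _ sT Aw); exact: hd.
Qed.

Lemma IJ_equation w t : A w -> 0 <= t <= T ->
  Y t w `^ p = Y 0 w `^ p + pr t w + nu1 * p * IRV t w + nu2 * p * JRV t w.
Proof.
move=> Aw tT; rewrite [IRV t w](cut_offE _ tT Aw) [JRV t w](cut_offE _ tT Aw) /I0.
by field; rewrite !gt_eqF// (lt_trans _ p2).
Qed.

Let hsol : {ae P, forall w, sol_path T bd Y0 (Y ^~ w) (fun t => nu1 * B t w + nu2 * BH t w)}.
Proof. by apply: ae_of_A => w /tame[]. Qed.

Let q1 : 1 < p - 1. Proof. by rewrite ltrBrDr. Qed.

Lemma dyadic_left_node n k : (k < 2 ^ n)%N ->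
  left_node 0 [seq dyadic T n k.+1 | k <- iota 0 (2 ^ n)] k = dyadic T n k.
Proof.
case: k => [|k] kn; first by rewrite /left_node /= dyadic0.
by rewrite /left_node /= (nth_map 0%N) ?size_iota ?nth_iota ?(ltnW kn).
Qed.

Lemma dyadic_right_node n k : (k < 2 ^ n)%N ->
  right_node 0 [seq dyadic T n k.+1 | k <- iota 0 (2 ^ n)] k = dyadic T n k.+1.
Proof. by move=> kn; rewrite /right_node (nth_map 0%N) ?size_iota ?nth_iota. Qed.

Lemma dyadic_cell s n : 0 < s -> s <= T -> exists2 k, (k < 2 ^ n)%N &
  forall i, (dyadic T n i < s <= dyadic T n i.+1) = (i == k).
Proof.
move=> s0 sT; have ex : exists j, s <= dyadic T n j by exists (2 ^ n)%N; rewrite dyadic_last.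
case: (ex_minnP ex) => -[|k] hk mk; first by move: hk; rewrite dyadic0 leNgt s0.
exists k; first by apply: mk; rewrite dyadic_last.
move=> i; apply/idP/eqP => [/andP[h1 h2]|->].
  apply/eqP; have := mk _ h2; rewrite ltnS => ki; rewrite eqn_leq ki andbT leqNgt.
  apply/negP => ki'; have := lt_le_trans h1 (le_trans hk (dyadic_leq n (ltW T0) ki')).
  by rewrite ltxx.
by rewrite hk andbT ltNge; apply/negP => /mk; rewrite ltnn.
Qed.

(** The truncation level 4^n is chosen so that its contribution, summed over
    the 2^n intervals of the grid, tends to 0. *)
Lemma simple_approximation : exists V : nat -> simple_process (joint_filtration B BH) T,
  (forall n, sp_grid (V n) = [seq dyadic T n k.+1 | k <- iota 0 (2 ^ n)]) /\
  (forall n k, (k < 2 ^ n)%N -> measurable_fun setT (sp_coef (V n) k) /\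
    {ae P, forall w, sp_coef (V n) k w = Num.min (phi (dyadic T n k) w) (4 ^+ n)}).
Proof.
have mh n : measurable_fun [set: R] (fun x : R => Num.min (x `^ (p - 1)) (4 ^+ n)).
  by apply: measurable_minr => //; exact: measurable_powR.
have sub_measurable t : joint_filtration B BH t `<=` measurable.
  apply: smallest_sub; first exact: sigma_algebra_measurable.
  move=> X [] [s _ [E mE <-]].
  - have mf : measurable_fun setT (B s) by exact: measurable_funPT.
    by apply: mf.
  - have mf : measurable_fun setT (BH s) by exact: measurable_funPT.
    by apply: mf.
have ex n k : exists f : Om -> R, (k <= 2 ^ n)%N ->
    [/\ forall E : set R, measurable E -> joint_filtration B BH (dyadic T n k) (f @^-1` E),
        measurable_fun setT f, (forall w, 0 <= f w <= 4 ^+ n) &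
        {ae P, forall w, f w = Num.min (phi (dyadic T n k) w) (4 ^+ n)}].
  have [kn|kn] := leqP k (2 ^ n); last by exists (fun=> 0).
  have [Ys [ad ae]] := adapted_version T0 (dyadic_itv T0 kn) k0 th0 c0 q1 hsol.
  exists (fun w => Num.min (Ys w `^ (p - 1)) (4 ^+ n)) => _.
  have ad' E : measurable E -> joint_filtration B BH (dyadic T n k)
      ((fun w => Num.min (Ys w `^ (p - 1)) (4 ^+ n)) @^-1` E).
    move=> mE; apply: (ad ((fun x : R => Num.min (x `^ (p - 1)) (4 ^+ n)) @^-1` E)).
    by rewrite -[X in measurable X]setTI; exact: mh.
  split=> //.
  - move=> _ E mE; rewrite setTI; exact: sub_measurable (ad' E mE).
  - by move=> w; rewrite le_min powR_ge0 exprn_ge0// ge_min lexx orbT.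
  - by apply: filterS ae => w YE; rewrite /phi YE.
pose f n := projT1 (choice (ex n)); have hf n := projT2 (choice (ex n)).
have {}hf n k : (k <= 2 ^ n)%N -> _ := hf n k.
have gp n : itv_partition 0 T [seq dyadic T n k.+1 | k <- iota 0 (2 ^ n)].
  split.
    rewrite -[X in path _ X _](dyadic0 T n); apply: (path_map_iota (f := dyadic T n)) => k kn.
    by rewrite dyadic_lt.
  by rewrite -[X in last X _](dyadic0 T n) (last_map_iota (dyadic T n)) dyadic_last.
have gs n : size [seq dyadic T n k.+1 | k <- iota 0 (2 ^ n)] = (2 ^ n)%N by rewrite size_map size_iota.
have gad n k : (k < size [seq dyadic T n k.+1 | k <- iota 0 (2 ^ n)])%N -> forall E : set R, measurable E ->
    joint_filtration B BH (left_node 0 [seq dyadic T n k.+1 | k <- iota 0 (2 ^ n)] k) (f n k @^-1` E).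
  by rewrite gs => kn E mE; rewrite dyadic_left_node//; have [h _ _ _] := hf n k (ltnW kn); exact: h.
have gb n : exists M : R, forall k w, (k < size [seq dyadic T n k.+1 | k <- iota 0 (2 ^ n)])%N -> `|f n k w| <= M.
  exists (4 ^+ n) => k w; rewrite gs => kn; have [_ _ h _] := hf n k (ltnW kn).
  by have /andP[h1 h2] := h w; rewrite ger0_norm.
exists (fun n => SimpleProcess (gp n) (@gad n) (gb n)); split => // n k kn /=.
by have [_ m _ e] := hf n k (ltnW kn).
Qed.

Lemma truncation_le (x m : R) : 0 <= x -> 0 < m -> 0 <= x - Num.min x m <= x ^+ 2 / m.
Proof.
move=> x0 m0; have [xm|/ltW mx] := leP x m.
  by rewrite subrr lexx divr_ge0 ?sqr_ge0// ltW.
rewrite subr_ge0 mx/= ler_pdivlMr// mulrBl expr2.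
apply: (@le_trans _ _ (x * m)); first by rewrite gerBl mulr_ge0// ltW.
by rewrite ler_wpM2l.
Qed.

Section approximating_sequence.
Variable V : nat -> simple_process (joint_filtration B BH) T.
Hypothesis gV : forall n, sp_grid (V n) = [seq dyadic T n k.+1 | k <- iota 0 (2 ^ n)].
Hypothesis mV : forall n k, (k < 2 ^ n)%N -> measurable_fun setT (sp_coef (V n) k).
Hypothesis aeV : forall n k, (k < 2 ^ n)%N ->
  {ae P, forall w, sp_coef (V n) k w = Num.min (phi (dyadic T n k) w) (4 ^+ n)}.

Lemma sp_valE n k s w : (k < 2 ^ n)%N ->
  (forall i, (dyadic T n i < s <= dyadic T n i.+1) = (i == k)) ->
  sp_val (V n) s w = sp_coef (V n) k w.
Proof.
move=> kn hk; rewrite /sp_val -(big_mkord xpredT (fun i => sp_coef (V n) i w *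
  \1_(`]left_node 0 (sp_grid (V n)) i, right_node 0 (sp_grid (V n)) i]%classic) s)) gV.
have ind i : (i < 2 ^ n)%N -> \1_(`]left_node 0 [seq dyadic T n k.+1 | k <- iota 0 (2 ^ n)] i,
    right_node 0 [seq dyadic T n k.+1 | k <- iota 0 (2 ^ n)] i]%classic) s = (i == k)%:R :> R.
  move=> iln; rewrite indicE dyadic_left_node// dyadic_right_node//; congr (_%:R).
  have E : (`]dyadic T n i, dyadic T n i.+1]%classic) s <-> i == k by rewrite /= in_itv/= hk.
  case: (boolP (i == k)) => ik; first by rewrite mem_set//; exact/E.
  by rewrite memNset// => /E; rewrite (negbTE ik).
rewrite size_map size_iota big_mkord (bigD1 (Ordinal kn))//= ind// eqxx mulr1 big1 ?addr0// => i ik.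
rewrite ind// (negbTE (_ : nat_of_ord i != k)) ?mulr0//.
Qed.

Lemma sp_integralE n t w : sp_integral (V n) (fun s => B s) t w =
  \sum_(0 <= k < 2 ^ n) sp_coef (V n) k w * grid_incr T t (B ^~ w) n k.
Proof.
rewrite /sp_integral -(big_mkord xpredT (fun i => sp_coef (V n) i w *
  (B (Num.min (right_node 0 (sp_grid (V n)) i) t) w - B (Num.min (left_node 0 (sp_grid (V n)) i) t) w))).
rewrite gV size_map size_iota; apply: eq_big_nat => k /andP[_ kn].
by rewrite dyadic_left_node// dyadic_right_node.
Qed.

Let ae_coef : {ae P, forall w, forall n k, (k < 2 ^ n)%N ->
  sp_coef (V n) k w = Num.min (phi (dyadic T n k) w) (4 ^+ n)}.
Proof.
apply: ae_foralln => n; apply: ae_foralln => k.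
have [kn|kn] := ltnP k (2 ^ n); last by apply: aeW.
by apply: filterS (aeV kn) => w h _.
Qed.

Let phi_le w s : A w -> 0 <= s <= T -> 0 <= phi s w <= G w ^+ N.
Proof. by move=> Aw sT; exact: (tame_phi_le p2 (tame Aw) sT). Qed.

Let fin_moment k : (k <= 8 * (2 * N + 3))%N ->
  exists2 M, 0 <= M & (\int[P]_w (G w ^+ k)%:E = M%:E)%E.
Proof.
move=> /iGk h; exists (fine (\int[P]_w (G w ^+ k)%:E)).
  by apply: fine_ge0; apply: integral_ge0 => w _; rewrite lee_fin exprn_ge0.
by rewrite fineK// ge0_fin_numE//; apply: integral_ge0 => w _; rewrite lee_fin exprn_ge0.
Qed.

(** The error consists of the modulus of continuity of Y^(p-1) in L^2 and of the
    part that the truncation cuts off. *)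
Lemma sp_val_sq_dist_le n s (e M : R) : 0 < s -> s <= T ->
  (\int[P]_w (G w ^+ (2 * (2 * N)))%:E = M%:E)%E ->
  (forall s', 0 <= s' <= T -> `|s - s'| <= T / 2 ^+ n ->
    (\int[P]_w ((phi s w - phi s' w) ^+ 2)%:E <= e%:E)%E) ->
  (sq_dist P (phi s) (sp_val (V n) s) <= (2 * e + 2 * M / 2 ^+ n)%:E)%E.
Proof.
move=> s0 sT ME he; have [k kn hk] := dyadic_cell n s0 sT.
have sv : sp_val (V n) s = sp_coef (V n) k by apply/funext => w; exact: sp_valE.
have dT : 0 <= dyadic T n k <= T by apply: dyadic_itv => //; exact: ltnW.
have /andP[ks sk] : dyadic T n k < s <= dyadic T n k.+1 by rewrite hk.
have dist : `|s - dyadic T n k| <= T / 2 ^+ n.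
  by rewrite ger0_norm ?subr_ge0 ?(ltW ks)// -(dyadic_step T n k) lerD2r.
have msq (f g : Om -> R) : measurable_fun setT f -> measurable_fun setT g ->
    measurable_fun setT (fun w => ((f w - g w) ^+ 2)%:E).
  by move=> mf mg; apply/measurable_EFinP; apply: measurable_funX; exact: measurable_funB.
have p4 : 0 < 4 ^+ n :> R by rewrite exprn_gt0.
have Kn0 : 0 <= 2 / (2 ^+ n) :> R by rewrite divr_ge0// exprn_ge0.
rewrite /sq_dist unlock sv.
apply: (@le_trans _ _ (\int[P]_w (2%:E * ((phi s w - phi (dyadic T n k) w) ^+ 2)%:E +
   (2 / 2 ^+ n)%:E * (G w ^+ (2 * (2 * N)))%:E))%E).
  apply: ae_ge0_le_integral => //.
  - by move=> w _; rewrite lee_fin sqr_ge0.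
  - by apply: msq; [exact: mY|exact: mV].
  - by move=> w _; rewrite adde_ge0// mule_ge0// lee_fin ?sqr_ge0 ?exprn_ge0.
  - by apply: emeasurable_funD; apply: measurable_funeM => //; apply: msq; exact: mY.
  have aeA : {ae P, forall w, A w} by exact: ae_of_A.
  apply: filterS2 aeA (aeV kn) => w Aw cE' _.
  change (((phi s w - sp_coef (V n) k w) ^+ 2)%:E <= (2 * (phi s w - phi (dyadic T n k) w) ^+ 2 +
    2 / 2 ^+ n * G w ^+ (2 * (2 * N)))%:E)%E.
  rewrite lee_fin cE'; have /andP[f0 fG] := phi_le Aw dT.
  have /andP[] := truncation_le f0 p4.
  set x := phi (dyadic T n k) w in f0 fG *; set z := Num.min x _; set y := phi s w.
  move=> h1 h2.
  have h3 : (x - z) ^+ 2 <= G w ^+ (2 * (2 * N)) / 2 ^+ n.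
    have x4 : x ^+ 2 <= G w ^+ (2 * N).
      by rewrite mulnC exprM; apply: lerXn2r; rewrite ?nnegrE ?exprn_ge0.
    apply: (@le_trans _ _ ((G w ^+ (2 * N) / 4 ^+ n) ^+ 2)).
      apply: lerXn2r; rewrite ?nnegrE ?divr_ge0 ?exprn_ge0//.
      by apply: le_trans h2 _; rewrite ler_wpM2r// invr_ge0 ltW.
    rewrite expr_div_n -exprM mulnC ler_wpM2l ?exprn_ge0//.
    rewrite lef_pV2 ?posrE ?exprn_gt0// -exprM.
    apply: (@le_trans _ _ (4 ^+ n)); first by apply: lerXn2r; rewrite ?nnegrE// ler_nat.
    by apply: ler_weXn2l; [rewrite ler1n|rewrite leq_pmulr].
  have -> : (y - z) ^+ 2 = 2 * (y - x) ^+ 2 + 2 * (x - z) ^+ 2 - (y - x - (x - z)) ^+ 2 by ring.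
  have := sqr_ge0 (y - x - (x - z)).
  have -> : 2 / 2 ^+ n * G w ^+ (2 * (2 * N)) = 2 * (G w ^+ (2 * (2 * N)) / 2 ^+ n) by ring.
  by move: h3; lra.
rewrite ge0_integralD//; first last.
- exact: measurable_funeM.
- by move=> w _; rewrite mule_ge0// lee_fin exprn_ge0.
- by apply: measurable_funeM; apply: msq; exact: mY.
- by move=> w _; rewrite mule_ge0// lee_fin sqr_ge0.
rewrite ge0_integralZl//; first last.
- by move=> w _; rewrite lee_fin sqr_ge0.
- by apply: msq; exact: mY.
rewrite ge0_integralZl//; last by move=> w _; rewrite lee_fin exprn_ge0.
rewrite ME (_ : 2 * M / 2 ^+ n = 2 / 2 ^+ n * M); last by ring.
apply: (@le_trans _ _ (2%:E * e%:E + (2 / 2 ^+ n)%:E * M%:E)%E); last exact: lexx.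
by rewrite leeD2r// lee_wpmul2l//; exact: he.
Qed.

Lemma sp_val_cvg : (\int[@lebesgue_measure R]_(s in `[0%R, T])
  sq_dist P (phi s) (sp_val (V n) s))%E @[n --> \oo] --> 0%E.
Proof.
have [M M0 ME] : exists2 M, 0 <= M & (\int[P]_w (G w ^+ (2 * (2 * N)))%:E = M%:E)%E.
  by apply: fin_moment; move: (tame_deg p); clear; lia.
have [M2 M20 ME2] : exists2 M, 0 <= M & (\int[P]_w (G w ^+ (2 * N))%:E = M%:E)%E.
  by apply: fin_moment; move: (tame_deg p); clear; lia.
apply: ge0_ecvg0 => [n|eps eps0].
  by apply: integral_ge0 => s _; rewrite /sq_dist unlock; apply: integral_ge0 => w _; rewrite lee_fin sqr_ge0.
pose e := eps / (4 * T); have e0 : 0 < e by rewrite divr_gt0// mulr_gt0.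
have hG : (\int[P]_w ((G w ^+ N) ^+ 2)%:E < +oo)%E.
  by under eq_integral do rewrite -exprM mulnC; rewrite ME2 ltry.
have hae : {ae P, forall w, unif_cont T (phi ^~ w) /\ forall t, 0 <= t <= T -> `|phi t w| <= G w ^+ N}.
  apply: ae_of_A => w Aw; split; first exact: (tame_powR_cont T0 (tame Aw)).
  by move=> t tT; have /andP[h1 h2] := phi_le Aw tT; rewrite ger0_norm.
have [de de0 hde] := L2_modulus (fun t _ => mY t (p - 1)) (measurable_funX _ mG) hG hae e0.
pose K := 2 * M * T + 1.
have K0 : 0 < K by rewrite ltr_wpDl// !mulr_ge0// ltW.
have /cvgrPdist_lt/(_ _ de0) c1 := dyadic_mesh_cvg0 T.
have /cvgrPdist_le/(_ _ (divr_gt0 eps0 (ltr0n R 2))) c2 := dyadic_mesh_cvg0 K.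
move: c1 c2; apply: filterS2 => n; rewrite !sub0r !normrN !ger0_norm ?divr_ge0 ?exprn_ge0 ?(ltW T0) ?(ltW K0)// => n1 n2.
have Mn : 0 <= 2 * M / 2 ^+ n by rewrite divr_ge0 ?exprn_ge0// mulr_ge0.
apply: (@le_trans _ _ ((2 * e + 2 * M / 2 ^+ n) * T)%:E).
  apply: time_integral_le; [exact: ltW|by rewrite addr_ge0// mulr_ge0// ltW| |].
    by move=> s _; rewrite /sq_dist unlock; apply: integral_ge0 => w _; rewrite lee_fin sqr_ge0.
  move=> s s0 sT; apply: sp_val_sq_dist_le => // s' sT' ss.
  by apply: hde => //; [rewrite sT ltW|exact: le_lt_trans ss n1].
rewrite lee_fin mulrDl (splitr eps) lerD//.
  by rewrite le_eqVlt; apply/orP; left; apply/eqP; rewrite /e; field; rewrite gt_eqF.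
apply: le_trans n2; rewrite mulrAC ler_wpM2r ?invr_ge0 ?exprn_ge0// lerDl//.
Qed.

(** Almost sure convergence comes from the pathwise Itô formula; the bound on the
    left sums improves it to convergence in L^2. *)
Lemma sp_integral_cvg t : 0 <= t <= T ->
  sq_dist P (IRV t) (sp_integral (V n) (fun s => B s) t) @[n --> \oo] --> 0%E.
Proof.
move=> tT; have /andP[t0 tT'] := tT.
pose S n w := \sum_(0 <= k < 2 ^ n) phi (dyadic T n k) w * grid_incr T t (B ^~ w) n k.
pose Q n w := \sum_(0 <= k < 2 ^ n) grid_incr T t (B ^~ w) n k ^+ 2.
pose c1 := Num.max 0 (ito_cst T p nu1 nu2 a b).
have c10 : 0 <= c1 by rewrite le_max lexx.
pose K := c1 * (1 + T) + c1 + 2.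
have K0 : 0 <= K by rewrite !addr_ge0 ?mulr_ge0 ?addr_ge0 ?(ltW T0).
have Q0 n w : 0 <= Q n w by apply: sumr_ge0 => k _; exact: sqr_ge0.
have Sle n w : A w -> `|S n w| <= c1 * G w ^+ N.+3 * (1 + Q n w).
  move=> Aw; apply: le_trans (tame_left_sum_le T0 p2 nu10 nu20 a0 ab b1 ab1 b12 (tame Aw) n tT) _.
  by rewrite ler_wpM2r ?addr_ge0 ?Q0// ler_wpM2r ?exprn_ge0// le_max lexx orbT.
have good : {ae P, forall w, [/\ A w, (S n w @[n --> \oo] --> IRV t w),
   (Q n w @[n --> \oo] --> t) & forall n, `|S n w - sp_integral (V n) (fun s => B s) t w| <=
      2 * G w ^+ (2 * N + 1) / 2 ^+ n]}.
  have aeA : {ae P, forall w, A w} by exact: ae_of_A.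
  apply: filterS3 aeA (qv_ae_cvg T0 tT hB) ae_coef => w Aw qv co; split => //.
  - rewrite [IRV t w](cut_offE _ tT Aw).
    exact: (tame_foellmer T0 p2 nu10 nu20 a0 ab ab1 b12 (tame Aw) cE tT qv).
  - have := qv 0%N 1%N (leqnn 1); rewrite (_ : stopped T t 0 1 = t); last first.
      by rewrite -[1%N]/(2 ^ 0)%N stopped_last.
    by under eq_fun do rewrite add0n mul1n.
  move=> n; rewrite sp_integralE -sumrB.
  apply: le_trans (ler_norm_sum _ _ _) _.
  apply: (@le_trans _ _ (\sum_(0 <= k < 2 ^ n) (G w ^+ (2 * N) / 4 ^+ n * (2 * G w)))).
    apply: ler_sum_nat => k /andP[_ kn]; rewrite -mulrBl normrM.
    have dT : 0 <= dyadic T n k <= T by apply: dyadic_itv => //; exact: ltnW.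
    rewrite co//; have /andP[f0 fG] := phi_le Aw dT.
    have p4 : 0 < 4 ^+ n :> R by rewrite exprn_gt0.
    have /andP[h1 h2] := truncation_le f0 p4; apply: ler_pM => //.
      rewrite ger0_norm//; apply: le_trans h2 _; rewrite ler_wpM2r ?invr_ge0 ?(ltW p4)//.
      by rewrite mulnC exprM; apply: lerXn2r; rewrite ?nnegrE ?exprn_ge0.
    apply: le_trans (ler_normB _ _) _; rewrite mulr_natl mulr2n.
    by apply: lerD; apply: (tame_x (tame Aw)); rewrite stopped_ge0// stopped_leT.
  rewrite sumr_const_nat subn0 -[leLHS]mulr_natl natrX.
  rewrite le_eqVlt; apply/orP; left; apply/eqP.
  have -> : 4 ^+ n = 2 ^+ n * 2 ^+ n :> R by rewrite -exprMn -natrM.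
  rewrite addn1 exprS; field; rewrite expf_neq0//.
rewrite /sq_dist unlock.
have mS n : measurable_fun setT (S n).
  by apply: measurable_sum => k; apply: measurable_funM => //; exact: mY.
have msp n : measurable_fun setT (sp_integral (V n) (fun s => B s) t).
  rewrite (_ : sp_integral _ _ _ = fun w => \sum_(k < 2 ^ n) sp_coef (V n) k w * grid_incr T t (B ^~ w) n k).
    by apply: measurable_sum => k; apply: measurable_funM => //; exact: mV.
  by apply/funext => w; rewrite sp_integralE big_mkord.
apply: (@L2_cvg0_of_moments _ _ _ P (fun n w => IRV t w - sp_integral (V n) (fun s => B s) t w) Q
  (fun w => K * G w ^+ (2 * N + 3)) (gauss_cst 8 * T ^+ 8)) => //.
- by move=> n; apply: measurable_funB => //; exact: (mI t).
- by move=> n; apply: measurable_sum => k; exact: measurable_funX.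
- by apply: measurable_funM => //; exact: measurable_funX.
- by move=> w; rewrite mulr_ge0// exprn_ge0.
- under eq_integral do rewrite exprMn -exprM mulnC EFinM.
  rewrite ge0_integralZl//; first last.
  + by rewrite lee_fin exprn_ge0.
  + by move=> w _; rewrite lee_fin exprn_ge0.
  by rewrite lte_mul_pinfty// lee_fin exprn_ge0.
- by move=> n; exact: qv_moment8.
- move=> n; apply: filterS good => w [Aw Sc Qc dS].
  have Ile : `|IRV t w| <= c1 * G w ^+ N.+3 * (1 + T).
    apply: (@le_trans _ _ (c1 * G w ^+ N.+3 * (1 + t))); last first.
      by apply: ler_wpM2l; [rewrite mulr_ge0// exprn_ge0|rewrite lerD2l].
    have n1 : `|S n w| @[n --> \oo] --> `|IRV t w| by apply: cvg_norm; exact: Sc.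
    have n2 : c1 * G w ^+ N.+3 * (1 + Q n w) @[n --> \oo] --> c1 * G w ^+ N.+3 * (1 + t).
      by apply: cvgMr; apply: cvgD => //; exact: cvg_cst.
    by apply: (ler_cvg_to n1 n2); apply: nearW => m; exact: Sle.
  have Gm j : (j <= 2 * N + 3)%N -> G w ^+ j <= G w ^+ (2 * N + 3) by move=> h; apply: ler_weXn2l.
  have g1 := ler_wpM2l c10 (Gm N.+3 _); have g2 := Gm (2 * N + 1)%N _.
  have {}g1 : c1 * G w ^+ N.+3 <= c1 * G w ^+ (2 * N + 3) by apply: g1; move: (tame_deg p); clear; lia.
  have {}g2 : G w ^+ (2 * N + 1) <= G w ^+ (2 * N + 3) by apply: g2; move: (tame_deg p); clear; lia.
  set Gb := G w ^+ (2 * N + 3) in g1 g2 *; have Gb0 : 0 <= Gb by exact: exprn_ge0.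
  have q0 := Q0 n w; have q2 : 1 <= 1 + Q n w by rewrite lerDl.
  have T1 : 0 <= 1 + T by rewrite addr_ge0// ltW.
  have i1 : `|IRV t w| <= c1 * (1 + T) * Gb * (1 + Q n w).
    apply: le_trans Ile _; apply: (@le_trans _ _ (c1 * Gb * (1 + T))); first by rewrite ler_wpM2r.
    by rewrite mulrAC ler_peMr// !mulr_ge0.
  have i2 : `|S n w| <= c1 * Gb * (1 + Q n w).
    by apply: le_trans (Sle n w Aw) _; rewrite ler_wpM2r// addr_ge0.
  have i3 : `|S n w - sp_integral (V n) (fun s => B s) t w| <= 2 * Gb * (1 + Q n w).
    apply: le_trans (dS n) _; apply: (@le_trans _ _ (2 * Gb)); last by rewrite ler_peMr// mulr_ge0.
    rewrite ler_pdivrMr ?exprn_gt0//; apply: (@le_trans _ _ (2 * Gb)); first by rewrite ler_wpM2l.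
    by rewrite ler_peMr ?mulr_ge0// exprn_ege1// ler1n.
  set Iw := IRV t w in i1 *; set sp := sp_integral _ _ _ _ in i3 *.
  have -> : Iw - sp = Iw - S n w + (S n w - sp) by ring.
  apply: le_trans (ler_normD _ _) _; apply: le_trans (lerD (ler_normB _ _) i3) _.
  by rewrite /K; move: i1 i2; lra.
apply: filterS good => w [Aw Sc Qc dS].
have -> : (fun n => IRV t w - sp_integral (V n) (fun s => B s) t w) =
   fun n => (IRV t w - S n w) + (S n w - sp_integral (V n) (fun s => B s) t w).
  by apply/funext => n; ring.
rewrite -[X in _ --> X](addr0 0); apply: cvgD.
  by rewrite -[X in _ --> X](subrr (IRV t w)); apply: cvgB => //; exact: cvg_cst.
apply/cvgrPdist_le => e e0.
have /cvgrPdist_le/(_ _ e0) := dyadic_mesh_cvg0 (2 * G w ^+ (2 * N + 1)).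
apply: filterS => n; rewrite !sub0r !normrN => h; apply: le_trans (dS n) _.
by apply: le_trans h; exact: ler_norm.
Qed.

End approximating_sequence.

Lemma I_ito : is_ito_integral (joint_filtration B BH) T (fun s => B s) phi (fun t => IRV t).
Proof.
split; last exact: I_continuous.
have [V [gV hV]] := simple_approximation; exists V; split.
  by apply: sp_val_cvg => // n k kn; have [] := hV n k kn.
by move=> t tT; apply: sp_integral_cvg => // n k kn; have [] := hV n k kn.
Qed.

(** The equation is the definition of I; the content is that I is the Itô
    integral. *)
Lemma ito_formula : exists I J : R -> {RV P >-> R},
  [/\ is_ito_integral (joint_filtration B BH) T (fun s => B s) phi I,
      (forall t, 0 <= t <= T -> is_L2_riemann_stieltjes_integral phi BH t (J t)) &
      {ae P, forall w, forall t, 0 <= t <= T ->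
        Y t w `^ p = Y 0 w `^ p + prim (fun s => p * kappa - p * theta * Y s w `^ p) t
          + nu1 * p * I t w + nu2 * p * J t w}].
Proof.
exists IRV, JRV; split; [exact: I_ito|by move=> t; exact: J_riemann_stieltjes|].
by apply: ae_of_A => w Aw t tT; exact: IJ_equation.
Qed.

End assembly.

(** * The equation for the power of the solution *)

Theorem proposition4p4 (R : realType) (d : measure_display)
    (Om : measurableType d) (P : probability Om R)
    (T kappa theta nu1 nu2 H alpha Y0 : R)
    (B BH Y : R -> {RV P >-> R})
    (hT : 0 < T) (hkappa : 0 < kappa) (htheta : 0 < theta)
    (hnu1 : 0 < nu1) (hnu2 : 0 < nu2)
    (hH : 0 < H < 1) (halpha : 1 / 2 < alpha < 1)
    (hHalpha : Num.min H (1 / 2) + alpha > 1)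
    (hH2 : 1 / 2 < H)
    (hY0 : 0 < Y0)
    (hB : wiener_process T B)
    (hBH : fractional_brownian_motion T H BH)
    (hindep : independent_processes P T B BH)
    (hY : positive_solution T kappa theta nu1 nu2 alpha Y0 B BH Y) :
  let X : R -> Om -> R := fun t w => Y t w `^ (1 / (1 - alpha)) in
  let Xalpha : R -> Om -> R := fun t w => X t w `^ alpha in
  exists I J : R -> {RV P >-> R},
    [/\ is_ito_integral (joint_filtration B BH) T B Xalpha I,
        (forall t, 0 <= t <= T ->
           is_L2_riemann_stieltjes_integral Xalpha BH t (J t)) &
        {ae P, forall w, forall t, 0 <= t <= T ->
           X t w = X 0 w
             + \int[lebesgue_measure]_(s in `[0, t])
                 (kappa / (1 - alpha) - theta / (1 - alpha) * X s w)
             + nu1 / (1 - alpha) * I t w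
             + nu2 / (1 - alpha) * J t w}].
Proof.
move=> X Xalpha; have /andP[a2 a1] := halpha; have /andP[_ H1] := hH.
have n1a : 0 < 1 - alpha by rewrite subr_gt0.
have a0 : 0 < alpha by apply: lt_trans a2; rewrite divr_gt0.
pose p := 1 / (1 - alpha); pose c := alpha * nu1 ^+ 2 / (2 * (1 - alpha)).
have p2 : 2 < p by rewrite ltr_pdivlMr//; move: a2; lra.
have c0 : 0 < c by rewrite divr_gt0 ?mulr_gt0 ?exprn_gt0.
have pE : p - 1 = alpha / (1 - alpha) by rewrite /p; field; rewrite gt_eqF.
have cE : c = (p - 1) * nu1 ^+ 2 / 2 by rewrite pE /c; field; rewrite gt_eqF.
have dE y : drift kappa theta nu1 alpha y = rdrift kappa theta c (p - 1) y.
  rewrite /drift /rdrift pE; congr (_ - _ - _).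
  by rewrite /c invfM -!mulrA; congr (_ * _); congr (_ * _); rewrite invfM mulrA.
have hY' : {ae P, forall w, intble T (rdrift kappa theta c (p - 1) \o (Y ^~ w)) /\
    forall t, 0 <= t <= T -> 0 < Y t w /\
      Y t w = Y0 + prim (rdrift kappa theta c (p - 1) \o (Y ^~ w)) t + (nu1 * B t w + nu2 * BH t w)}.
  apply: filterS hY => w [h1 h2]; split.
    by apply: eq_intble h1 => s _ _ /=; rewrite dE.
  move=> t tT; have [h3 h4] := h2 t tT; split => //; rewrite {1}h4; congr (_ + _ + _).
  by apply: eq_prim => s _ _ /=; rewrite dE.
have [G [A [mG G1 iG [mA PA] tame]]] :=
  tame_path_ae hT hkappa htheta c0 p2 hnu1 hnu2 H1 hH2 hB hBH hY' (8 * (2 * tame_deg p + 3)).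
have [I [J [hI hJ hE]]] : exists I J : R -> {RV P >-> R},
  [/\ is_ito_integral (joint_filtration B BH) T (fun s => B s) (fun t w => Y t w `^ (p - 1)) I,
      (forall t, 0 <= t <= T -> is_L2_riemann_stieltjes_integral (fun t w => Y t w `^ (p - 1)) BH t (J t)) &
      {ae P, forall w, forall t, 0 <= t <= T ->
        Y t w `^ p = Y 0 w `^ p + prim (fun s => p * kappa - p * theta * Y s w `^ p) t
          + nu1 * p * I t w + nu2 * p * J t w}].
  apply: (ito_formula hT hkappa htheta c0 p2 hnu1 hnu2 _ _ _ _ _ cE hB mG G1 iG mA PA tame); move: H1 hH2; lra.
have XE : Xalpha = fun t w => Y t w `^ (p - 1).
  apply/funext => t; apply/funext => w; rewrite /Xalpha /X -powRrM; congr (_ `^ _).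
  by rewrite pE; field; rewrite gt_eqF.
exists I, J; rewrite XE; split => //.
apply: filterS hE => w h t tT; rewrite /X -/p (h t tT); congr (_ + _ + _ + _).
- by apply: eq_prim => s _ _; rewrite /p; field; rewrite gt_eqF.
- by rewrite /p; field; rewrite gt_eqF.
- by rewrite /p; field; rewrite gt_eqF.
Qed.
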